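(* Let $m,n$ be positive integers and $\psi:[1,\infty)\to(0,\infty)$ a non-increasing continuous function. If $\int_1^\infty\psi(x)\,dx=\infty$ (resp. $<\infty$), then almost every (resp. almost no) $\Lambda\in X_{m+n}$ is $(\psi,n)$-approximable.
   Context: $X_{m+n}=SL_{m+n}(\mathbb R)/SL_{m+n}(\mathbb Z)$ is the space of unimodular lattices in $\mathbb R^{m+n}$ with its normalized Haar measure. $\|\cdot\|$ is the max norm. For $\mathbf v\in\mathbb R^{m+n}$, $\mathbf v^{(m)}\in\mathbb R^m$ consists of the first $m$ coordinates and $\mathbf v_{(n)}\in\mathbb R^n$ of the last $n$. A lattice $\Lambda$ is $(\psi,n)$-approximable if there exist $\mathbf v\in\Lambda$ with $\|\mathbf v_{(n)}\|$ arbitrarily large such that $\|\mathbf v^{(m)}\|^m\le\psi(\|\mathbf v_{(n)}\|^n)$. *)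

(* Defs.v *)
From HB Require Import structures.
From mathcomp Require Import all_boot all_order all_algebra.
From mathcomp Require Import all_classical all_reals all_analysis.
Set Implicit Arguments. Unset Strict Implicit. Unset Printing Implicit Defensive.
Import Order.TTheory GRing.Theory Num.Theory.
Local Open Scope classical_set_scope.
Local Open Scope ring_scope.

Section Defs.
Variable R : realType.

Definition supnorm (k : nat) (x : 'I_k -> R) : R :=
  \big[Num.max/0]_(i < k) `|x i|.

Definition vtop (m n : nat) (v : 'I_(m + n) -> R) : 'I_m -> R :=
  fun i => v (lshift n i).
Definition vbot (m n : nat) (v : 'I_(m + n) -> R) : 'I_n -> R :=
  fun i => v (rshift m i).

(* The unimodular lattice |det A|^(-1/d) A Z^d spanned by the (rescaled)
   columns of an invertible matrix A : 'M_d. *)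
Definition lattice_of (d : nat) (A : 'M[R]_d) : set ('I_d -> R) :=
  [set v | exists k : 'I_d -> int,
     v = fun i => (`|\det A| `^ (- (d%:R)^-1)) * \sum_(j < d) A i j * (k j)%:~R].

Definition approximable (m n : nat) (psi : R -> R) (L : set ('I_(m + n) -> R)) : Prop :=
  forall T : R, exists2 v, L v &
    T < supnorm (vbot v) /\ supnorm (vtop v) ^+ m <= psi (supnorm (vbot v) ^+ n).

Definition mx_box (d : nat) (a b : 'M[R]_d) : set 'M[R]_d :=
  [set A | forall i j, a i j <= A i j <= b i j].

Definition mx_null (d : nat) (N : set 'M[R]_d) : Prop :=
  forall eps : R, 0 < eps ->
    exists a b : nat -> 'M[R]_d,
      (forall l i j, a l i j <= b l i j) /\
      N `<=` \bigcup_l mx_box (a l) (b l) /\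
      (forall K : nat,
         \sum_(l < K) \prod_(i < d) \prod_(j < d) (b l i j - a l i j) <= eps).
End Defs.
Arguments approximable {R} m n psi L.

(* Main.v *)
Require Import Defs.
From HB Require Import structures.
From mathcomp Require Import all_boot all_order all_algebra.
From mathcomp Require Import all_classical all_reals all_analysis.
From mathcomp Require Import measurable_realfun ring lra zify.
Import Order.TTheory GRing.Theory Num.Theory numFieldNormedType.Exports.
Set Implicit Arguments. Unset Strict Implicit. Unset Printing Implicit Defensive.
Local Open Scope ring_scope.

(** Write [d = m + n], let [y_j] in [R^m] be the first [m] entries of the [j]-th column of [A],
    and consider the integer vectors [k] of sup norm about [N].  Then [A k] has a small top part
    exactly when [y_j0] is close to the point [P_k = - (sum_{j <> j0} k_j y_j) / k_j0].

    Convergence is Borel-Cantelli: for fixed [k] the matrices whose top part [A k] is at most [r]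
    have volume of order [(r / |k|)^m], and there are about [N^d] vectors of norm about [N].

    Divergence: fix all entries except [y_j0].  By the pigeonhole principle every [y_j0] admits some
    [k] of norm at most [N] with top part at most of order [N^(-n/m)].  The case [k_j0 = 0] is
    excluded almost everywhere by Borel-Cantelli, and [0 < |k_j0| < N / E] concerns a small part of
    every box, so most [y_j0] lie within about [N^(-d/m)] of some [P_k].  Hence every box contains
    about [N^d |box|] well-separated points [P_k]; the cubes around them on which [A k] is good
    enough cover a proportion of about [N^n psi (c N^n)], and this series over a geometric sequence
    of values of [N] diverges.  Choosing the cubes greedily, away from those of earlier levels,
    shows that a fixed proportion of every box is reached.  Volumes are measured by counting the
    cells of a fine grid. *)

(** * Volume of covers by boxes *)

(** For a fixed invertible [A] a vector [A k] with small top part has a bottom part comparable to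
    [|k|], so the lattice condition concerns the top rows alone, up to constants depending on [A].
    Invertible matrices are therefore split into countably many classes with uniform constants,
    indexed by a bound [K] and, for divergence, by a choice of columns.

    A proportion reached in every box gives full measure only if it is the same for all boxes,
    however small. This dictates the order of choices: [E], the sparsity [L] of the levels and the
    proportion depend on [m], [n], [K] only; the first level, the number of levels and the grid
    depend on the box.

    The obstacle is the overlap of cubes from different levels. It is removed by forbidding the
    cells near earlier cubes: as long as the proportion already covered is small, few cells are
    forbidden, and once it is no longer small the goal is reached. Disjointness then makes the
    counts add up. On a finite grid, passing from the cells that are reached to those that are
    missed is a subtraction of cardinals, although the sets themselves are only controlled through
    covers. *)

Lemma ler_sum_sub (R : realType) (T : eqType) (s1 s2 : seq T) (w : T -> R) :
  (forall t, 0 <= w t) -> uniq s1 -> uniq s2 -> {subset s1 <= s2} ->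
  \sum_(t <- s1) w t <= \sum_(t <- s2) w t.
Proof.
move=> w0 u1 u2 sub; rewrite [leRHS](bigID (mem s1)) /=.
rewrite -[X in X + _]big_filter.
have /(perm_big _)-> : perm_eq [seq t <- s2 | t \in s1] s1.
  apply: uniq_perm; rewrite ?filter_uniq // => t.
  by rewrite mem_filter; case: (boolP (t \in s1)) => // /sub ->.
by rewrite lerDl sumr_ge0.
Qed.

Section Cover.
Local Open Scope classical_set_scope.
Variables (R : realType) (I : finType).
Implicit Types (N : set (I -> R)) (a b x : I -> R).

Definition box a b : set (I -> R) := [set x | forall i, a i <= x i <= b i].
Definition vol a b : R := \prod_i (b i - a i).

(** Outer volume at most [v], realised by a single cover and expressed through finite partial
    sums. *)
Definition coverable N (v : R) : Prop :=
  exists a b : nat -> I -> R,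
    [/\ forall l i, a l i <= b l i,
        N `<=` \bigcup_l box (a l) (b l) &
        forall K : nat, \sum_(l < K) vol (a l) (b l) <= v].

Definition null N : Prop := forall e : R, 0 < e -> coverable N e.

Lemma vol_ge0 a b : (forall i, a i <= b i) -> 0 <= vol a b.
Proof. by move=> ab; apply: prodr_ge0 => i _; rewrite subr_ge0. Qed.

Lemma coverable_ge0 N v : coverable N v -> 0 <= v.
Proof. by move=> [a [b [_ _ /(_ 0%N)]]]; rewrite big_ord0. Qed.

Lemma coverable_le N N' v v' :
  N' `<=` N -> v <= v' -> coverable N v -> coverable N' v'.
Proof.
move=> NN vv [a [b [ab cov sm]]]; exists a, b; split => //.
  by move=> x /NN /cov.
by move=> K; apply: le_trans (sm K) vv.
Qed.

Lemma null_sub N N' : N' `<=` N -> null N -> null N'.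
Proof. by move=> NN nN e e0; apply: coverable_le (nN e e0). Qed.

Lemma coverable_bigcup (F : nat -> set (I -> R)) (v : nat -> R) (V : R) :
  (forall i, coverable (F i) (v i)) ->
  (forall K : nat, \sum_(i < K) v i <= V) ->
  coverable (\bigcup_i F i) V.
Proof.
move=> /choice[a /choice[b abP]] sV.
have [f bf] : exists f : nat -> nat * nat, bijective f.
  have /card_eqPle[] := card_nat2.
  have := card_nat2; rewrite card_eq_sym => /card_set_bijP[f bf] _ _.
  by exists f; rewrite -setTT_bijective.
have injf := bij_inj bf; case: bf => g fK gK.
have ab i j k : a i j k <= b i j k by have [+ _ _] := abP i; exact.
have v0 p : 0 <= vol (a p.1 p.2) (b p.1 p.2) by exact: vol_ge0.
exists (fun l => a (f l).1 (f l).2), (fun l => b (f l).1 (f l).2); split.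
- by move=> l i; exact: ab.
- move=> x [i _ Fx]; have [_ /(_ _ Fx)[j _ xj] _] := abP i.
  by exists (g (i, j)) => //; rewrite gK.
move=> K.
(* The first [K] pairs lie in a finite rectangle, whose rows are bounded one at a time. *)
pose A := (\max_(l < K) ((f l).1).+1)%N; pose B := (\max_(l < K) ((f l).2).+1)%N.
apply: (@le_trans _ _ (\sum_(i < A) \sum_(j < B) vol (a i j) (b i j))); last first.
  apply: le_trans (sV A); apply: ler_sum => i _.
  by have [_ _] := abP i; exact.
rewrite -(big_mkord predT (fun i => \sum_(j < B) vol (a i j) (b i j))).
rewrite -(big_mkord predT (fun l => vol (a (f l).1 (f l).2) (b (f l).1 (f l).2))).
under [leRHS]eq_bigr do rewrite -(big_mkord predT (fun j => vol (a _ j) (b _ j))).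
rewrite /index_iota !subn0.
rewrite -(big_map f predT (fun p => vol (a p.1 p.2) (b p.1 p.2))).
rewrite -(@big_allpairs _ _ _ _ _ _ _ (fun p => vol (a p.1 p.2) (b p.1 p.2))).
apply: ler_sum_sub => //.
- by rewrite map_inj_uniq ?iota_uniq.
- by rewrite allpairs_uniq ?iota_uniq // => -[? ?] [? ?] _ _ [-> ->].
move=> p /mapP[l]; rewrite mem_iota /= add0n => lK ->.
apply/allpairsP; exists (f l); rewrite !mem_iota /= !add0n.
split; last by case: (f l).
- exact: (@leq_bigmax _ (fun l : 'I_K => (f l).1.+1) (Ordinal lK)).
- exact: (@leq_bigmax _ (fun l : 'I_K => (f l).2.+1) (Ordinal lK)).
Qed.

Lemma null_bigcup (F : nat -> set (I -> R)) :
  (forall i, null (F i)) -> null (\bigcup_i F i).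
Proof.
move=> nF e e0; apply: (@coverable_bigcup _ (fun i => e / 2 ^+ i.+1)).
  by move=> i; apply: nF; rewrite divr_gt0 // exprn_gt0.
move=> K; suff -> : \sum_(i < K) e / 2 ^+ i.+1 = e - e / 2 ^+ K.
  by rewrite gerBl divr_ge0 ?exprn_ge0 // ltW.
elim: K => [|K IH]; first by rewrite big_ord0 expr0 divr1 subrr.
rewrite big_ord_recr /= IH exprS; field.
by rewrite expf_neq0.
Qed.

(** The finite family is padded to a sequence with the degenerate box at [0]. The index [i0] makes
    its volume vanish: over an empty index type the product would be 1. *)
Lemma coverable_fin (i0 : I) (T : finType) (P : pred T) (a b : T -> I -> R) N v :
  (forall t i, a t i <= b t i) ->
  N `<=` [set x | exists2 t, P t & box (a t) (b t) x] ->
  \sum_(t | P t) vol (a t) (b t) <= v -> coverable N v.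
Proof.
move=> ab cov sv.
pose s := [seq t <- enum T | P t].
pose c (f : T -> I -> R) l : I -> R := if onth s l is Some t then f t else 0.
have volc l : vol (c a l) (c b l) = if onth s l is Some t then vol (a t) (b t) else 0.
  rewrite /c; case: onth => // ; apply/eqP; rewrite prodf_seq_eq0.
  by apply/hasP; exists i0; rewrite ?mem_index_enum //= subrr.
exists (c a), (c b); split.
- by move=> l i; rewrite /c; case: onth.
- move=> x /cov[t Pt xt].
  have ts : t \in s by rewrite mem_filter Pt mem_enum.
  by exists (index t s) => //; rewrite /c onthE (nth_map t) ?index_mem ?nth_index.
move=> K; apply: le_trans sv.
under eq_bigr do rewrite volc.
rewrite -(big_mkord predT (fun l => if onth s l is Some t then vol (a t) (b t) else 0)).
rewrite /index_iota subn0.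
have -> : \sum_(t | P t) vol (a t) (b t) = \sum_(t <- s) vol (a t) (b t).
  by rewrite big_filter big_enum_cond.
have vge0 t : 0 <= vol (a t) (b t) by exact: vol_ge0.
elim: s K {volc c} => [|t s IH] [|K]; rewrite ?big_nil //=.
- by rewrite big_cons big1_seq ?addr0 // => -[|l].
- by apply: sumr_ge0.
rewrite 2!big_cons /= lerD2l (iotaDl 1 0) big_map.
exact: IH.
Qed.

Lemma null0 (i0 : I) : null (@set0 (I -> R)).
Proof.
move=> e e0; apply: (@coverable_fin i0 void xpred0 (fun _ => 0) (fun _ => 0)) => //.
by rewrite big_pred0 ?ltW.
Qed.

Lemma null_bigcup_count (i0 : I) (T : countType) (F : T -> set (I -> R)) :
  (forall t, null (F t)) -> null [set x | exists t, F t x].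
Proof.
move=> nF.
apply: (@null_sub (\bigcup_l (if unpickle l is Some t then F t else set0))).
  by move=> x [t Ft]; exists (pickle t) => //; rewrite pickleK.
apply: null_bigcup => l; case: unpickle => [t|]; [exact: nF|exact: null0].
Qed.

Lemma nullU (i0 : I) N N' : null N -> null N' -> null (N `|` N').
Proof.
move=> nN nN'; apply: (@null_sub [set x | exists t : bool, (if t then N else N') x]).
  by move=> x [] ?; [exists true|exists false].
by apply: (null_bigcup_count i0) => -[].
Qed.

(* A substitute for the Lebesgue density theorem that needs no measurability:
   inserting the hypothesis into a cover multiplies its volume by [1 - c]. *)
Lemma null_density (c V0 : R) N : 0 < c -> c <= 1 -> coverable N V0 ->
  (forall a b, (forall i, a i <= b i) ->
     coverable (N `&` box a b) ((1 - c) * vol a b)) ->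
  null N.
Proof.
move=> c0 c1 covN loc e e0.
have step V : coverable N V -> coverable N ((1 - c) * V).
  move=> [a [b [ab cov sm]]].
  apply: (@coverable_le (\bigcup_l (N `&` box (a l) (b l))) _ ((1 - c) * V)) => //.
    by move=> x Nx; have [l _ xl] := cov _ Nx; exists l.
  apply: (@coverable_bigcup _ (fun l => (1 - c) * vol (a l) (b l))) => [l|K].
    exact: loc.
  by rewrite -mulr_sumr ler_wpM2l // subr_ge0.
have V00 := coverable_ge0 covN.
have covn n : coverable N ((1 - c) ^+ n * V0).
  by elim: n => [|n /step]; rewrite ?expr0 ?mul1r // exprS mulrA.
have [n nV] : exists n : nat, (1 - c) ^+ n * V0 < e.
  have cv : (fun n => (1 - c) ^+ n * V0) @ \oo --> (0 * V0 : R).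
    apply: cvgM; last exact: cvg_cst.
    apply: cvg_expr; rewrite ger0_norm ?subr_ge0 //; lra.
  move: cv; rewrite mul0r => /cvgrPdist_lt/(_ _ e0)[n _ /(_ n (leqnn n))] /=.
  rewrite sub0r normrN => h; exists n; apply: le_lt_trans h.
  exact: ler_norm.
exact: coverable_le (ltW nV) (covn n).
Qed.

Lemma coverable_box (i0 : I) a b : (forall i, a i <= b i) -> coverable (box a b) (vol a b).
Proof.
move=> ab; apply: (@coverable_fin i0 unit predT (fun=> a) (fun=> b)) => //.
  by move=> x xab; exists tt.
by rewrite (big_pred1 tt) // => -[].
Qed.

(** Boxes of a cover are clipped to the cube [[- K, K]]. A clipped box has all sides positive, and
    the hypothesis applies, or some side zero and no volume, or some side reversed and no points. *)
Lemma null_density_box (i0 : I) (c K : R) N : 0 < c -> c <= 1 ->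
  N `<=` box (fun=> - K) (fun=> K) ->
  (forall a b, (forall i, - K <= a i) -> (forall i, a i < b i) -> (forall i, b i <= K) ->
     coverable (N `&` box a b) ((1 - c) * vol a b)) ->
  null N.
Proof.
move=> c0 c1 NK loc.
have [K0|K0] := ltP K 0.
  apply: null_sub (null0 i0) => x /NK /(_ i0) /= /andP[? ?]; exfalso; lra.
apply: (@null_density c (vol (fun=> - K) (fun=> K))) => //.
  have KK (i : I) : - K <= K by lra.
  exact: coverable_le NK (lexx _) (coverable_box i0 KK).
move=> a b ab; pose a' i := Num.max (- K) (a i); pose b' i := Num.min K (b i).
have vab := vol_ge0 ab.
have NN : N `&` box a b `<=` N `&` box a' b'.
  move=> x [Nx xab]; split=> // i; have := NK _ Nx i; have := xab i.
  by rewrite /a' /b' ge_max le_min => /andP[-> ->] /andP[-> ->].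
have [/forallP lt'|/forallPn/=[i]] := boolP [forall i, a' i < b' i].
  apply: (coverable_le NN _ (loc a' b' _ lt' _)).
  - apply: ler_wpM2l; first by rewrite subr_ge0.
    apply: ler_prod => i _; rewrite subr_ge0 ltW //=.
    by apply: lerB; rewrite /a' /b' ?le_max ?ge_min lexx orbT.
  - by move=> i; rewrite /a' le_max lexx.
  - by move=> i; rewrite /b' ge_min lexx.
rewrite -leNgt => ba.
have [/eqP ba'|bna] := boolP (b' i == a' i); last first.
  apply: (@coverable_fin i0 void xpred0 (fun _ => 0) (fun _ => 0)) => //.
    move=> x /NN[_ /(_ i)] /andP[h1 h2].
    by have := le_trans h1 h2; rewrite leNgt lt_neqAle bna ba.
  by rewrite big_pred0 // mulr_ge0 // subr_ge0.
have [/forallP le'|/forallPn/=[j]] := boolP [forall i, a' i <= b' i].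
  have NB : N `&` box a b `<=` box a' b' by move=> x /NN[].
  apply: coverable_le NB _ (coverable_box i0 le').
  rewrite /vol (bigD1 i) //= ba' subrr mul0r mulr_ge0 // subr_ge0 //.
rewrite -ltNge => ba''.
apply: (@coverable_fin i0 void xpred0 (fun _ => 0) (fun _ => 0)) => //.
  by move=> x /NN[_ /(_ j)] /andP[h1 h2]; have := le_trans h1 h2; rewrite leNgt ba''.
by rewrite big_pred0 // mulr_ge0 // subr_ge0.
Qed.

End Cover.

(** * Grids and counting *)

(** The index is the truncation of [(t - a) / w], with [w] the cell width, except at the right
    endpoint, where that would be [M] and the last cell serves. A degenerate interval uses cell
    0. *)
Lemma ord_cell (R : realType) (M : nat) (a b t : R) :
  (0 < M)%N -> a <= t <= b ->
  exists x : 'I_M, a + x%:R * ((b - a) / M%:R) <= t <= a + x%:R * ((b - a) / M%:R) + (b - a) / M%:R.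
Proof.
case: M => // M _ /andP[at_ tb].
have M0 : 0 < M.+1%:R :> R by rewrite ltr0n.
have [ab|ba] := ltP a b; last first.
  exists ord0; have -> : b = a by apply/le_anti; rewrite ba (le_trans at_ tb).
  rewrite subrr !mul0r !addr0; have := le_trans tb ba; lra.
set w := (b - a) / M.+1%:R.
have w0 : 0 < w by rewrite divr_gt0 // subr_gt0.
have bE : b = a + M.+1%:R * w by rewrite /w mulrCA divff ?gt_eqF // mulr1 addrC subrK.
pose q := (t - a) / w.
have q0 : 0 <= q by rewrite divr_ge0 ?subr_ge0 // ltW.
have qt : t = a + q * w by rewrite /q divfK ?gt_eqF // addrC subrK.
have /andP[h1 h2] := truncn_itv q0.
have [lt|ge] := ltnP (Num.truncn q) M.+1.
  exists (Ordinal lt) => /=; rewrite qt lerD2l ler_pM2r // h1 /=.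
  by rewrite -addrA lerD2l -[X in _ + X]mul1r -mulrDl natr1 ler_pM2r // ltW.
exists ord_max => /=.
have Mq : M.+1%:R <= q by apply: le_trans h1; rewrite ler_nat.
have tb' : t = b.
  by apply/le_anti; rewrite tb bE qt lerD2l ler_pM2r.
rewrite tb' bE lerD2l ler_pM2r // ler_nat leqnSn /=.
by rewrite -addrA lerD2l -[X in _ + X]mul1r -mulrDl natr1.
Qed.

Section Count.
Variable R : realType.

Lemma card_itv_le (M : nat) (p : pred 'I_M) (al be : R) : al <= be ->
  (forall x, p x -> al <= x%:R <= be) ->
  #|p|%:R <= be - al + 1.
Proof.
move=> ab pP; pose k := Num.truncn (be - al).
have d0 : 0 <= be - al by rewrite subr_ge0.
apply: (@le_trans _ _ k.+1%:R); last first.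
  by rewrite -natr1 lerD2r; have /andP[] := truncn_itv d0.
rewrite ler_nat; have [->//|] := posnP #|p|; case/card_gt0P => y py.
have [x0 px0 minx] := arg_minnP (fun x : 'I_M => x : nat) py.
have xk x : p x -> (x - x0 < k.+1)%N.
  move=> px; have /andP[_ xb] := pP _ px; have /andP[ax _] := pP _ px0.
  rewrite ltnS truncn_ge_nat // natrB ?minx //; lra.
pose f (x : 'I_M) : 'I_k.+1 := inord (x - x0).
have finj : {in p &, injective f}.
  move=> x x' px px' /(congr1 val); rewrite /= !inordK ?xk // => e.
  by apply/val_inj; rewrite /= -(subnK (minx _ px)) e subnK // minx.
by rewrite -[leqRHS](card_ord k.+1) -(card_in_image finj) max_card.
Qed.

Lemma card_itv_ge (M : nat) (p : pred 'I_M) (al be : R) : 0 <= al -> be < M%:R ->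
  (forall x : 'I_M, al <= x%:R <= be -> p x) ->
  be - al - 1 <= #|p|%:R.
Proof.
move=> a0 bM pP; have [ba|ab] := ltP be al.
  by apply: (@le_trans _ _ 0); rewrite ?ler0n //; lra.
pose k := Num.truncn (be - al); pose a1 := (Num.truncn al).+1.
have d0 : 0 <= be - al by rewrite subr_ge0.
have /andP[k1 k2] := truncn_itv d0; have /andP[t1 t2] := truncn_itv a0.
apply: (@le_trans _ _ k%:R); first by rewrite -natr1 in k2; rewrite lerBlDr ltW.
have jP (j : 'I_k) : (a1 + j < M)%N.
  rewrite -(ltr_nat R); apply: le_lt_trans bM.
  have : (j.+1 <= k)%N by []; rewrite -(ler_nat R) -natr1 natrD -natr1.
  rewrite -/k in k1; lra.
pose f j := Ordinal (jP j).
have fp j : f j \in p.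
  apply: pP => /=; rewrite natrD; apply/andP; split.
    by apply: (le_trans (ltW t2)); rewrite lerDl ler0n.
  have : (j.+1 <= k)%N by []; rewrite -(ler_nat R) -natr1 -natr1.
  rewrite -/k in k1; lra.
have finj : injective f by move=> j j' /(congr1 val) /addnI/val_inj.
rewrite ler_nat -[leqLHS](card_ord k) -(card_codom finj).
by apply: subset_leq_card; apply/fintype.subsetP => x /codomP[j ->].
Qed.

Lemma card_family_prod (J S : finType) (F : J -> pred S) :
  #|[pred s : {ffun J -> S} | [forall j, F j (s j)]]|%:R = \prod_j #|F j|%:R :> R.
Proof.
have -> : #|[pred s : {ffun J -> S} | [forall j, F j (s j)]]| = #|family F|.
  by apply: eq_card => s; rewrite inE; apply/forallP/forallP => h j; exact: h.
rewrite card_family -natr_prod foldrE /image_mem big_map big_enum //.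
Qed.

Lemma card_box_le (J : finType) (M : nat) (P : pred {ffun J -> 'I_M}) (al be : J -> R) :
  (forall j, al j <= be j) ->
  (forall s j, P s -> al j <= (s j)%:R <= be j) ->
  #|P|%:R <= \prod_j (be j - al j + 1).
Proof.
move=> ab PP; pose F j : pred 'I_M := fun x => al j <= x%:R <= be j.
apply: (@le_trans _ _ (\prod_j #|F j|%:R)).
  rewrite -card_family_prod ler_nat subset_leq_card //.
  by apply/fintype.subsetP => s Ps; rewrite inE; apply/forallP => j; exact: PP.
by apply: ler_prod => j _; rewrite ler0n /= card_itv_le.
Qed.

Lemma card_box_ge (J : finType) (M : nat) (P : pred {ffun J -> 'I_M}) (al be : J -> R) :
  (forall j, 0 <= al j) -> (forall j, be j < M%:R) -> (forall j, 0 <= be j - al j - 1) ->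
  (forall s : {ffun J -> 'I_M}, (forall j, al j <= (s j)%:R <= be j) -> P s) ->
  \prod_j (be j - al j - 1) <= #|P|%:R.
Proof.
move=> a0 bM ab PP; pose F j : pred 'I_M := fun x => al j <= x%:R <= be j.
apply: (@le_trans _ _ (\prod_j #|F j|%:R)).
  by apply: ler_prod => j _; rewrite ab /= (@card_itv_ge _ (F j) (al j) (be j)).
rewrite -card_family_prod ler_nat subset_leq_card //.
by apply/fintype.subsetP => s; rewrite inE => /forallP Fs; exact: PP.
Qed.

(** Separates the coordinates that vary, namely the image of [g], from those that stay fixed. *)
Definition gluef (J I : finType) (S : Type) (g : J -> I) (tau : I -> S) (ka : J -> S) : {ffun I -> S} :=
  [ffun i => if [pick j | g j == i] is Some j then ka j else tau i].

Lemma gluef_in (J I : finType) S (g : J -> I) (tau : I -> S) (ka : J -> S) j :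
  injective g -> gluef g tau ka (g j) = ka j.
Proof.
by move=> gi; rewrite ffunE; case: pickP => [j' /eqP/gi->//|/(_ j)]; rewrite eqxx.
Qed.

Lemma gluef_out (J I : finType) S (g : J -> I) (tau : I -> S) (ka : J -> S) i :
  (forall j, g j != i) -> gluef g tau ka i = tau i.
Proof. by move=> gi; rewrite ffunE; case: pickP => // j /eqP e; have := gi j; rewrite e eqxx. Qed.

(** Discrete Fubini. Resetting the coordinates in the image of [g] to [s0] labels the slices, and
    there are [#|S| ^ (#|I| - #|J|)] labels. *)
Lemma card_fiber (J I S : finType) (g : J -> I) (s0 : S) (T : pred {ffun I -> S}) (c : R) :
  injective g ->
  (forall tau : {ffun I -> S}, #|[pred ka : {ffun J -> S} | T (gluef g tau ka)]|%:R <= c) ->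
  #|T|%:R <= c * #|S|%:R ^+ (#|I| - #|J|).
Proof.
move=> gi fib.
pose D : {set I} := (~: [set g j | j in J])%SET.
pose r (s : {ffun I -> S}) : {ffun I -> S} := gluef g s (fun=> s0).
have rD s : pffun_on s0 (mem D) predT (r s).
  apply/pffun_onP; split=> // ; apply/fintype.subsetP => i /=; rewrite !inE => ri.
  apply/negP => /imsetP[j _ ij]; move: ri; rewrite ij.
  by rewrite /r gluef_in // eqxx.
have cD : #|pffun_on s0 (mem D) predT : pred {ffun I -> S}| = (#|S| ^ (#|I| - #|J|))%N.
  by rewrite card_pffun_on cardsCs finset.setCK card_imset.
rewrite -natrX -cD -sum1_card (partition_big r (pffun_on s0 (mem D) predT)) /=; last by move=> s _; exact: rD.
rewrite natr_sum -[in leRHS]sum1_card natr_sum mulr_sumr; apply: ler_sum => t tP.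
rewrite mulr1; apply: le_trans (fib t).
rewrite ler_nat sum1_card.
pose h (s : {ffun I -> S}) : {ffun J -> S} := [ffun j => s (g j)].
have gl s : r s = t -> gluef g t (h s) = s.
  move=> <-; apply/ffunP => i; rewrite ffunE.
  case: pickP => [j /eqP <-|gi']; first by rewrite ffunE.
  by rewrite /r gluef_out // => j; rewrite gi'.
have ih : {in [pred s | T s & r s == t] &, injective h}.
  move=> s s' /andP[_ /eqP rs] /andP[_ /eqP rs'] hs.
  by rewrite -(gl _ rs) -(gl _ rs') hs.
rewrite -(card_in_image ih); apply: subset_leq_card; apply/fintype.subsetP => k /fintype.imageP[s /andP[Ts /eqP rs] ->].
by rewrite inE gl.
Qed.

End Count.

Section Grid.
Local Open Scope classical_set_scope.
Variables (R : realType) (I : finType).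

Definition gpt (a b : I -> R) M (s : {ffun I -> 'I_M}) (i : I) : R :=
  a i + (s i)%:R * ((b i - a i) / M%:R).

Definition gcell (a b : I -> R) M (s : {ffun I -> 'I_M}) : set (I -> R) :=
  box (gpt a b s) (fun i => gpt a b s i + (b i - a i) / M%:R).

Lemma gcell_ex (a b x : I -> R) M : (0 < M)%N -> box a b x ->
  exists s : {ffun I -> 'I_M}, gcell a b s x.
Proof.
move=> M0 xab; have /choice[f fP] := fun i => ord_cell M0 (xab i).
by exists (finfun f) => i; rewrite /gpt ffunE; exact: fP.
Qed.

(** All cells have the same volume, so covering by the cells that meet [N] reduces a volume bound to
    a cardinality bound. *)
Lemma coverable_grid (i0 : I) (a b : I -> R) (M : nat) (N : set (I -> R))
    (T : pred {ffun I -> 'I_M}) (ga : R) :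
  (0 < M)%N -> (forall i, a i <= b i) -> N `<=` box a b ->
  (forall x s, N x -> gcell a b s x -> T s) ->
  #|T|%:R <= ga * M%:R ^+ #|I| ->
  coverable N (ga * vol a b).
Proof.
move=> M0 ab NB NT cT; have M0' : 0 < M%:R :> R by rewrite ltr0n.
have w0 i : 0 <= (b i - a i) / M%:R by rewrite divr_ge0 ?subr_ge0 // ltW.
apply: (@coverable_fin _ _ i0 _ T (fun s => gpt a b s)
   (fun s i => gpt a b s i + (b i - a i) / M%:R)).
- by move=> s i; rewrite lerDl.
- by move=> x Nx; have [s sx] := gcell_ex M0 (NB _ Nx); exists s => //; exact: NT sx.
have -> : \sum_(t | T t) vol (gpt a b t) (fun i => gpt a b t i + (b i - a i) / M%:R) =
   #|T|%:R * (vol a b / M%:R ^+ #|I|).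
  rewrite -sum1_card natr_sum mulr_suml; apply: eq_bigr => s _; rewrite mul1r.
  transitivity (\prod_i ((b i - a i) / M%:R)).
    by apply: eq_bigr => i _; rewrite addrC addKr.
  by rewrite big_split /= prodr_const exprVn.
rewrite mulrCA [leRHS]mulrC ler_wpM2l ?vol_ge0 //.
by rewrite ler_pdivrMr // exprn_gt0.
Qed.

End Grid.

Lemma card_partition_le (R : realType) (T U : finType) (P : pred T) (Q : pred U) (r : T -> U) (c : R) :
  (forall t, P t -> Q (r t)) ->
  (forall u, Q u -> #|[pred t | P t & r t == u]|%:R <= c) ->
  #|P|%:R <= #|Q|%:R * c.
Proof.
move=> PQ fib; rewrite -sum1_card (partition_big r Q) //= natr_sum.
rewrite -[in leRHS]sum1_card natr_sum mulr_suml; apply: ler_sum => u Qu.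
by rewrite mul1r; apply: le_trans (fib u Qu); rewrite sum1_card.
Qed.

Lemma card_exists_le (R : realType) (T U : finType) (P : pred T) (Q : pred U) (E : U -> pred T) (c : U -> R) :
  (forall t, P t -> exists2 u, Q u & E u t) ->
  (forall u, Q u -> #|E u|%:R <= c u) ->
  #|P|%:R <= \sum_(u | Q u) c u.
Proof.
move=> PE Ec; apply: (@le_trans _ _ (\sum_(u | Q u) #|E u|%:R)); last exact: ler_sum.
have : (#|P| <= #|\bigcup_(u | Q u) [set t | E u t]|)%N.
  apply: subset_leq_card; apply/fintype.subsetP => t /PE[u Qu Eu].
  by apply/bigcupP; exists u => //; rewrite inE.
rewrite -(ler_nat R) => /le_trans; apply.
rewrite -natr_sum ler_nat; elim/big_rec2: _ => [|u A n Qu h]; first by rewrite cards0.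
apply: leq_trans (leq_card_setU _ _).1 _; rewrite leq_add //.
by rewrite cardsE.
Qed.

Section Cubes.
Variables (R : realType) (J : finType) (a b : J -> R) (M : nat).
Hypothesis ab : forall i, a i < b i.
Hypothesis M0 : (0 < M)%N.
Let w i := (b i - a i) / M%:R.
Let x (ka : {ffun J -> 'I_M}) i := gpt a b ka i.

(** Number of grid cells per unit of volume. *)
Definition dens : R := M%:R ^+ #|J| / vol a b.

Let w0 i : 0 < w i. Proof. by rewrite divr_gt0 ?subr_gt0 // ltr0n. Qed.

Lemma densE : dens = \prod_i (w i)^-1.
Proof.
rewrite prodfV /w big_split /= prodr_const exprVn invf_div //.
Qed.

Lemma dens_gt0 : 0 < dens.
Proof. by rewrite densE prodr_gt0 // => i _; rewrite invr_gt0. Qed.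

Lemma dens_vol : dens * vol a b = M%:R ^+ #|J|.
Proof. by rewrite divfK // gt_eqF // prodr_gt0 // => i _; rewrite subr_gt0. Qed.

Lemma prod_w (c : R) : \prod_i (c / w i) = c ^+ #|J| * dens.
Proof. by rewrite big_split /= prodr_const densE. Qed.

Lemma gpt_bound ka i : a i <= x ka i <= b i.
Proof.
rewrite /x /gpt lerDl mulr_ge0 ?(ltW (w0 i)) //=.
rewrite -lerBrDl mulrCA -ler_pdivlMl ?subr_gt0 // mulVf ?gt_eqF ?subr_gt0 //.
by rewrite ler_pdivrMr ?ltr0n // mul1r ler_nat ltnW.
Qed.

(** Because [w i <= rho], a side of length [2 rho] carries at most [2 rho / w i + 1 <= 3 rho / w i]
    grid points. In [cube_ge] the loss goes the other way: [2 rho / w i - 1 >= rho / w i]. *)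
Lemma cube_le (P : pred {ffun J -> 'I_M}) (p : J -> R) rho : (forall i, w i <= rho) ->
  (forall ka i, P ka -> `|x ka i - p i| <= rho) -> #|P|%:R <= (3 * rho) ^+ #|J| * dens.
Proof.
move=> wr PP.
pose al i := (p i - rho - a i) / w i; pose be i := (p i + rho - a i) / w i.
apply: le_trans (@card_box_le R J M P al be _ _) _.
- by move=> j; rewrite ler_pM2r ?invr_gt0 //; have := lt_le_trans (w0 j) (wr j); lra.
- move=> s j /(PP s j); rewrite ler_norml /x /gpt -/(w j) => h.
  by rewrite ler_pdivrMr // ler_pdivlMr //; lra.
rewrite -prod_w; apply: ler_prod => i _; apply/andP; split.
  by rewrite addr_ge0 // /be /al -mulrBl mulr_ge0 ?invr_ge0 ?(ltW (w0 _)) //; have := lt_le_trans (w0 i) (wr i); lra.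
have -> : be i - al i = 2 * rho / w i by rewrite /be /al; field; rewrite gt_eqF.
by rewrite -[X in _ + X](divff (lt0r_neq0 (w0 i))) -mulrDl ler_pM2r ?invr_gt0 //; have := wr i; lra.
Qed.

Lemma cube_ge (P : pred {ffun J -> 'I_M}) (p : J -> R) rho : (forall i, w i <= rho) ->
  (forall i, a i <= p i - rho) -> (forall i, p i + rho < b i) ->
  (forall ka, (forall i, `|x ka i - p i| <= rho) -> P ka) -> rho ^+ #|J| * dens <= #|P|%:R.
Proof.
move=> wr ap pb PP.
pose al i := (p i - rho - a i) / w i; pose be i := (p i + rho - a i) / w i.
have beal i : be i - al i - 1 = 2 * rho / w i - 1 by rewrite /be /al; field; rewrite gt_eqF.
have h1 i : 1 <= rho / w i by rewrite ler_pdivlMr // mul1r.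
apply: le_trans (@card_box_ge R J M P al be _ _ _ _).
- rewrite -prod_w; apply: ler_prod => i _; rewrite beal -mulrA; have := h1 i; lra.
- by move=> j; rewrite divr_ge0 ?(ltW (w0 j)) //; have := ap j; lra.
- move=> j; rewrite ltr_pdivrMr //.
  have -> : M%:R * w j = b j - a j by rewrite /w mulrCA divff ?mulr1 // gt_eqF // ltr0n.
  have := pb j; lra.
- by move=> j; rewrite beal -mulrA; have := h1 j; lra.
move=> s h; apply: PP => i; have /andP[] := h i.
by rewrite ler_pdivrMr // ler_pdivlMr // ler_norml /x /gpt -/(w i); lra.
Qed.

End Cubes.

(** The target box is cut into at most [\prod_i (w i + 1)] unit cells. Two integer vectors with
    images in one cell differ by a vector with image at most 1; as [Z] inverts [yf], their
    coordinates differ by at most [m K], so a cell receives at most [(2 m K + 1) ^ m] vectors. *)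
Lemma card_lattice_le (R : realType) (m M : nat) (yf Z : 'I_m -> 'I_m -> R) (K : R)
    (P : pred {ffun 'I_m -> 'I_M}) (lo w : 'I_m -> R) :
  0 <= K ->
  (forall (c : 'I_m -> R) l, c l = \sum_i Z l i * \sum_l' c l' * yf l' i) ->
  (forall l i, `|Z l i| <= K) ->
  (forall i, 0 <= w i) ->
  (forall ka i, P ka -> lo i <= \sum_l (ka l)%:R * yf l i <= lo i + w i) ->
  #|P|%:R <= (2 * (m%:R * K) + 1) ^+ m * \prod_i (w i + 1).
Proof.
move=> K0 ZE ZK w0 PP.
have mK0 : 0 <= m%:R * K by rewrite mulr_ge0.
pose S (ka : {ffun 'I_m -> 'I_M}) i : R := \sum_l (ka l)%:R * yf l i.
pose B := (\max_i Num.truncn (w i))%N.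
pose r ka : {ffun 'I_m -> 'I_B.+1} := [ffun i => inord (Num.truncn (S ka i - lo i))].
have tB ka i : P ka -> (Num.truncn (S ka i - lo i) <= Num.truncn (w i))%N.
  by move=> /(PP ka i) h; apply: le_truncn; rewrite -/(S ka i) in h; lra.
have rE ka i : P ka -> r ka i = Num.truncn (S ka i - lo i) :> nat.
  move=> Pka; rewrite ffunE inordK // ltnS (leq_trans (tB _ i Pka)) //.
  exact: (@leq_bigmax _ (fun i => Num.truncn (w i)) i).
pose Q : pred {ffun 'I_m -> 'I_B.+1} := fun s => [forall i, s i <= Num.truncn (w i)]%N.
rewrite mulrC.
apply: (@le_trans _ _ (#|Q|%:R * (2 * (m%:R * K) + 1) ^+ m)).
  apply: (@card_partition_le R _ _ P Q r) => [ka Pka|u _].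
    by apply/forallP => i; rewrite rE // tB.
  have [ka0 /andP[P0 /eqP r0]|none] := pickP [pred t | P t & r t == u]; last first.
    by rewrite eq_card0 // exprn_ge0 // addr_ge0 // !mulr_ge0.
  apply: le_trans (@card_box_le R _ M _ (fun l => (ka0 l)%:R - m%:R * K)
     (fun l => (ka0 l)%:R + m%:R * K) _ _) _.
  - by move=> j /=; lra.
  - move=> ka l /andP[Pka /eqP rka].
    suff : `|(ka l)%:R - (ka0 l)%:R| <= m%:R * K by rewrite ler_norml; lra.
    rewrite (ZE (fun l => (ka l)%:R - (ka0 l)%:R)) (le_trans (ler_norm_sum _ _ _)) //.
    rewrite -[m in leRHS]card_ord mulr_natl -sumr_const; apply: ler_sum => i _.
    rewrite normrM -[leRHS]mulr1; apply: ler_pM => //.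
    have -> : \sum_l' ((ka l')%:R - (ka0 l')%:R) * yf l' i = S ka i - S ka0 i.
      by rewrite /S -sumrB; apply: eq_bigr => l' _; rewrite mulrBl.
    have e : Num.truncn (S ka i - lo i) = Num.truncn (S ka0 i - lo i).
      by rewrite -!rE // rka r0.
    have := PP ka i Pka; have := PP ka0 i P0; rewrite -/(S ka i) -/(S ka0 i) => h0 h.
    have g0 : 0 <= S ka i - lo i by lra.
    have g0' : 0 <= S ka0 i - lo i by lra.
    have := truncn_itv g0; have := truncn_itv g0'; rewrite e -natr1 ler_norml; lra.
  rewrite -[leRHS]mulr1 -[X in _ ^+ X]card_ord -prodr_const mulr1.
  by apply: ler_prod => i _; lra.
rewrite ler_wpM2r ?exprn_ge0 ?addr_ge0 ?mulr_ge0 //.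
apply: le_trans (@card_box_le R _ _ Q (fun=> 0) (fun i => (Num.truncn (w i))%:R) _ _) _ => //.
  by move=> s j /forallP/(_ j); rewrite ler_nat ler0n.
apply: ler_prod => i _; rewrite subr0 addr_ge0 //= lerD2r.
by have /andP[] := truncn_itv (w0 i).
Qed.

(** * Integer vectors with a small coordinate *)

Section Lin.
Variables (R : realType) (m d N : nat) (j0 : 'I_d) (y : 'I_d -> 'I_m -> R).

(* Integers of absolute value at most [N] are encoded as ordinals shifted by [N]. *)
Definition zr (s : 'I_(2 * N).+1) : R := s%:R - N%:R.

Lemma zr_le s : `|zr s| <= N%:R.
Proof.
have : (s <= 2 * N)%N by rewrite -ltnS.
rewrite -(ler_nat R) natrM ler_norml /zr; have : 0 <= s%:R :> R by []. lra.
Qed.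

Lemma zr_int s : zr s = (s%:Z - N%:Z)%:~R.
Proof. by rewrite intrB. Qed.

Lemma zr_ge1 s : zr s != 0 -> 1 <= `|zr s|.
Proof.
rewrite zr_int intr_eq0 -intr_norm -[1]/(1%:~R) ler_int => h.
by rewrite -gtz0_ge1 normr_gt0.
Qed.

Definition tail (s : {ffun 'I_d -> 'I_(2 * N).+1}) i : R :=
  \sum_(j | j != j0) zr (s j) * y j i.

(** Coordinate [i] of the top part of [A k] when the column [j0] is [x]; the other columns enter
    through [tail] only, and the zero in [x] is the point [P_k]. *)
Definition lin (s : {ffun 'I_d -> 'I_(2 * N).+1}) (x : 'I_m -> R) i : R := zr (s j0) * x i + tail s i.

End Lin.

(** Terms with [|h| > D] are at most [2 ^ m], and there are at most [2 N / E + 1] of them; the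
    others are at most [(1 + D) ^ m] since [|h| >= 1], and there are at most [2 D + 1]. Only the
    first group grows with [N], and it carries the factor [1 / E]. *)
Lemma sum_inv_le (R : realType) (m N E : nat) (D : R) : 0 <= D -> (0 < E)%N ->
  \sum_(h : 'I_(2 * N).+1 | (zr R h != 0) && (E%:R * `|zr R h| < N%:R)) (1 + D / `|zr R h|) ^+ m
  <= 2 ^+ m * (2 * N%:R / E%:R + 1) + (1 + D) ^+ m * (2 * D + 1).
Proof.
move=> D0 E0; have E0' : 0 < E%:R :> R by rewrite ltr0n.
rewrite (bigID (fun h => `|zr R h| <= D)) /= addrC; apply: lerD.
- apply: (@le_trans _ _ (\sum_(h : 'I_(2 * N).+1 | E%:R * `|zr R h| < N%:R) 2 ^+ m)).
    rewrite big_mkcondr /= big_mkcond [leRHS]big_mkcond /=; apply: ler_sum => h _.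
    case: (E%:R * _ < _); rewrite ?andbF ?andbT //.
    case: ifP => [h0|_]; rewrite ?exprn_ge0 //.
    case: ifP => [hD|_]; rewrite ?exprn_ge0 //.
    have h1 : 0 < `|zr R h| by rewrite normr_gt0.
    rewrite lerXn2r ?nnegrE //; first by rewrite addr_ge0 // divr_ge0.
    rewrite -[leRHS]/(1 + 1) lerD2l ler_pdivrMr // mul1r ltW // ltNge.
    by rewrite hD.
  rewrite sumr_const -[_ *+ _]mulr_natr ler_wpM2l ?exprn_ge0 //.
  apply: le_trans (@card_itv_le R _ _ (N%:R - N%:R / E%:R) (N%:R + N%:R / E%:R) _ _) _.
  + have : 0 <= N%:R / E%:R :> R by rewrite divr_ge0 // ltW.
    lra.
  + move=> h hE; have {hE} : E%:R * `|zr R h| < N%:R by [].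
    rewrite mulrC -ltr_pdivlMr // => /ltW.
    by rewrite ler_norml /zr; lra.
  + by rewrite lerD2r; lra.
apply: (@le_trans _ _ (\sum_(h : 'I_(2 * N).+1 | `|zr R h| <= D) (1 + D) ^+ m)).
  rewrite big_mkcondr /= big_mkcond [leRHS]big_mkcond /=; apply: ler_sum => h _.
  case: (`|_| <= D); last by case: ifP.
  case: ifP => [/andP[h0 _]|_]; rewrite ?exprn_ge0 ?addr_ge0 //.
  have := zr_ge1 h0 => h1.
  rewrite lerXn2r ?nnegrE ?addr_ge0 ?divr_ge0 // lerD2l ler_pdivrMr ?(lt_le_trans _ h1) //.
  by rewrite ler_peMr.
rewrite sumr_const -[_ *+ _]mulr_natr ler_wpM2l ?exprn_ge0 ?addr_ge0 //.
apply: le_trans (@card_itv_le R _ _ (N%:R - D) (N%:R + D) _ _) _.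
+ lra.
+ move=> h hE; have {hE} : `|zr R h| <= D by [].
  by rewrite ler_norml /zr; lra.
+ by rewrite lerD2r; lra.
Qed.

Section Small.
Variables (R : realType) (m d N E M : nat) (j0 : 'I_d) (f : 'I_m -> 'I_d).
Variables (y : 'I_d -> 'I_m -> R) (Z : 'I_m -> 'I_m -> R) (K r D : R) (a b : 'I_m -> R).
Hypothesis K0 : 0 <= K.
Hypothesis fi : injective f.
Hypothesis fj0 : forall l, f l != j0.
Hypothesis ZE : forall (c : 'I_m -> R) l, c l = \sum_i Z l i * \sum_l' c l' * y (f l') i.
Hypothesis ZK : forall l i, `|Z l i| <= K.
Hypothesis ab : forall i, a i < b i.
Hypothesis M0 : (0 < M)%N.
Hypothesis N0 : (0 < N)%N.
Hypothesis E0 : (0 < E)%N.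
Hypothesis r0 : 0 < r.
Hypothesis wr : forall i, (b i - a i) / M%:R <= r / N%:R.
Hypothesis D0 : 0 <= D.
Hypothesis Dr : forall i, 2 * r + 1 <= D * (b i - a i).

Let tl := tail (N := N) j0 y.
Let ln := lin (N := N) j0 y.
Let g (o : option 'I_m) : 'I_d := if o is Some l then f l else j0.

Let gi : injective g.
Proof.
move=> [l|] [l'|] //= => [/fi -> //|e|e].
  by have := fj0 l; rewrite e eqxx.
by have := fj0 l'; rewrite -e eqxx.
Qed.

(** Once [k_j0 = h] and the [d - m - 1] coordinates outside [j0] and the image of [f] are fixed, the
    combination of the columns [f l] must lie in a box of sides [|h| (b i - a i) + 2 r], and
    [card_lattice_le] counts the solutions. *)
Lemma card_small_fiber (h : 'I_(2 * N).+1) (T : pred {ffun 'I_d -> 'I_(2 * N).+1}) :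
  (forall s, T s -> s j0 = h /\
     exists2 x : 'I_m -> R, (forall i, a i <= x i <= b i) & forall i, `|ln s x i| <= r) ->
  #|T|%:R <= (2 * (m%:R * K) + 1) ^+ m * \prod_i (`|zr R h| * (b i - a i) + 2 * r + 1)
     * (2 * N).+1%:R ^+ (d - m.+1).
Proof.
move=> TP.
have -> : m.+1 = #|{: option 'I_m}| by rewrite card_option card_ord.
rewrite -[d in (_ ^+ (d - _))]card_ord -[(2 * N).+1 in leRHS]card_ord.
apply: (card_fiber (g := g) ord0 gi) => tau.
(* The slices of [card_fiber] vary [m + 1] coordinates, but the one at [j0] is forced to be [h]. *)
pose sh (k : {ffun 'I_m -> 'I_(2 * N).+1}) : {ffun option 'I_m -> 'I_(2 * N).+1} :=
  [ffun o => if o is Some l then k l else h].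
pose P : pred {ffun 'I_m -> 'I_(2 * N).+1} := fun k => T (gluef g tau (sh k)).
apply: (@le_trans _ _ #|P|%:R).
  pose p (k : {ffun option 'I_m -> 'I_(2 * N).+1}) : {ffun 'I_m -> 'I_(2 * N).+1} :=
    [ffun l => k (Some l)].
  have shp (k : {ffun option 'I_m -> 'I_(2 * N).+1}) : T (gluef g tau k) -> sh (p k) = k.
    move=> /TP[+ _]; rewrite -[j0]/(g None) gluef_in // => e.
    by apply/ffunP => -[l|]; rewrite !ffunE //=.
  rewrite ler_nat -(@card_in_image _ _ p); last first.
    by move=> k k' /shp e /shp e' pk; rewrite -e -e' pk.
  apply: subset_leq_card; apply/fintype.subsetP => k /fintype.imageP[k' Tk' ->].
  by change (is_true (P (p k'))); rewrite /P shp.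
have [k0 Pk0|none] := pickP P; last first.
  rewrite eq_card0 // mulr_ge0 ?exprn_ge0 ?addr_ge0 ?mulr_ge0 //.
  apply: prodr_ge0 => i _; rewrite !addr_ge0 ?mulr_ge0 ?(ltW r0) // subr_ge0 ltW //.
pose s0 := gluef g tau (sh k0).
pose Fs : {set 'I_d} := [set f l | l in 'I_m]%SET.
pose rest i : R := \sum_(j | (j != j0) && (j \notin Fs)) zr R (s0 j) * y j i.
have tailE k i : tl (gluef g tau (sh k)) i =
    \sum_l (k l)%:R * y (f l) i - N%:R * \sum_l y (f l) i + rest i.
  rewrite /tl /tail (bigID (mem Fs)) /=; congr (_ + _).
    rewrite mulr_sumr -sumrB.
    rewrite (eq_bigl (mem Fs)); last first.
      move=> j; apply/andP/idP => [[]//|jF]; split=> //.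
      by case/imsetP: jF => l _ ->; exact: fj0.
    rewrite /= big_imset /=; last by move=> ? ? _ _ /fi.
    apply: eq_bigr => l _; rewrite -mulrBl; congr (_ * _).
    by rewrite -[f l]/(g (Some l)) gluef_in // ffunE.
  apply: eq_bigr => j /andP[jj0 jF]; congr (zr R _ * _).
  have nj o : g o != j.
    case: o => [l|] /=; last by rewrite eq_sym.
    by apply: contra jF => /eqP <-; apply: imset_f.
  by rewrite /s0 !gluef_out.
(* Lowest value of the combination: [h x i] is largest at an endpoint determined by the sign of [h],
   and [N * \sum_l y (f l) i] undoes the shift in the encoding of integers. *)
pose lo i := - (Num.max (zr R h * a i) (zr R h * b i)) - r + N%:R * \sum_l y (f l) i - rest i.
pose w i := `|zr R h| * (b i - a i) + 2 * r.
apply: (@card_lattice_le R m _ (fun l => y (f l)) Z K P lo w) => //.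
- by move=> i; rewrite addr_ge0 ?mulr_ge0 // ?(ltW r0) // subr_ge0 ltW.
move=> k i /TP[+ [x xab xr]]; rewrite -[j0]/(g None) gluef_in // => e.
have := xr i; rewrite /ln /lin -/tl -[j0 in zr R (_ j0)]/(g None) gluef_in // ffunE tailE.
set A := \sum_l _; set B := N%:R * _ => h1.
have {h1} : - r <= zr R h * x i + (A - B + rest i) <= r by rewrite -ler_norml.
rewrite /w /lo -/B; have /andP[x1 x2] := xab i.
have [h0|h0] := leP 0 (zr R h).
  rewrite ger0_norm // max_r; last by rewrite ler_wpM2l // (le_trans x1).
  have : zr R h * a i <= zr R h * x i <= zr R h * b i by rewrite !ler_wpM2l.
  rewrite mulrBr; lra.
rewrite ltr0_norm // max_l; last by rewrite ler_wnM2l ?(ltW h0) // (le_trans x1).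
have : zr R h * b i <= zr R h * x i <= zr R h * a i by rewrite !ler_wnM2l ?(ltW h0).
rewrite mulrBr; lra.
Qed.

(** Union bound over [h = k_j0], then over [k]. Each [k] gives a cube of half-side [r / |h|] around
    [P_k], while [card_small_fiber] allows about [|h| ^ m] times the volume of the box for each
    choice of the free coordinates. The powers of [|h|] cancel up to [(1 + D / |h|) ^ m], where [D]
    absorbs the boundary term [2 r + 1] into the sides of the box. *)
Lemma card_small_coord (P : pred {ffun 'I_m -> 'I_M}) :
  (forall ka, P ka -> exists s : {ffun 'I_d -> 'I_(2 * N).+1}, [/\ zr R (s j0) != 0, E%:R * `|zr R (s j0)| < N%:R &
      forall i, `|ln s (gpt a b ka) i| <= r]) ->
  #|P|%:R <= M%:R ^+ m * ((2 * (m%:R * K) + 1) ^+ m * (2 * N).+1%:R ^+ (d - m.+1) * (3 * r) ^+ m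
     * (2 ^+ m * (2 * N%:R / E%:R + 1) + (1 + D) ^+ m * (2 * D + 1))).
Proof.
move=> PP.
pose C := (2 * (m%:R * K) + 1) ^+ m * (2 * N).+1%:R ^+ (d - m.+1).
have C0 : 0 <= C by rewrite mulr_ge0 ?exprn_ge0 ?addr_ge0 ?mulr_ge0.
pose good (h : 'I_(2 * N).+1) := (zr R h != 0) && (E%:R * `|zr R h| < N%:R).
pose Eh (h : 'I_(2 * N).+1) : pred {ffun 'I_m -> 'I_M} :=
  fun ka => [exists s : {ffun 'I_d -> 'I_(2 * N).+1}, (s j0 == h) && [forall i, `|ln s (gpt a b ka) i| <= r]].
apply: (@le_trans _ _ (\sum_(h | good h) M%:R ^+ m * (C * (3 * r) ^+ m * (1 + D / `|zr R h|) ^+ m))); last first.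
  rewrite -mulr_sumr -mulr_sumr /C ler_wpM2l ?exprn_ge0 //.
  by rewrite ler_wpM2l ?mulr_ge0 ?exprn_ge0 ?mulr_ge0 ?(ltW r0) ?addr_ge0 ?mulr_ge0 // sum_inv_le.
apply: (@card_exists_le R _ _ P good Eh) => [ka /PP[s [s1 s2 s3]]|h /andP[h0 hE]].
  exists (s j0); first by rewrite /good s1.
  by apply/existsP; exists s; rewrite eqxx; apply/forallP.
have hp : 0 < `|zr R h| by rewrite normr_gt0.
pose T : pred {ffun 'I_d -> 'I_(2 * N).+1} := fun s =>
  (s j0 == h) && [exists ka : {ffun 'I_m -> 'I_M}, [forall i, `|ln s (gpt a b ka) i| <= r]].
pose Es (s : {ffun 'I_d -> 'I_(2 * N).+1}) : pred {ffun 'I_m -> 'I_M} :=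
  fun ka => (s j0 == h) && [forall i, `|ln s (gpt a b ka) i| <= r].
pose c := (3 * (r / `|zr R h|)) ^+ m * dens a b M.
apply: (@le_trans _ _ (\sum_(s | T s) c)).
  apply: (@card_exists_le R _ _ _ T Es (fun=> c)) => [ka /existsP[s /andP[sh sr]]|s _].
    by exists s; rewrite /T /Es sh //=; apply/existsP; exists ka.
  rewrite /c -[X in _ ^+ X]card_ord.
  apply: (@cube_le R _ a b M ab M0 _ (fun i => - tl s i / zr R h)) => [i|ka i /andP[/eqP sh /forallP/(_ i)]].
    apply: (le_trans (wr i)); rewrite ler_pM2l // lef_pV2 ?posrE ?ltr0n //; exact: zr_le.
  rewrite /= /ln /lin sh -/tl ler_pdivlMr // -normrM.
  have -> // : (gpt a b ka i - - tl s i / zr R h) * zr R h = zr R h * gpt a b ka i + tl s i.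
  by move: h0; generalize (zr R h) => z z0; field.
rewrite sumr_const -[_ *+ _]mulr_natl.
apply: (@le_trans _ _ ((2 * (m%:R * K) + 1) ^+ m * \prod_i (`|zr R h| * (b i - a i) + 2 * r + 1)
     * (2 * N).+1%:R ^+ (d - m.+1) * c)).
  rewrite ler_wpM2r //.
    have dg := ltW (dens_gt0 ab M0).
    by apply: mulr_ge0 => //; rewrite exprn_ge0 ?mulr_ge0 ?invr_ge0 ?(ltW r0).
  apply: card_small_fiber => s /andP[/eqP sh /existsP[ka /forallP kar]]; split=> //.
  by exists (gpt a b ka) => // i; exact: gpt_bound.
have -> : (2 * (m%:R * K) + 1) ^+ m * \prod_i (`|zr R h| * (b i - a i) + 2 * r + 1)
     * (2 * N).+1%:R ^+ (d - m.+1) * c =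
   C * (3 * r) ^+ m * (dens a b M * \prod_i ((`|zr R h| * (b i - a i) + 2 * r + 1) / `|zr R h|)).
  rewrite big_split /= prodr_const card_ord /c /C [3 * (r / _)]mulrA [(3 * r / _) ^+ m]exprMn.
  by set X := \prod_i _; ring.
have C3 : 0 <= C * (3 * r) ^+ m by apply: mulr_ge0 => //; rewrite exprn_ge0 ?mulr_ge0 ?(ltW r0).
rewrite [leRHS]mulrCA; apply: ler_wpM2l => //.
have -> : M%:R ^+ m = dens a b M * vol a b by rewrite dens_vol // card_ord.
rewrite -(mulrA (dens a b M)); apply: ler_wpM2l; first exact: ltW (dens_gt0 ab M0).
rewrite -[m in (1 + _) ^+ m]card_ord -prodr_const -big_split /=; apply: ler_prod => i _.
have s0 : 0 < b i - a i by rewrite subr_gt0.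
apply/andP; split; first by rewrite divr_ge0 // !addr_ge0 ?mulr_ge0 ?(ltW r0) // ltW.
rewrite ler_pdivrMr //.
have -> : (b i - a i) * (1 + D / `|zr R h|) * `|zr R h| = `|zr R h| * (b i - a i) + D * (b i - a i).
  by move: hp; generalize `|zr R h| => z z0; field; rewrite gt_eqF.
have := Dr i; lra.
Qed.

End Small.

(** * Well-separated points of one level *)

(** The [(N + 1) ^ d] vectors with entries in [[0, N]] outnumber the [H ^ m] cells of a cube
    containing their images. The difference of two vectors in one cell is encoded as
    [N + q - q']. *)
Lemma dirichlet (R : realType) (m d N H : nat) (Y : 'I_d -> 'I_m -> R) (K : R) :
  (0 < H)%N -> (H ^ m < N.+1 ^ d)%N -> (forall j i, `|Y j i| <= K) ->
  exists s : {ffun 'I_d -> 'I_(2 * N).+1}, (exists j, zr R (s j) != 0) /\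
    forall i, `|\sum_j zr R (s j) * Y j i| <= 2 * d%:R * K * N%:R / H%:R.
Proof.
move=> H0 HN YK.
pose L (q : {ffun 'I_d -> 'I_N.+1}) i : R := \sum_j (q j)%:R * Y j i.
pose A : R := d%:R * K * N%:R.
have LA q i : - A <= L q i <= A.
  rewrite -ler_norml (le_trans (ler_norm_sum _ _ _)) //.
  rewrite /A -mulrA -[d in d%:R]card_ord mulr_natl -sumr_const; apply: ler_sum => j _.
  rewrite normrM mulrC ler_pM // normr_nat ler_nat -ltnS; exact: ltn_ord.
have /choice[c cP] : forall q, exists u : {ffun 'I_m -> 'I_H}, forall i,
    - A + (u i)%:R * ((A - - A) / H%:R) <= L q i <= - A + (u i)%:R * ((A - - A) / H%:R) + (A - - A) / H%:R.
  move=> q; have /choice[u uP] := fun i => ord_cell H0 (LA q i).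
  by exists (finfun u) => i; rewrite ffunE; exact: uP.
have ninj : ~ injective c.
  move=> /leq_card; rewrite !card_ffun !card_ord; apply/negP; by rewrite -ltnNge.
have [q [q' [cq qq]]] : exists q q', c q = c q' /\ q <> q'.
  apply: contrapT => h; apply: ninj => q q' cq; apply: contrapT => qq; apply: h.
  by exists q, q'.
have sP j : (N + q j - q' j < (2 * N).+1)%N.
  rewrite ltnS leq_subLR mul2n -addnn addnA [(q' j + N)%N]addnC -addnA leq_add2l.
  by rewrite (leq_trans _ (leq_addl _ _)) // -ltnS.
pose s : {ffun 'I_d -> 'I_(2 * N).+1} := [ffun j => Ordinal (sP j)].
have sE j : zr R (s j) = (q j)%:R - (q' j)%:R.
  rewrite /zr ffunE /= natrB; last by rewrite (leq_trans _ (leq_addr _ _)) // -ltnS.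
  by rewrite natrD; ring.
exists s; split.
  apply: contrapT => h; apply: qq; apply/ffunP => j; apply/val_inj.
  apply/eqP; rewrite -(eqr_nat R) -subr_eq0 -sE; apply/negPn/negP => hj; apply: h.
  by exists j.
move=> i; have -> : \sum_j zr R (s j) * Y j i = L q i - L q' i.
  by rewrite /L -sumrB; apply: eq_bigr => j _; rewrite sE mulrBl.
have := cP q i; have := cP q' i; rewrite cq opprK.
have -> : 2 * d%:R * K * N%:R / H%:R = (A + A) / H%:R by rewrite /A; ring.
rewrite ler_norml; lra.
Qed.

Lemma card_disjoint (T U : finType) (Phi : pred T) (A : T -> pred U) :
  (forall t t' u, Phi t -> Phi t' -> A t u -> A t' u -> t = t') ->
  (\sum_(t | Phi t) #|A t| = #|[pred u | [exists t, Phi t && A t u]]|)%N.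
Proof.
move=> dis.
pose B t := [pred u | Phi t && A t u].
have -> : (\sum_(t | Phi t) #|A t| = \sum_t #|B t|)%N.
  rewrite big_mkcond /=; apply: eq_bigr => t _; case: ifP => Pt.
    by apply: eq_card => u; rewrite inE /= Pt.
  by rewrite eq_card0 // => u; rewrite inE /= Pt.
under eq_bigr do rewrite -sum1_card big_mkcond /=.
rewrite exchange_big -sum1_card [RHS]big_mkcond /=; apply: eq_bigr => u _.
case: ifP => [/existsP[t tu]|/existsPn nu].
  rewrite (bigD1 t) //= big1 ?addn0; first by rewrite ifT // inE.
  move=> t' t't; rewrite ifF //; apply/negP => /andP[P' A'].
  by case/andP: tu => P A0; rewrite (dis _ _ _ P P' A0 A') eqxx in t't.
by rewrite big1 // => t _; rewrite ifF //; apply/negbTE; exact: nu.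
Qed.

Section Select.
Variables (R : realType) (m d N H E M : nat) (j0 : 'I_d) (f : 'I_m -> 'I_d).
Variables (y : 'I_d -> 'I_m -> R) (Z : 'I_m -> 'I_m -> R) (K D : R) (a b : 'I_m -> R).
Hypothesis K1 : 1 <= K.
Hypothesis fi : injective f.
Hypothesis fj0 : forall l, f l != j0.
Hypothesis ZE : forall (c : 'I_m -> R) l, c l = \sum_i Z l i * \sum_l' c l' * y (f l') i.
Hypothesis ZK : forall l i, `|Z l i| <= K.
Hypothesis yK : forall j i, j != j0 -> `|y j i| <= K.
Hypothesis aK : forall i, - K <= a i.
Hypothesis bK : forall i, b i <= K.
Hypothesis ab : forall i, a i < b i.
Hypothesis M0 : (0 < M)%N.
Hypothesis N0 : (0 < N)%N.
Hypothesis H0 : (0 < H)%N.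
Hypothesis E0 : (0 < E)%N.
Hypothesis HN : (H ^ m < N.+1 ^ d)%N.

Let C1 : R := 2 * d%:R * K.
Let r : R := C1 * N%:R / H%:R.
(** A top part of size [r = C1 N / H] divided by [|k_j0| >= N / E] puts [P_k] at distance at most
    [C5 / H]. Points more than [C6 / H] apart therefore have disjoint cubes of half-side [1 / H]
    around their [P_k], because [2 (C5 + 1) < C6]. *)
Let C5 : R := C1 * E%:R.
Let C6 : R := 2 * C5 + 3.
Let be1 : R := (1 / 4) ^+ m / 4.
Let w i := (b i - a i) / M%:R.
Let x (ka : {ffun 'I_m -> 'I_M}) i := gpt a b ka i.

Hypothesis ND : forall s : {ffun 'I_d -> 'I_(2 * N).+1}, zr R (s j0) = 0 ->
  (exists j, zr R (s j) != 0) -> exists i, r < `|tail j0 y s i|.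
Hypothesis wH : forall i, w i <= 1 / H%:R.
Hypothesis D0 : 0 <= D.
Hypothesis Dr : forall i, 2 * r + 1 <= D * (b i - a i).
Hypothesis small : (2 * (m%:R * K) + 1) ^+ m * (2 * N).+1%:R ^+ (d - m.+1) * (3 * r) ^+ m
     * (2 ^+ m * (2 * N%:R / E%:R + 1) + (1 + D) ^+ m * (2 * D + 1)) <= be1.
Hypothesis M4 : (4 %| M)%N.
Hypothesis Hs : forall i, 1 / H%:R < (b i - a i) / 4.

Definition hitpt (p : 'I_m -> R) := exists s : {ffun 'I_d -> 'I_(2 * N).+1},
  N%:R <= E%:R * `|zr R (s j0)| /\ forall i, lin j0 y s p i = 0.

(** The middle cells make up a proportion of at least [4 be1]; removing the forbidden cells [V] and
    the cells where a vector with small nonzero [k_j0] does well costs at most [be1] each. Every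
    remaining cell is near some [P_k], and a maximal separated subset of these cells is the required
    family. *)
Lemma separated_points (V : pred {ffun 'I_m -> 'I_M}) :
  #|V|%:R <= be1 * M%:R ^+ m ->
  exists (Phi : pred {ffun 'I_m -> 'I_M}) (P : {ffun 'I_m -> 'I_M} -> 'I_m -> R),
  [/\ forall ka, Phi ka -> [/\ ~~ V ka, hitpt (P ka), forall i, `|x ka i - P ka i| <= C5 / H%:R
        & forall i, a i + (b i - a i) / 4 <= x ka i <= b i - (b i - a i) / 4],
      forall ka ka', Phi ka -> Phi ka' -> ka != ka' -> exists i, C6 / H%:R < `|x ka i - x ka' i|,
      2 * be1 / (3 * C6) ^+ m * (H%:R ^+ m * vol a b) <= #|Phi|%:R
    & #|Phi|%:R <= H%:R ^+ m * vol a b].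
Proof.
move=> Vbe.
have [M' ME] := dvdnP M4.
have H0' : 0 < H%:R :> R by rewrite ltr0n.
have N0' : 0 < N%:R :> R by rewrite ltr0n.
have E0' : 0 < E%:R :> R by rewrite ltr0n.
have M0' : 0 < M%:R :> R by rewrite ltr0n.
have K0 : 0 < K by apply: lt_le_trans K1.
have dg := dens_gt0 ab M0.
have vg : 0 < vol a b by apply: prodr_gt0 => i _; rewrite subr_gt0.
have Mm : M%:R ^+ m = dens a b M * vol a b by rewrite dens_vol // card_ord.
have d0 : 1 <= d%:R :> R by rewrite ler1n (leq_trans _ (ltn_ord j0)).
have C11 : 1 <= C1.
  have : 1 <= d%:R * K by rewrite -[leLHS]mulr1 ler_pM.
  rewrite /C1 -mulrA; lra.
have E1 : 1 <= E%:R :> R by rewrite ler1n.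
have C51 : 1 <= C5 by rewrite /C5 -[leLHS]mulr1 ler_pM.
have r0 : 0 < r by rewrite /r divr_gt0 // mulr_gt0 //; lra.
pose bad : pred {ffun 'I_m -> 'I_M} := fun ka =>
  `[< exists s : {ffun 'I_d -> 'I_(2 * N).+1}, [/\ zr R (s j0) != 0, E%:R * `|zr R (s j0)| < N%:R &
      forall i, `|lin j0 y s (gpt a b ka) i| <= r] >].
have badle : #|bad|%:R <= be1 * M%:R ^+ m.
  rewrite mulrC.
  apply: le_trans (@card_small_coord R m d N E M j0 f y Z K r D a b _ _ _ _ _ _ _ _ _ _ _ _ _ bad _) _ => //.
  - exact: ltW.
  - move=> i; apply: (le_trans (wH i)); rewrite /r mulrAC mulfK ?gt_eqF //.
    by rewrite ler_pM2r ?invr_gt0.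
  - by move=> ka /asboolP.
  - by rewrite ler_pM2l ?exprn_gt0.
(* With [M = 4 M'], each direction keeps at least [3 M' - M' - 1 >= M'] indices, a quarter of
   all. *)
pose mid : pred {ffun 'I_m -> 'I_M} := fun ka =>
  [forall i, (M'%:R <= (ka i)%:R :> R) && ((ka i)%:R <= 3 * M'%:R :> R)].
have M'0 : (0 < M')%N by move: M0; rewrite ME muln_gt0 => /andP[].
have M'1 : 1 <= M'%:R :> R by rewrite ler1n.
have MR : M%:R = 4 * M'%:R :> R by rewrite ME natrM mulrC.
have midge : 4 * be1 * M%:R ^+ m <= #|mid|%:R.
  apply: le_trans (@card_box_ge R _ M mid (fun=> M'%:R) (fun=> 3 * M'%:R) _ _ _ _) => //.
  - have -> : 4 * be1 * M%:R ^+ m = \prod_(i < m) M'%:R.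
      have e : (1 / 4) ^+ m * 4 ^+ m = 1 :> R by rewrite -exprMn mul1r mulVf ?expr1n.
      rewrite prodr_const card_ord MR /be1 [(4 * _) ^+ m]exprMn mulrA.
      transitivity ((1 / 4 : R) ^+ m * 4 ^+ m * M'%:R ^+ m); last by rewrite e mul1r.
      by congr (_ * _); set t := (1 / 4 : R) ^+ m; set t' := (4 : R) ^+ m; field.
    by apply: ler_prod => i _; lra.
  - by move=> j; rewrite MR; lra.
  - by move=> j; lra.
  - by move=> s h; apply/forallP => j; exact: h.
pose X' : pred {ffun 'I_m -> 'I_M} := fun ka => [&& mid ka, ~~ V ka & ~~ bad ka].
have X'ge : 2 * be1 * M%:R ^+ m <= #|X'|%:R.
  have : (#|mid| <= #|X'| + (#|V| + #|bad|))%N.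
    have -> : #|X'| = #|[set ka | X' ka]%SET| by rewrite cardsE.
    have -> : #|V| = #|[set ka | V ka]%SET| by rewrite cardsE.
    have -> : #|bad| = #|[set ka | bad ka]%SET| by rewrite cardsE.
    apply: leq_trans (leq_add (leqnn _) (leq_card_setU _ _).1).
    apply: leq_trans (leq_card_setU _ _).1.
    apply: subset_leq_card; apply/fintype.subsetP => ka mka.
    rewrite !inE; change (is_true (mid ka)) in mka; rewrite /X' mka /=.
    by case: (V ka); case: (bad ka).
  rewrite -(ler_nat R) !natrD; lra.
pose sep (A : {set {ffun 'I_m -> 'I_M}}) :=
  [forall ka in A, forall ka' in A, (ka != ka') ==> [exists i, C6 / H%:R < `|x ka i - x ka' i|]].
pose ok (A : {set {ffun 'I_m -> 'I_M}}) := (A \subset X') && sep A.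
(* Maximality is used in the form [XA] below: each cell of [X'] is within [C6 / H] of a chosen one,
   otherwise it could be added. *)
have [A /maxsetP[/andP[AX sepA] maxA]] : {A : {set {ffun 'I_m -> 'I_M}} | maxset ok A}.
  apply: ex_maxset; exists finset.set0; apply/andP; split.
    by apply/fintype.subsetP => k; rewrite inE.
  by apply/forallP => ka; rewrite inE.
have XA ka : X' ka -> exists2 ka', ka' \in A & forall i, `|x ka i - x ka' i| <= C6 / H%:R.
  move=> X'ka; have [kaA|kaA] := boolP (ka \in A).
    by exists ka => // i; rewrite subrr normr0 divr_ge0 // /C6; lra.
  apply: contrapT => h; move/negP: kaA; apply.
  have far ka' : ka' \in A -> exists i, C6 / H%:R < `|x ka i - x ka' i|.
    move=> k'A; apply: contrapT => h'; apply: h; exists ka' => // i.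
    by rewrite leNgt; apply/negP => h2; apply: h'; exists i.
  rewrite -(maxA (ka |: A)%SET) ?setU11 ?finset.subsetUr //.
  apply/andP; split.
    apply/fintype.subsetP => k; rewrite !inE => /orP[/eqP-> //|].
    exact: (fintype.subsetP AX).
  apply/forall_inP => k1; rewrite !inE => /orP[/eqP->|k1A].
    apply/forall_inP => k2; rewrite !inE => /orP[/eqP->|k2A]; rewrite ?eqxx //.
    by apply/implyP => _; apply/existsP; exact: far.
  apply/forall_inP => k2; rewrite !inE => /orP[/eqP->|k2A].
    by apply/implyP => _; have [i hi] := far _ k1A; apply/existsP; exists i; rewrite distrC.
  by move/forall_inP/(_ _ k1A)/forall_inP/(_ _ k2A): sepA.
have xK ka i : `|x ka i| <= K.
  have := gpt_bound ab M0 ka i; rewrite -/(x ka i) ler_norml.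
  have := aK i; have := bK i; lra.
have /choice[P PP] : forall ka, exists p : 'I_m -> R, X' ka ->
    hitpt p /\ forall i, `|x ka i - p i| <= C5 / H%:R.
  move=> ka; have [X'ka|_] := boolP (X' ka); last by exists (fun=> 0).
  (* Pigeonhole is applied with the grid point as column [j0]. [ND] rules out [k_j0 = 0], and the
     cell not being bad rules out the small nonzero values, so division by [k_j0] is under
     control. *)
  pose Y j i := if j == j0 then x ka i else y j i.
  have YK j i : `|Y j i| <= K by rewrite /Y; case: eqVneq => // jj; exact: yK.
  have [s [s0 sr]] := dirichlet H0 HN YK.
  have linE i : lin j0 y s (x ka) i = \sum_j zr R (s j) * Y j i.
    rewrite (bigD1 j0) //= /Y eqxx; congr (_ + _).
    by apply: eq_bigr => j /negbTE ->.
  have sj0 : zr R (s j0) != 0.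
    apply/eqP => sj; have [i] := ND sj s0.
    by rewrite ltNge => /negP; apply; have := sr i; rewrite -linE /lin sj mul0r add0r.
  have sN : N%:R <= E%:R * `|zr R (s j0)|.
    rewrite leNgt; apply/negP => h; case/and3P: X'ka => _ _ /asboolPn; apply.
    by exists s; split=> // i; rewrite linE.
  have sp : 0 < `|zr R (s j0)| by rewrite normr_gt0.
  exists (fun i => - tail j0 y s i / zr R (s j0)) => _; split.
    by exists s; split=> // i; rewrite /lin mulrC divfK // addNr.
  move=> i; rewrite -(ler_pM2r sp) -normrM.
  have -> : (x ka i - - tail j0 y s i / zr R (s j0)) * zr R (s j0) = lin j0 y s (x ka) i.
    by rewrite /lin; move: sj0; generalize (zr R (s j0)) => z z0; field.
  have -> : C5 / H%:R * `|zr R (s j0)| = C1 * (E%:R * `|zr R (s j0)|) / H%:R by rewrite /C5; ring.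
  rewrite linE; apply: (le_trans (sr i)); rewrite -/C1 ler_pM2r ?invr_gt0 //.
  by apply: ler_wpM2l => //; apply: le_trans C11.
have AX' ka : ka \in A -> X' ka by move/(fintype.subsetP AX).
have midx ka : mid ka -> forall i, a i + (b i - a i) / 4 <= x ka i <= b i - (b i - a i) / 4.
  move=> /forallP + i => /(_ i)/andP[m1 m2].
  have wi0 : 0 < w i by rewrite divr_gt0 ?subr_gt0.
  have sE : b i - a i = 4 * (M'%:R * w i).
    by rewrite /w MR; field; rewrite gt_eqF; lra.
  have h1 : M'%:R * w i <= (ka i)%:R * w i by rewrite ler_pM2r.
  have h2 : (ka i)%:R * w i <= 3 * M'%:R * w i by rewrite ler_pM2r.
  rewrite /x /gpt -/(w i); lra.
exists (fun ka => ka \in A), P; split.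
- move=> ka /AX' X'ka; have [Ph Px] := PP _ X'ka.
  by case/and3P: X'ka => mk Vk _; split=> //; exact: midx.
- move=> ka ka' kA kA' kk; move/forall_inP/(_ _ kA)/forall_inP/(_ _ kA')/implyP/(_ kk): sepA.
  by move/existsP.
(* Lower bound: the cubes of half-side [C6 / H] around the chosen points cover [X']. *)
- pose nb (k : {ffun 'I_m -> 'I_M}) : pred {ffun 'I_m -> 'I_M} :=
    fun ka => [forall i, `|x ka i - x k i| <= C6 / H%:R].
  have : #|X'|%:R <= \sum_(k in A) (3 * (C6 / H%:R)) ^+ m * dens a b M :> R.
    apply: (@card_exists_le R _ _ X' (mem A) nb) => [ka /XA[k kA h]|k _].
      by exists k => //; apply/forallP.
    rewrite -[X in _ ^+ X]card_ord.
    apply: (@cube_le R _ a b M ab M0 _ (x k)) => [i|ka i /forallP]; last exact.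
    by apply: (le_trans (wH i)); rewrite ler_pM2r ?invr_gt0 // /C6; lra.
  rewrite sumr_const -[(_ * _) *+ _]mulr_natl => h0; have := le_trans X'ge h0.
  have -> : (3 * (C6 / H%:R)) ^+ m = (3 * C6) ^+ m / H%:R ^+ m by rewrite mulrA expr_div_n.
  rewrite Mm; have C6m : 0 < (3 * C6) ^+ m by rewrite exprn_gt0 // /C6; lra.
  have Hm : 0 < H%:R ^+ m :> R by rewrite exprn_gt0.
  move=> h; rewrite mulrAC ler_pdivrMr // -(ler_pM2r dg).
  have -> : 2 * be1 * (H%:R ^+ m * vol a b) * dens a b M = 2 * be1 * (dens a b M * vol a b) * H%:R ^+ m.
    by set t := dens _ _ _; ring.
  have -> : #|A|%:R * (3 * C6) ^+ m * dens a b M = #|A|%:R * ((3 * C6) ^+ m / H%:R ^+ m * dens a b M) * H%:R ^+ m.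
    by set t := dens _ _ _; set q := H%:R ^+ m in Hm *; set t' := _ ^+ m; field; rewrite gt_eqF.
  by rewrite ler_pM2r.
(* Upper bound: the cubes of half-side [1 / H] are pairwise disjoint and stay inside the box, the
   chosen points being in its middle half. *)
- pose nb (k : {ffun 'I_m -> 'I_M}) : pred {ffun 'I_m -> 'I_M} :=
    fun ka => [forall i, `|x ka i - x k i| <= 1 / H%:R].
  have dis k k' u : k \in A -> k' \in A -> nb k u -> nb k' u -> k = k'.
    move=> kA kA' /forallP ku /forallP ku'; apply/eqP/negPn/negP => kk.
    move/forall_inP/(_ _ kA)/forall_inP/(_ _ kA')/implyP/(_ kk): sepA => /existsP[i].
    apply/negP; rewrite -leNgt.
    have -> : x k i - x k' i = (x u i - x k' i) - (x u i - x k i) by ring.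
    apply: (le_trans (ler_normB _ _)).
    have h1 := ku i; have h2 := ku' i.
    apply: (@le_trans _ _ (2 / H%:R)); first by lra.
    by rewrite ler_pM2r ?invr_gt0 // /C6; lra.
  have tot := card_disjoint dis.
  have : \sum_(k in A) (1 / H%:R) ^+ m * dens a b M <= #|{ffun 'I_m -> 'I_M}|%:R :> R.
    apply: (@le_trans _ _ (\sum_(k in A) #|nb k|%:R)); last first.
      by rewrite -natr_sum tot ler_nat max_card.
    apply: ler_sum => k /AX'/and3P[/midx km _ _]; rewrite -[X in _ ^+ X]card_ord.
    apply: (@cube_ge R _ a b M ab M0 _ (x k)) => // [i|i|ka h]; last by apply/forallP.
      have := km i; have := Hs i; lra.
    have := km i; have := Hs i; lra.
  rewrite sumr_const -[(_ * _) *+ _]mulr_natl card_ffun !card_ord natrX Mm.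
  have Hm : 0 < H%:R ^+ m :> R by rewrite exprn_gt0.
  rewrite mulrA [dens _ _ _ * vol _ _]mulrC ler_pM2r // expr_div_n expr1n mulrA mulr1.
  by rewrite ler_pdivrMr // mulrC.
Qed.

End Select.

(** * Greedy choice over the levels *)

Lemma exprD_le (R : realType) (x y : R) m : 0 <= x -> 0 <= y ->
  (x + y) ^+ m <= 2 ^+ m * (x ^+ m + y ^+ m).
Proof.
move=> x0 y0; wlog xy : x y x0 y0 / x <= y => [h|].
  by have [/h|/ltW/h] := leP x y; [exact|rewrite addrC [_ ^+ _ + _]addrC; exact].
apply: (@le_trans _ _ ((2 * y) ^+ m)).
  by rewrite lerXn2r ?nnegrE ?addr_ge0 ?mulr_ge0 //; lra.
by rewrite exprMn ler_wpM2l ?exprn_ge0 // lerDr exprn_ge0.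
Qed.

Section Greedy.
Variables (R : realType) (m M U : nat) (a b : 'I_m -> R).
Variables (H rr : nat -> R) (hit : nat -> ('I_m -> R) -> Prop) (C5 be1 c g : R).
Hypothesis ab : forall i, a i < b i.
Hypothesis M0 : (0 < M)%N.
Let w i := (b i - a i) / M%:R.
Let x (ka : {ffun 'I_m -> 'I_M}) i := gpt a b ka i.
(** The proportion at which the greedy choice may stop. It satisfies [6 ^ m * be = be1 / 2], where 6
    is the 3 of [cube_le] times the 2 of [exprD_le]. *)
Let be := be1 / (2 * 6 ^+ m).
Hypothesis C50 : 0 <= C5.
Hypothesis c0 : 0 <= c.
Hypothesis be0 : 0 < be1.
Hypothesis H0 : forall u, 0 < H u.
Hypothesis rH : forall u, rr u <= 1 / H u.
Hypothesis wr : forall u i, (u < U)%N -> w i <= rr u.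
Hypothesis rr0 : forall u, 0 < rr u.
Hypothesis Hs : forall u i, (C5 + 1) / H u < (b i - a i) / 4.
Hypothesis geo : forall u, (u < U)%N -> \sum_(u' < u) H u' ^+ m <= g * H u ^+ m.
Hypothesis gsmall : (6 * (C5 + 1)) ^+ m * g <= be1 / 2.
Hypothesis sel : forall u, (u < U)%N -> forall V : pred {ffun 'I_m -> 'I_M},
  #|V|%:R <= be1 * M%:R ^+ m ->
  exists (Phi : pred {ffun 'I_m -> 'I_M}) (P : {ffun 'I_m -> 'I_M} -> 'I_m -> R),
  [/\ forall ka, Phi ka -> [/\ ~~ V ka, hit u (P ka), forall i, `|x ka i - P ka i| <= C5 / H u
        & forall i, a i + (b i - a i) / 4 <= x ka i <= b i - (b i - a i) / 4],
      forall ka ka', Phi ka -> Phi ka' -> ka != ka' -> exists i, (2 * C5 + 3) / H u < `|x ka i - x ka' i|,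
      c * (H u ^+ m * vol a b) <= #|Phi|%:R
    & #|Phi|%:R <= H u ^+ m * vol a b].

Let cube (p : 'I_m -> R) (rho : R) : pred {ffun 'I_m -> 'I_M} :=
  fun ka => [forall i, `|x ka i - p i| <= rho].

Definition hits t : pred {ffun 'I_m -> 'I_M} := fun ka =>
  `[< exists u p, [/\ (u < t)%N, hit u p & forall i, `|x ka i - p i| <= rr u] >].

Let X := {ffun 'I_m -> 'I_M}.

(** State after [t] levels: the chosen cubes lie in the box, are pairwise disjoint across and within
    levels, and contain the expected number of grid points, unless the proportion [be] has been
    reached. *)
Let inv t (Phi : nat -> pred X) (P : nat -> X -> 'I_m -> R) :=
  [/\ forall u ka, (u < t)%N -> Phi u ka ->
        [/\ hit u (P u ka), forall i, a i <= P u ka i - rr u & forall i, P u ka i + rr u < b i],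
      forall u, (u < t)%N -> #|Phi u|%:R <= H u ^+ m * vol a b,
      forall u u' ka ka' k, (u < t)%N -> (u' < t)%N -> Phi u ka -> Phi u' ka' ->
        cube (P u ka) (rr u) k -> cube (P u' ka') (rr u') k -> u = u' /\ ka = ka' &
      Num.min be (c * \sum_(u < t) (rr u * H u) ^+ m) * M%:R ^+ m <=
        \sum_(u < t) \sum_(ka | Phi u ka) #|cube (P u ka) (rr u)|%:R].

Let dg : 0 < dens a b M. Proof. exact: dens_gt0. Qed.
Let Mm : M%:R ^+ m = dens a b M * vol a b. Proof. by rewrite dens_vol // card_ord. Qed.

Let cubele p rho : (forall i, w i <= rho) -> #|cube p rho|%:R <= (3 * rho) ^+ m * dens a b M.
Proof.
move=> wrho; rewrite -[X in _ ^+ X]card_ord.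
by apply: (@cube_le R _ a b M ab M0 _ p) => // ka i /forallP.
Qed.

Let cubege p rho : (forall i, w i <= rho) ->
  (forall i, a i <= p i - rho) -> (forall i, p i + rho < b i) ->
  rho ^+ m * dens a b M <= #|cube p rho|%:R.
Proof.
move=> wrho pa pb; rewrite -[X in _ ^+ X]card_ord.
by apply: (@cube_ge R _ a b M ab M0 _ p) => // ka h; apply/forallP.
Qed.

(** The enlargement [(C5 + 1) / H t] is the distance from a new cell to its hit point, at most
    [C5 / H t], plus the half-side of the new cube, at most [1 / H t]. *)
Let blocked t (Phi : nat -> pred X) (P : nat -> X -> 'I_m -> R) : pred X := fun k =>
  [exists v : 'I_t * X, Phi v.1 v.2 && cube (P v.1 v.2) (rr v.1 + (C5 + 1) / H t) k].

(** Half of the budget [be1] pays for the old cubes themselves, which contain fewer than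
    [be * M ^ m] grid points; the other half pays for their enlargement, whose total is a geometric
    sum controlled by [g]. *)
Let blocked_le t Phi P : (t < U)%N -> inv t Phi P ->
  \sum_(u < t) \sum_(ka | Phi u ka) #|cube (P u ka) (rr u)|%:R < be * M%:R ^+ m ->
  #|blocked t Phi P|%:R <= be1 * M%:R ^+ m.
Proof.
move=> tU [Phit Phile _ _]; set S := \sum_(u < t) _ => Slt.
have C7 : 0 < (C5 + 1) / H t by rewrite divr_gt0 // ltr_wpDl.
apply: (@le_trans _ _ (\sum_(u < t) \sum_(ka | Phi u ka)
   (3 * (rr u + (C5 + 1) / H t)) ^+ m * dens a b M)).
  rewrite pair_big_dep /=.
  apply: (@card_exists_le R _ _ _ (fun v : 'I_t * X => Phi v.1 v.2)
     (fun v => cube (P v.1 v.2) (rr v.1 + (C5 + 1) / H t))) => [k /existsP[v /andP[v1 v2]]|v _].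
    by exists v.
  apply: cubele => i; apply: (le_trans (wr i (ltn_trans (ltn_ord v.1) tU))); rewrite lerDl ltW //.
apply: (@le_trans _ _ (6 ^+ m * S + \sum_(u < t) H u ^+ m * vol a b * ((6 * ((C5 + 1) / H t)) ^+ m * dens a b M))).
  rewrite /S mulr_sumr -big_split /=; apply: ler_sum => u _.
  apply: (@le_trans _ _ (\sum_(ka | Phi u ka) (6 ^+ m * #|cube (P u ka) (rr u)|%:R
     + (6 * ((C5 + 1) / H t)) ^+ m * dens a b M))).
    apply: ler_sum => ka Pka; have [_ ha hb] := Phit _ _ (ltn_ord u) Pka.
    apply: (@le_trans _ _ (6 ^+ m * (rr u ^+ m * dens a b M) + (6 * ((C5 + 1) / H t)) ^+ m * dens a b M)).
      rewrite mulrA -mulrDl ler_pM2r // -exprMn.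
      have -> : 3 * (rr u + (C5 + 1) / H t) = 3 * rr u + 3 * ((C5 + 1) / H t) by ring.
      have r3 := rr0 u.
      apply: (le_trans (@exprD_le _ _ _ m _ _)); try lra.
      rewrite mulrDr -!exprMn !mulrA; have -> : 2 * 3 = 6 :> R by ring.
      by [].
    rewrite lerD2r ler_wpM2l ?exprn_ge0 //; apply: cubege => // i.
    exact: wr (ltn_trans (ltn_ord u) tU).
  rewrite big_split /= -mulr_sumr lerD2l sumr_const -[(_ * _) *+ _]mulr_natl.
  rewrite ler_wpM2r //; last exact: Phile.
  by rewrite mulr_ge0 ?exprn_ge0 ?(ltW dg) // mulr_ge0 // ltW.
have -> : \sum_(u < t) H u ^+ m * vol a b * ((6 * ((C5 + 1) / H t)) ^+ m * dens a b M) =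
   (6 * (C5 + 1)) ^+ m * (\sum_(u < t) H u ^+ m / H t ^+ m) * M%:R ^+ m.
  rewrite Mm mulrAC mulr_sumr; apply: eq_bigr => u _.
  rewrite [6 * (_ / _)]mulrA expr_div_n; set t1 := dens _ _ _; set t2 := vol _ _.
  by ring.
have h1 : \sum_(u < t) H u ^+ m / H t ^+ m <= g.
  by rewrite -mulr_suml ler_pdivrMr ?exprn_gt0 // geo.
have h2 : (6 * (C5 + 1)) ^+ m * (\sum_(u < t) H u ^+ m / H t ^+ m) <= be1 / 2.
  apply: le_trans gsmall; apply: ler_wpM2l => //; by rewrite exprn_ge0 ?mulr_ge0 ?addr_ge0.
have Mp : 0 < M%:R ^+ m :> R by rewrite exprn_gt0 // ltr0n.
have h3 : 6 ^+ m * S <= be1 / 2 * M%:R ^+ m.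
  have p6 : 0 < 6 ^+ m :> R by rewrite exprn_gt0.
  apply: (@le_trans _ _ (6 ^+ m * (be * M%:R ^+ m))); first by rewrite ler_wpM2l // ltW.
  by rewrite le_eqVlt; apply/orP; left; apply/eqP; rewrite /be; set q := M%:R ^+ m; set z := 6 ^+ m in p6 *; field; rewrite gt_eqF.
have -> : be1 * M%:R ^+ m = be1 / 2 * M%:R ^+ m + be1 / 2 * M%:R ^+ m by field.
by apply: lerD => //; rewrite ler_pM2r.
Qed.

Let invS t Phi P : (t < U)%N -> inv t Phi P -> exists Phi' P', inv t.+1 Phi' P'.
Proof.
move=> tU iv; have [Phit Phile dis low] := iv.
set S := \sum_(u < t) _ in low.
have Mp : 0 < M%:R ^+ m :> R by rewrite exprn_gt0 // ltr0n.
have vg : 0 < vol a b by apply: prodr_gt0 => i _; rewrite subr_gt0.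
pose upd (Ph : pred X) (Q : X -> 'I_m -> R) :=
  ((fun u => if u == t then Ph else Phi u), (fun u => if u == t then Q else P u)).
have Sud Ph Q : \sum_(u < t.+1) \sum_(ka | (upd Ph Q).1 u ka) #|cube ((upd Ph Q).2 u ka) (rr u)|%:R
   = S + \sum_(ka | Ph ka) #|cube (Q ka) (rr t)|%:R :> R.
  rewrite big_ord_recr /= eqxx; congr (_ + _); apply: eq_bigr => u _.
  by rewrite ltn_eqF.
have upd1 Ph Q u : (u < t)%N -> (upd Ph Q).1 u = Phi u by move=> ut; rewrite /upd /= ltn_eqF.
have upd2 Ph Q u : (u < t)%N -> (upd Ph Q).2 u = P u by move=> ut; rewrite /upd /= ltn_eqF.
have upd1t Ph Q : (upd Ph Q).1 t = Ph by rewrite /upd /= eqxx.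
have upd2t Ph Q : (upd Ph Q).2 t = Q by rewrite /upd /= eqxx.
have ltS u : (u < t.+1)%N -> u = t \/ (u < t)%N.
  by rewrite ltnS leq_eqVlt => /orP[/eqP|]; [left|right].
clearbody upd.
(* If the proportion [be] is already covered, level [t] adds nothing; otherwise the blocked cells
   are few enough to serve as [V]. *)
have [Sge|Slt] := leP (be * M%:R ^+ m) S.
  exists (upd pred0 (P t)).1, (upd pred0 (P t)).2; split.
  - by move=> u ka /ltS[->|ut]; rewrite ?upd1t // upd1 // upd2 //; exact: Phit.
  - move=> u /ltS[->|ut]; rewrite ?upd1t ?upd1 //; last exact: Phile.
    by rewrite eq_card0 // mulr_ge0 // ?exprn_ge0 // ltW.
  - move=> u u' ka ka' k /ltS[->|ut]; first by rewrite upd1t.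
    move=> /ltS[->|ut']; first by rewrite upd1t.
    by rewrite !upd1 // !upd2 //; exact: dis.
  - rewrite Sud big_pred0_eq addr0; apply: le_trans Sge.
    by rewrite ler_pM2r // ge_min lexx.
have [Ph [Q [PhP sepP c1 c2]]] := sel tU (blocked_le tU iv Slt).
have near_t ka k i : Ph ka -> cube (Q ka) (rr t) k -> `|x k i - x ka i| <= rr t + C5 / H t.
  move=> /PhP[_ _ /(_ i) h1 _] /forallP/(_ i) h2; move: h1 h2; rewrite !ler_norml; lra.
have far_old u ka ka' k : (u < t)%N -> Phi u ka -> Ph ka' ->
    cube (P u ka) (rr u) k -> cube (Q ka') (rr t) k -> False.
  move=> ut Pu Ph' cu ct; have [nb _ _ _] := PhP _ Ph'; move/negP: nb; apply.
  apply/existsP; exists (Ordinal ut, ka); rewrite /= Pu; apply/forallP => i.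
  have := near_t _ _ i Ph' ct; move/forallP/(_ i): cu; have := rH t.
  rewrite mulrDl !ler_norml; lra.
exists (upd Ph Q).1, (upd Ph Q).2; split.
- move=> u ka /ltS[->|ut]; rewrite ?upd1t ?upd2t ?upd1 ?upd2 //; last exact: Phit.
  move=> /PhP[_ hq h1 h2]; have ht := rH t; split=> // i.
    have := h1 i; have := h2 i; have := Hs t i; rewrite mulrDl ler_norml; lra.
  have := h1 i; have := h2 i; have := Hs t i; rewrite mulrDl ler_norml; lra.
- move=> u /ltS[->|ut]; rewrite ?upd1t ?upd1 //; exact: Phile.
- move=> u u' ka ka' k /ltS[->|ut] /ltS[->|ut'];
    rewrite ?upd1t ?upd2t ?[in _.1 u]upd1 ?[in _.2 u]upd2 ?[in _.1 u']upd1 ?[in _.2 u']upd2 //.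
  + move=> h h' ck ck'; split=> //; apply/eqP/negPn/negP => kk.
    have [i] := sepP _ _ h h' kk; apply/negP; rewrite -leNgt.
    have := near_t _ _ i h ck; have := near_t _ _ i h' ck'; have := rH t.
    rewrite !mulrDl !ler_norml; have : 0 < 1 / H t by rewrite divr_gt0.
    lra.
  + by move=> h h' ck ck'; case: (far_old _ _ _ _ ut' h' h ck' ck).
  + by move=> h h' ck ck'; case: (far_old _ _ _ _ ut h h' ck ck').
  + exact: dis.
rewrite Sud.
(* Since [S] is below [be * M ^ m], the minimum in [low] is its second term. *)
have Sc : c * (\sum_(u < t) (rr u * H u) ^+ m) * M%:R ^+ m <= S.
  apply: le_trans (low); rewrite ler_pM2r // le_min lexx andbT.
  rewrite leNgt; apply/negP => h; move: low; rewrite min_l ?(ltW h) //.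
  by rewrite leNgt Slt.
rewrite big_ord_recr /=.
apply: (@le_trans _ _ (c * (\sum_(u < t) (rr u * H u) ^+ m + (rr t * H t) ^+ m) * M%:R ^+ m)).
  by rewrite ler_pM2r // ge_min lexx orbT.
rewrite mulrDr mulrDl; apply: lerD => //.
(* Level [t] brings at least [c H ^ m vol] cubes of at least [rr ^ m dens] points each, and
   [dens * vol] is [M ^ m]. *)
apply: (@le_trans _ _ (\sum_(ka | Ph ka) rr t ^+ m * dens a b M)).
  rewrite sumr_const -[(_ * _) *+ _]mulr_natl.
  apply: (@le_trans _ _ (c * (H t ^+ m * vol a b) * (rr t ^+ m * dens a b M))).
    rewrite exprMn Mm le_eqVlt; apply/orP; left; apply/eqP.
    by set t1 := dens _ _ _; set t2 := vol _ _; ring.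
  by rewrite ler_wpM2r // mulr_ge0 ?exprn_ge0 ?(ltW dg) // ltW.
apply: ler_sum => ka /PhP[_ hq h1 h2]; have ht := rH t; apply: cubege => i; first exact: wr.
  have := h1 i; have := h2 i; have := Hs t i; rewrite mulrDl ler_norml; lra.
have := h1 i; have := h2 i; have := Hs t i; rewrite mulrDl ler_norml; lra.
Qed.

Lemma card_hits_ge t : (t <= U)%N ->
  Num.min be (c * \sum_(u < t) (rr u * H u) ^+ m) * M%:R ^+ m <= #|hits t|%:R.
Proof.
move=> tU; have [Phi [P [Phit _ dis low]]] : exists Phi P, inv t Phi P.
  elim: t tU => [|t IH] tU; last by have [Phi [P iv]] := IH (ltnW tU); exact: (invS tU iv).
  exists (fun=> pred0), (fun _ _ => 0); split=> //.
  by rewrite !big_ord0 mulr0 min_r ?mul0r // divr_ge0 ?(ltW be0) // mulr_ge0 ?exprn_ge0.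
apply: (le_trans low).
pose A (v : 'I_t * X) : pred X := cube (P v.1 v.2) (rr v.1).
have tot := @card_disjoint _ _ (fun v : 'I_t * X => Phi v.1 v.2) A.
have -> : \sum_(u < t) \sum_(ka | Phi u ka) #|cube (P u ka) (rr u)|%:R =
   (\sum_(v : 'I_t * X | Phi v.1 v.2) #|A v|)%:R :> R.
  by rewrite natr_sum pair_big_dep.
rewrite tot; last first.
  move=> [u ka] [u' ka'] k /= h h' c1 c2.
  by have [/val_inj-> ->] := dis _ _ _ _ _ (ltn_ord u) (ltn_ord u') h h' c1 c2.
rewrite ler_nat; apply: subset_leq_card; apply/fintype.subsetP => k.
rewrite inE => /existsP[[u ka] /= /andP[h /forallP ck]]; apply/asboolP.
by exists u, (P u ka); have [hu _ _] := Phit _ _ (ltn_ord u) h.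
Qed.

End Greedy.

(** * Constants and levels *)

Local Open Scope classical_set_scope.

Lemma exists_natR (R : realType) (x : R) : exists n : nat, (0 < n)%N /\ x <= n%:R.
Proof.
by exists (Num.truncn x).+1; split=> //; exact/ltW/truncnS_gt.
Qed.

Lemma exists_bound (R : realType) (J : finType) (x : J -> R) : exists2 D : R, 0 < D & forall j, x j <= D.
Proof.
exists (1 + \sum_j `|x j|) => [|j]; first by rewrite ltr_wpDr // sumr_ge0.
rewrite (bigD1 j) //= (le_trans (ler_norm _)) // addrCA lerDl addr_ge0 // sumr_ge0 //.
Qed.

Lemma pow2_ge (R : realType) (x : R) : exists u0, forall u, (u0 <= u)%N -> x <= (2 ^ u)%:R.
Proof.
have [n [_ xn]] := exists_natR x; exists n => u nu.
apply: (le_trans xn); rewrite ler_nat (leq_trans nu) // ltnW //; exact: ltn_expl.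
Qed.

Section Levels.
Variables (R : realType) (m n : nat).
Hypothesis m0 : (0 < m)%N.
Hypothesis n0 : (0 < n)%N.
Let d := (m + n)%N.

(** The exponents make [H ^ m = N ^ (m + n)] exact over the integers, so that [H] is [N ^ (d / m)],
    the largest scale that pigeonhole allows. *)
Definition Nl u := (2 ^ (m * u))%N.
Definition Hl u := (2 ^ ((m + n) * u))%N.

Lemma Nl_gt0 u : (0 < Nl u)%N. Proof. by rewrite expn_gt0. Qed.
Lemma Hl_gt0 u : (0 < Hl u)%N. Proof. by rewrite expn_gt0. Qed.
Lemma Nl_le_Hl u : (Nl u <= Hl u)%N.
Proof. by rewrite leq_exp2l // leq_mul2r leq_addr orbT. Qed.
Lemma Hl_pow u : (Hl u ^ m = Nl u ^ (m + n))%N.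
Proof.
rewrite /Hl /Nl -!expnM.
by have -> : ((m + n) * u * m = m * u * (m + n))%N by rewrite mulnC mulnA mulnAC.
Qed.
Lemma Hl_lt u : (Hl u ^ m < (Nl u).+1 ^ d)%N.
Proof.
by rewrite Hl_pow ltn_exp2r // /d addn_gt0 m0.
Qed.
Lemma le_2_Nl u : (2 ^ u <= Nl u)%N.
Proof. by rewrite leq_exp2l // leq_pmull. Qed.
Lemma le_2_Hl u : (2 ^ u <= Hl u)%N.
Proof. by rewrite (leq_trans (le_2_Nl u)) // Nl_le_Hl. Qed.

Lemma NH u : (Nl u)%:R ^+ m / (Hl u)%:R ^+ m = ((Nl u)%:R ^+ n)^-1 :> R.
Proof.
have N0 : (Nl u)%:R != 0 :> R by rewrite pnatr_eq0 -lt0n Nl_gt0.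
have -> : (Hl u)%:R ^+ m = (Nl u)%:R ^+ m * (Nl u)%:R ^+ n :> R.
  by rewrite -exprD -!natrX /Hl /Nl -!expnM; congr ((2 ^ _)%:R); lia.
by rewrite invfM mulrA divff ?mul1r // expf_neq0.
Qed.

(* [C1] comes from the pigeonhole bound; [be1] is a quarter of a lower bound for the proportion
   of the grid cells lying in the middle half of a box. *)
Definition C1 (K : R) : R := 2 * d%:R * K.
Definition be1 : R := (1 / 4) ^+ m / 4.

(** The left side is at most a constant times [1 / E + B / N], where [B] depends on [D]. The first
    term is made small by [E], before [D] is known; [D] varies with the box and is beaten by taking
    the level large. *)
Lemma small_levels (K : R) : 1 <= K -> exists E, (0 < E)%N /\ forall D : R, 0 <= D ->
  exists u0, forall u, (u0 <= u)%N ->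
  (2 * (m%:R * K) + 1) ^+ m * (2 * Nl u).+1%:R ^+ (d - m.+1) * (3 * (C1 K * (Nl u)%:R / (Hl u)%:R)) ^+ m
     * (2 ^+ m * (2 * (Nl u)%:R / E%:R + 1) + (1 + D) ^+ m * (2 * D + 1)) <= be1.
Proof.
move=> K1; have K0 : 0 <= K by lra.
pose A0 : R := (2 * (m%:R * K) + 1) ^+ m * 3 ^+ n.-1 * (3 * C1 K) ^+ m.
have C10 : 0 <= C1 K by rewrite /C1 !mulr_ge0.
have A00 : 0 <= A0 by rewrite /A0 !mulr_ge0 ?exprn_ge0 ?addr_ge0 ?mulr_ge0.
have be0 : 0 < be1 by rewrite /be1 divr_gt0 // exprn_gt0.
have [E [E0 hE]] := exists_natR (A0 * 2 ^+ m * 2 / (be1 / 2)).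
exists E; split=> // D D0.
pose B := 2 ^+ m + (1 + D) ^+ m * (2 * D + 1).
have [u0 hu0] := pow2_ge (A0 * B / (be1 / 2)).
exists u0 => u /hu0 hu.
have NR : 0 < (Nl u)%:R :> R by rewrite ltr0n Nl_gt0.
have ER : 0 < E%:R :> R by rewrite ltr0n.
have N1 : 1 <= (Nl u)%:R :> R by rewrite ler1n Nl_gt0.
have B0 : 0 <= B by rewrite /B addr_ge0 ?mulr_ge0 ?exprn_ge0 ?addr_ge0 ?mulr_ge0.
apply: (@le_trans _ _ (A0 / (Nl u)%:R * (2 ^+ m * 2 * (Nl u)%:R / E%:R + B))).
  have -> : 2 ^+ m * (2 * (Nl u)%:R / E%:R + 1) + (1 + D) ^+ m * (2 * D + 1) =
     2 ^+ m * 2 * (Nl u)%:R / E%:R + B by rewrite /B; ring.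
  apply: ler_wpM2r; first by rewrite addr_ge0 // divr_ge0 ?mulr_ge0 ?exprn_ge0 // ltW.
  have -> : (3 * (C1 K * (Nl u)%:R / (Hl u)%:R)) ^+ m = (3 * C1 K) ^+ m * ((Nl u)%:R ^+ n)^-1.
    by rewrite -NH -expr_div_n -exprMn; congr (_ ^+ _); ring.
  have -> : (d - m.+1 = n.-1)%N by rewrite /d; move: n0; lia.
  have -> : A0 / (Nl u)%:R = (2 * (m%:R * K) + 1) ^+ m * (3 ^+ n.-1 * (Nl u)%:R ^+ n.-1) * ((3 * C1 K) ^+ m * ((Nl u)%:R ^+ n)^-1).
    rewrite /A0 -[in (Nl u)%:R ^+ n](prednK n0) exprS invfM.
    set t := _ ^+ n.-1; set t' := (Nl u)%:R ^+ n.-1.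
    have t'0 : t' != 0 by rewrite expf_neq0 // gt_eqF.
    set t2 := (_ + 1) ^+ m; set t3 := (3 * C1 K) ^+ m.
    by field; rewrite t'0 gt_eqF.
  apply: ler_wpM2r; first by rewrite mulr_ge0 ?invr_ge0 ?exprn_ge0 ?mulr_ge0.
  apply: ler_wpM2l; first by rewrite exprn_ge0 ?addr_ge0 ?mulr_ge0.
  rewrite -exprMn; apply: lerXn2r; rewrite ?nnegrE ?mulr_ge0 //.
  by rewrite -natr1 natrM; lra.
have be2 : 0 < be1 / 2 by rewrite divr_gt0.
have -> : be1 = be1 / 2 + be1 / 2 by field.
rewrite mulrDr; apply: lerD.
  have -> : A0 / (Nl u)%:R * (2 ^+ m * 2 * (Nl u)%:R / E%:R) = A0 * 2 ^+ m * 2 / E%:R.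
    by field; rewrite !gt_eqF.
  by rewrite ler_pdivrMr // [_ * E%:R]mulrC -ler_pdivrMr.
rewrite mulrAC ler_pdivrMr // [_ * (Nl u)%:R]mulrC -ler_pdivrMr //; apply: (le_trans hu).
by rewrite ler_nat le_2_Nl.
Qed.

End Levels.

(** * The set of missed matrices is null *)

(** The factor [2 / q] is what sparse levels gain: earlier levels weigh little against the current
    one. *)
Lemma geo_sum (R : realType) (q : R) u : 2 <= q -> \sum_(i < u) q ^+ i <= 2 / q * q ^+ u.
Proof.
move=> q2; have q0 : 0 < q by lra.
elim: u => [|u IH]; first by rewrite big_ord0 expr0 mulr1 divr_ge0 // ltW.
rewrite big_ord_recr /= exprS mulrA divfK ?gt_eqF //.
have := ler_wpM2r (exprn_ge0 u (ltW q0)) q2.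
have : 2 / q * q ^+ u <= 1 * q ^+ u.
  by rewrite ler_wpM2r ?exprn_ge0 ?(ltW q0) // ler_pdivrMr // mul1r.
lra.
Qed.

Lemma Hl_mul m n L v : (Hl m n (L * v) ^ m = (2 ^ ((m + n) * L * m)) ^ v)%N.
Proof.
rewrite /Hl -!expnM; have -> // : ((m + n) * (L * v) * m = (m + n) * L * m * v)%N.
by rewrite -!mulnA [(m * v)%N]mulnC.
Qed.

Section Density.
Variables (R : realType) (m n : nat) (j0 : 'I_(m + n)) (f : 'I_m -> 'I_(m + n)) (K : R).
Hypothesis m0 : (0 < m)%N.
Hypothesis n0 : (0 < n)%N.
Hypothesis fi : injective f.
Hypothesis fj0 : forall l, f l != j0.
Hypothesis K1 : 1 <= K.
Let d := (m + n)%N.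
Let I : finType := ('I_(m + n) * 'I_(m + n))%type.

Definition cols (A : I -> R) (j : 'I_(m + n)) (i : 'I_m) : R := A (lshift n i, j).

(* The points [A] at which no level [u >= u1] produces an integer point close to the
   subspace, although the columns [f] form a basis and no integer point supported
   off [j0] is exceptionally close. *)
Definition missing (E : nat) (rho : nat -> R) (u1 : nat) : set (I -> R) :=
  [set A | [/\ forall p, `|A p| <= K,
     exists2 Z : 'I_m -> 'I_m -> R, forall l i, `|Z l i| <= K &
       forall (c : 'I_m -> R) l, c l = \sum_i Z l i * \sum_l' c l' * cols A (f l') i,
     forall u, (u1 <= u)%N -> forall s : {ffun 'I_(m + n) -> 'I_(2 * Nl m u).+1},
       zr R (s j0) = 0 -> (exists j, zr R (s j) != 0) ->
       exists i, C1 m n K * (Nl m u)%:R / (Hl m n u)%:R < `|tail j0 (cols A) s i| &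
     forall u, (u1 <= u)%N -> forall s : {ffun 'I_(m + n) -> 'I_(2 * Nl m u).+1},
       (Nl m u)%:R <= E%:R * `|zr R (s j0)| ->
       exists i, 3 * (Nl m u)%:R * rho u < `|lin j0 (cols A) s (cols A j0) i| ] ].

(** This is the density argument with proportion [be]. Divergence is asked along every progression
    [L (u + u0)], since [L] comes from the constants and [u0] from the box under consideration. *)
Lemma null_missing : exists E, (0 < E)%N /\ forall rho : nat -> R,
  (forall u, 0 < rho u <= 1 / (Hl m n u)%:R) ->
  (forall L u0 (B : R), (0 < L)%N -> exists t : nat,
     B <= \sum_(u < t) (rho (L * (u + u0))%N * (Hl m n (L * (u + u0)))%:R) ^+ m) ->
  forall u1, null (missing E rho u1).
Proof.
have K0 : 0 < K by apply: lt_le_trans K1.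
have [E [E0 small]] := small_levels m0 n0 K1.
exists E; split=> // rho rhoP div u1.
set C1' := C1 m n K in small.
have d1 : (0 < m + n)%N by rewrite addn_gt0 m0.
have C1'0 : 0 <= C1' by rewrite /C1' /C1 !mulr_ge0 // ltW.
pose C5 : R := C1' * E%:R.
have C50 : 0 <= C5 by rewrite mulr_ge0.
pose b1 : R := be1 R m.
have b10 : 0 < b1 by rewrite /b1 /be1 divr_gt0 // exprn_gt0.
pose c : R := 2 * b1 / (3 * (2 * C5 + 3)) ^+ m.
have c0 : 0 < c by rewrite divr_gt0 ?mulr_gt0 ?exprn_gt0 ?mulr_gt0 //; lra.
pose be : R := b1 / (2 * 6 ^+ m).
have be0 : 0 < be by rewrite divr_gt0 ?mulr_gt0 ?exprn_gt0.
have be1' : be <= 1.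
  have h1 : b1 <= 1.
    rewrite /b1 /be1 ler_pdivrMr // mul1r (@le_trans _ _ 1) //.
      by rewrite exprn_ile1 //; lra.
    lra.
  have h2 : 1 <= 2 * 6 ^+ m :> R.
    have : 1 <= 6 ^+ m :> R by rewrite exprn_ege1 // ler1n.
    lra.
  by rewrite ler_pdivrMr ?mul1r ?(le_trans h1) // (lt_le_trans ltr01).
(* Only every [L]-th level is used, so that enlarging all earlier cubes by the current spacing
   costs a geometric sum of ratio [2 ^ - (d * L * m)]. *)
have [L [L0 gsmall]] : exists L, (0 < L)%N /\
    (6 * (C5 + 1)) ^+ m * (2 / (2 ^ (d * L * m))%:R) <= b1 / 2.
  have [L hL] := pow2_ge ((6 * (C5 + 1)) ^+ m * 2 / (b1 / 2)).
  exists L.+1; split=> //; rewrite mulrA ler_pdivrMr ?ltr0n ?expn_gt0 //.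
  rewrite [_ * (_ ^ _)%:R]mulrC -ler_pdivrMr ?divr_gt0 //; apply: hL.
  by move: m0 d1; rewrite /d; nia.
have i0 : I by exact: (j0, j0).
apply: (@null_density_box R I i0 be K) => //.
  by move=> A [h _ _ _] p; rewrite -ler_norml.
move=> a b aK ab bK.
(* Only the top entries of column [j0] vary; the cells of all other entries are fixed by
   [card_fiber]. *)
pose g (i : 'I_m) : I := (lshift n i, j0).
have gi : injective g by move=> i i' /(congr1 fst); exact: lshift_inj.
pose a' := a \o g; pose b' := b \o g.
have ab' i : a' i < b' i by exact: ab.
pose si i := b' i - a' i.
have si0 i : 0 < si i by rewrite subr_gt0.
have [D D0 hD] := exists_bound (fun i => (2 * C1' + 1) / si i).
have [Sb Sb0 hSb] := exists_bound (fun i => 1 / si i).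
have [ua hua] := small D (ltW D0).
have [ub hub] := pow2_ge (4 * (C5 + 1) * Sb + 1).
pose u0 := maxn u1 (maxn ua ub).
pose lev u := (L * (u + u0))%N.
have levge u : (u0 <= lev u)%N by rewrite /lev (leq_trans (leq_addl u u0)) // leq_pmull.
have levua u : (ua <= lev u)%N by apply: leq_trans (levge u); rewrite !leq_max leqnn !orbT.
have levub u : (ub <= lev u)%N by apply: leq_trans (levge u); rewrite !leq_max leqnn !orbT.
have levu1 u : (u1 <= lev u)%N by apply: leq_trans (levge u); rewrite !leq_max leqnn.
have HR u : 0 < (Hl m n u)%:R :> R by rewrite ltr0n Hl_gt0.
have Hs u i : (C5 + 1) / (Hl m n (lev u))%:R < (b' i - a' i) / 4.
  rewrite ltr_pdivrMr // -/(si i) mulrAC ltr_pdivlMr // mulrC.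
  have h : 4 * (C5 + 1) * Sb < (Hl m n (lev u))%:R.
    have := hub _ (levub u); have : (2 ^ lev u)%:R <= (Hl m n (lev u))%:R :> R by rewrite ler_nat le_2_Hl.
    lra.
  have h2 : 1 <= Sb * si i by have := hSb i; rewrite ler_pdivrMr.
  apply: (@le_lt_trans _ _ (4 * (C5 + 1) * Sb * si i)).
    by rewrite -mulrA ler_peMr // mulr_ge0 // addr_ge0.
  by rewrite [ltRHS]mulrC ltr_pM2r.
(* Finitely many levels already bring the sum up to the target proportion, so one grid can resolve
   all of their cubes. *)
have [U hU] := div L u0 (be / c) L0.
have rho0 u : 0 < rho u by have /andP[] := rhoP u.
have rhoH u : rho u <= 1 / (Hl m n u)%:R by have /andP[] := rhoP u.
have [Sr Sr0 hSr] := exists_bound (fun u : 'I_U => 1 / rho (lev u)).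
have [M1 [M10 hM1]] := exists_natR (((m + n).+1%:R * K) * Sr).
(* [M1] makes the mesh fine compared with each [rho] of the [U] levels; the factor 4 gives the
   divisibility required to define the middle half. *)
pose M := (M1 * 4)%N.
have M0 : (0 < M)%N by rewrite muln_gt0 M10.
have MR : 0 < M%:R :> R by rewrite ltr0n.
have Mrho u : (u < U)%N -> (m + n).+1%:R * K / M%:R <= rho (lev u).
  move=> uU; rewrite ler_pdivrMr // [rho _ * _]mulrC -ler_pdivrMr //.
  apply: (@le_trans _ _ M1%:R); last by rewrite ler_nat leq_pmulr.
  apply: le_trans hM1; rewrite ler_wpM2l ?mulr_ge0 ?(ltW K0) //.
  by have := hSr (Ordinal uU); rewrite div1r.
have wK p : (b p - a p) / M%:R <= 2 * K / M%:R.
  by rewrite ler_pM2r ?invr_gt0 //; have := aK p; have := bK p; lra.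
have wr u i : (u < U)%N -> (b' i - a' i) / M%:R <= rho (lev u).
  move=> uU; apply: (le_trans (wK (g i))); apply: le_trans (Mrho _ uU).
  rewrite ler_pM2r ?invr_gt0 // ler_pM2r // (ler_nat R 2) ltnS //.
apply: (@coverable_grid R I i0 a b M _
   (fun s => `[< exists2 A, missing E rho u1 A & gcell a b s A >])) => //.
- by move=> p; exact: ltW.
- by move=> A s [mA _] sA; apply/asboolP; exists A.
set T : pred {ffun I -> 'I_M} := fun s => _.
apply: (@le_trans _ _ ((1 - be) * M%:R ^+ m * #|'I_M|%:R ^+ (#|I| - #|'I_m|))); last first.
  rewrite !card_ord -mulrA -exprD subnKC // card_prod !card_ord.
  by rewrite (leq_trans (leq_addr n m)) // leq_pmulr.
apply: (@card_fiber R 'I_m I 'I_M g (Ordinal M0) T) => // tau.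
have [ka0 Tka0|none] := pickP [pred ka : {ffun 'I_m -> 'I_M} | T (gluef g tau ka)]; last first.
  by rewrite eq_card0 // mulr_ge0 ?exprn_ge0 // subr_ge0.
(* One missing matrix [A0] of the slice supplies the fixed columns and the inverse [Z]; those of any
   other matrix in the slice differ from [A0] outside column [j0] by at most the mesh. *)
have /asboolP[A0 [A0K [Z ZK ZE] ND _] A0c] := Tka0.
pose y := cols A0.
pose hit u (p : 'I_m -> R) := hitpt (Nl m (lev u)) E j0 y p.
have hits_ge : be * M%:R ^+ m <= #|hits (M := M) a' b' (fun u => rho (lev u)) hit U|%:R.
  have -> : be = Order.min be (c * \sum_(u < U) (rho (lev u) * (Hl m n (lev u))%:R) ^+ m).
    by rewrite min_l // mulrC -ler_pdivrMr.
  apply: (@card_hits_ge R m M U a' b' (fun u => (Hl m n (lev u))%:R) (fun u => rho (lev u))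
    hit C5 b1 c (2 / (2 ^ (d * L * m))%:R)) => //.
  - move=> u uU.
    pose q : R := (2 ^ (d * L * m))%:R.
    have HE v : (Hl m n (lev v))%:R ^+ m = q ^+ u0 * q ^+ v :> R.
      by rewrite -exprD -!natrX Hl_mul [(v + u0)%N]addnC.
    under eq_bigr do rewrite HE.
    rewrite HE -mulr_sumr mulrCA ler_wpM2l ?exprn_ge0 // geo_sum //.
    rewrite /q (ler_nat R 2) -[2%N]expn1 leq_exp2l //.
    by rewrite /d !muln_gt0 d1 L0 m0.
  - move=> u uU V Vle.
    have rle : C1' * (Nl m (lev u))%:R / (Hl m n (lev u))%:R <= C1'.
      by rewrite -mulrA ler_piMr // ler_pdivrMr // mul1r ler_nat Nl_le_Hl.
    apply: (@separated_points R m (m + n) (Nl m (lev u)) (Hl m n (lev u)) E M j0 f y Z K D a' b'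
      K1 fi fj0 ZE ZK (fun j i _ => A0K (lshift n i, j)) (fun i => aK (g i)) (fun i => bK (g i)) ab' M0
      (Nl_gt0 _ _) (Hl_gt0 _ _ _) E0 (Hl_lt n m0 _) (ND _ (levu1 u)) _ (ltW D0) _ (hua _ (levua u)) _ _ V Vle).
    + move=> i; exact: le_trans (wr _ i uU) (rhoH _).
    + move=> i; have := hD i; rewrite ler_pdivrMr //.
      have e : 2 * (m + n)%:R * K = C1' by [].
      rewrite e -/(si i); lra.
    + by apply/dvdnP; exists M1.
    + move=> i; apply: le_lt_trans (Hs u i).
      by rewrite ler_pM2r ?invr_gt0 // lerDr.
pose Tt : pred {ffun 'I_m -> 'I_M} := [pred ka : {ffun 'I_m -> 'I_M} | T (gluef g tau ka)].
(* A cell that is hit contains no missing matrix. The hit gives [N rho], and replacing the columns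
   and the grid point by those of [A1] costs [2 N (d + 1) K / M <= 2 N rho]: this is the factor 3 in
   [missing]. *)
have disj ka : Tt ka -> hits (M := M) a' b' (fun u => rho (lev u)) hit U ka -> False.
  move=> /asboolP[A1 [A1K _ _ A1m] A1c] /asboolP[u [p [uU [s [sN sp]] kp]]].
  have [i] := A1m _ (levu1 u) s sN.
  apply/negP; rewrite -leNgt.
  set N := Nl m (lev u) in s sN sp *.
  have pi : A1 (g i) = cols A1 j0 i by [].
  have e0 : lin j0 (cols A1) s (cols A1 j0) i =
     zr R (s j0) * (A1 (g i) - p i) + \sum_(j | j != j0) zr R (s j) * (cols A1 j i - y j i).
    rewrite -[LHS]subr0 -[in LHS](sp i) /lin pi /tail.
    under [in RHS]eq_bigr do rewrite mulrBr.
    by rewrite sumrB; ring.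
  have h1 : `|A1 (g i) - p i| <= rho (lev u) + 2 * K / M%:R.
    have -> : A1 (g i) - p i = (A1 (g i) - gpt a' b' ka i) + (gpt a' b' ka i - p i) by ring.
    apply: (le_trans (ler_normD _ _)); rewrite addrC; apply: lerD => //.
    have e : gpt a b (gluef g tau ka) (g i) = gpt a' b' ka i by rewrite /gpt gluef_in.
    have := A1c (g i); have := wK (g i); rewrite e.
    move: (gpt a' b' ka i) (A1 (g i)) ((b (g i) - a (g i)) / M%:R) => G1 G2 G3 w1 /andP[w2 w3].
    have KM : 0 <= 2 * K / M%:R by rewrite divr_ge0 // mulr_ge0 // ltW.
    rewrite ler_norml; lra.
  have h2 j : j != j0 -> `|cols A1 j i - y j i| <= 2 * K / M%:R.
    move=> jj; have := A1c (lshift n i, j); have := A0c (lshift n i, j); have := wK (lshift n i, j).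
    have gp i' : g i' != (lshift n i, j) by apply: contra jj => /eqP[_ ->].
    rewrite /gpt !gluef_out // /y /cols ler_norml; lra.
  rewrite e0; apply: (le_trans (ler_normD _ _)).
  have NR : 0 <= N%:R :> R by [].
  have KM : 0 <= 2 * K / M%:R by rewrite divr_ge0 // mulr_ge0 // ltW.
  have b1' : `|zr R (s j0) * (A1 (g i) - p i)| <= N%:R * (rho (lev u) + 2 * K / M%:R).
    by rewrite normrM ler_pM // zr_le.
  have b2 : `|\sum_(j | j != j0) zr R (s j) * (cols A1 j i - y j i)| <= (m + n)%:R * (N%:R * (2 * K / M%:R)).
    apply: (le_trans (ler_norm_sum _ _ _)).
    rewrite -[(m + n)%N in leRHS]card_ord mulr_natl -sumr_const.
    rewrite big_mkcond /=; apply: ler_sum => j _; case: ifP => [jj|_].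
      by rewrite normrM ler_pM // ?zr_le // h2.
    by rewrite mulr_ge0.
  have h3 : N%:R * ((m + n).+1%:R * K / M%:R) <= N%:R * rho (lev u) by rewrite ler_wpM2l // Mrho.
  apply: (le_trans (lerD b1' b2)).
  have -> : N%:R * (rho (lev u) + 2 * K / M%:R) + (m + n)%:R * (N%:R * (2 * K / M%:R)) =
     N%:R * rho (lev u) + 2 * (N%:R * ((m + n).+1%:R * K / M%:R)) by rewrite -natr1; ring.
  lra.
have : (#|Tt| + #|hits (M := M) a' b' (fun u => rho (lev u)) hit U| <= M ^ m)%N.
  have -> : (M ^ m = #|{ffun 'I_m -> 'I_M}|)%N by rewrite card_ffun !card_ord.
  rewrite -(cardC Tt) leq_add2l; apply: subset_leq_card; apply/fintype.subsetP => ka hk.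
  by apply/negP => /disj; apply.
rewrite -(ler_nat R) natrD natrX; lra.
Qed.

End Density.

(** * The Borel-Cantelli half *)

Lemma coverable_finU (R : realType) (I : finType) (i0 : I) (T : finType) (P : pred T)
    (F : T -> set (I -> R)) (v : T -> R) :
  (forall t, P t -> coverable (F t) (v t)) ->
  coverable [set x | exists2 t, P t & F t x] (\sum_(t | P t) v t).
Proof.
move=> cF; pose s := [seq t <- enum T | P t].
pose G l := if onth s l is Some t then F t else set0.
pose u l := if onth s l is Some t then v t else 0.
apply: (@coverable_le _ _ (\bigcup_l G l) _ _ _ _ (lexx _)).
  move=> x [t Pt Ft]; have ts : t \in s by rewrite mem_filter Pt mem_enum.
  by exists (index t s) => //; rewrite /G onthE (nth_map t) ?index_mem ?nth_index.
have -> : \sum_(t | P t) v t = \sum_(t <- s) v t by rewrite big_filter big_enum_cond.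
have sP t : t \in s -> P t by rewrite mem_filter => /andP[].
apply: (@coverable_bigcup _ _ G u) => [l|K].
  rewrite /G /u; case E : (onth s l) => [t|].
    apply: cF; apply: sP; move: E; rewrite onthE.
    case: (ltnP l (size s)) => ls; last by rewrite nth_default // size_map.
    by rewrite (nth_map t) // => -[<-]; exact: mem_nth.
  by apply: (@coverable_fin R I i0 void xpred0 (fun _ => 0) (fun _ => 0)) => //; rewrite big_pred0.
rewrite -(big_mkord predT u) /index_iota subn0 /u.
have vs t : t \in s -> 0 <= v t by move=> /sP/cF/coverable_ge0.
elim: s K {sP G u} vs => [|t s IH] [|K] vs; rewrite ?big_nil //=.
- by rewrite big1_seq // => -[|l].
- by rewrite big_seq_cond sumr_ge0 // => t' /andP[/vs].
rewrite 2!big_cons /= lerD2l (iotaDl 1 0) big_map.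
by apply: IH => t' ts; apply: vs; rewrite inE ts orbT.
Qed.

Lemma tail_small (R : realType) (v : nat -> R) (B : R) : (forall s, 0 <= v s) ->
  (forall t, \sum_(s < t) v s <= B) ->
  forall e, 0 < e -> exists s0, forall t, \sum_(s < t) v (s0 + s)%N <= e.
Proof.
move=> v0 vB e e0; pose S t := \sum_(s < t) v s.
have hS : has_sup (range S).
  by split; [exists (S 0%N), 0%N|exists B => x [t _ <-]; exact: vB].
have [x [s0 _ <-] hx] := sup_adherent e0 hS.
exists s0 => t; have : S (s0 + t)%N <= sup (range S) by apply: ub_le_sup; [case: hS|exists (s0 + t)%N].
have -> : S (s0 + t)%N = S s0 + \sum_(s < t) v (s0 + s)%N.
  elim: t => [|t IH]; first by rewrite big_ord0 addr0 addn0.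
  by rewrite addnS {1}/S big_ord_recr /= -/(S _) IH big_ord_recr /= addrA.
lra.
Qed.

Section Slab.
Variables (R : realType) (m n : nat) (K : R).
Hypothesis m0 : (0 < m)%N.
Hypothesis n0 : (0 < n)%N.
Hypothesis K1 : 1 <= K.
Let I : finType := ('I_(m + n) * 'I_(m + n))%type.

Definition slab (k : 'I_(m + n) -> R) (r : R) : set (I -> R) :=
  [set A | (forall p, `|A p| <= K) /\ forall i : 'I_m, `|\sum_l k l * A (lshift n i, l)| <= r].

(** With the other entries confined to one cell each, the top entries of column [j] lie in a cube of
    half-side [D r / h]. Choosing [j] where [|k|] is largest keeps division by [k j] from magnifying
    the mesh errors. In [D = d + 3], two units come from the two matrices compared, [d] from the
    other columns, and one from the grid point. The constant does not depend on [k], so slabs can be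
    summed over a shell. *)
Lemma coverable_slab : exists2 C : R, 0 < C & forall (k : 'I_(m + n) -> R) j h r,
  (forall l, `|k l| <= `|k j|) -> 0 < h -> h <= `|k j| -> 0 < r ->
  coverable (slab k r) (C * (r / h) ^+ m).
Proof.
have K0 : 0 < K by apply: lt_le_trans K1.
pose D : R := (m + n).+3%:R.
exists ((3 * D / (2 * K)) ^+ m * (2 * K) ^+ #|I|) => [|k j h r kj h0 hk r0].
  by rewrite mulr_gt0 ?exprn_gt0 ?divr_gt0 ?mulr_gt0.
have i0 : I by exact: (j, j).
have [M [M0 hM]] := exists_natR (2 * K / (r / h)).
have MR : 0 < M%:R :> R by rewrite ltr0n.
have rh0 : 0 < r / h by rewrite divr_gt0.
have k0 : 0 < `|k j| by apply: lt_le_trans hk.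
pose w := 2 * K / M%:R.
have w0 : 0 < w by rewrite divr_gt0 ?mulr_gt0.
have wrh : w <= r / h by rewrite /w ler_pdivrMr // [_ * M%:R]mulrC -ler_pdivrMr.
pose a (i : I) : R := - K; pose b (i : I) : R := K.
have ab i : a i < b i by rewrite /a /b; lra.
have wE i : (b i - a i) / M%:R = w by rewrite /a /b /w; congr (_ / _); ring.
pose rho := D * (r / h).
have rho0 : 0 <= rho by rewrite /rho mulr_ge0 // ltW.
have volE : vol a b = (2 * K) ^+ #|I|.
  rewrite /vol (eq_bigr (fun=> 2 * K)) ?prodr_const // => i _; rewrite /a /b; ring.
have -> : (3 * D / (2 * K)) ^+ m * (2 * K) ^+ #|I| * (r / h) ^+ m = (3 * rho / (2 * K)) ^+ m * vol a b.
  rewrite volE mulrAC -exprMn; congr (_ ^+ m * _); rewrite /rho; ring.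
apply: (@coverable_grid R I i0 a b M _
   (fun s => `[< exists2 A, slab k r A & gcell a b s A >])) => //.
- by move=> i; exact: ltW.
- by move=> A [AK _] p; rewrite /a /b -ler_norml.
- by move=> A s mA sA; apply/asboolP; exists A.
set T : pred {ffun I -> 'I_M} := fun s => _.
pose g (i : 'I_m) : I := (lshift n i, j).
have gi : injective g by move=> i i' /(congr1 fst); exact: lshift_inj.
apply: (@le_trans _ _ ((3 * rho / (2 * K)) ^+ m * M%:R ^+ m * #|'I_M|%:R ^+ (#|I| - #|'I_m|))); last first.
  rewrite !card_ord -mulrA -exprD subnKC // card_prod !card_ord.
  by rewrite (leq_trans (leq_addr n m)) // leq_pmulr // addn_gt0 m0.
apply: (@card_fiber R 'I_m I 'I_M g (Ordinal M0) T) => // tau.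
have [ka0 Tka0|none] := pickP [pred ka : {ffun 'I_m -> 'I_M} | T (gluef g tau ka)]; last first.
  have h1 : 0 <= 3 * rho / (2 * K) by apply: divr_ge0; apply: mulr_ge0 => //; exact: ltW.
  by rewrite eq_card0 //; apply: mulr_ge0; apply: exprn_ge0.
have /asboolP[A0 [A0K A0r] A0c] := Tka0.
have -> : (3 * rho / (2 * K)) ^+ m * M%:R ^+ m = (3 * rho) ^+ #|'I_m| * dens (a \o g) (b \o g) M.
  rewrite densE (eq_bigr (fun=> w^-1)) => [|i _]; last by rewrite /= wE.
  rewrite prodr_const card_ord -!exprMn; congr (_ ^+ m); rewrite /w; field.
  by rewrite !gt_eqF.
apply: (@cube_le R _ (a \o g) (b \o g) M _ M0 _ (A0 \o g)) => [i|i|ka i].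
- exact: ab.
- rewrite /= wE (le_trans wrh) // /rho ler_peMl ?(ltW rh0) // /D ler1n //.
move=> /asboolP[A1 [A1K A1r] A1c] /=.
have e : gpt a b (gluef g tau ka) (g i) = gpt (a \o g) (b \o g) ka i by rewrite /gpt gluef_in.
have h1 : `|gpt (a \o g) (b \o g) ka i - A1 (g i)| <= w.
  have /andP[] := A1c (g i); rewrite wE e ler_norml; lra.
have h2 l : l != j -> `|A1 (lshift n i, l) - A0 (lshift n i, l)| <= w.
  move=> lj; have /andP[] := A1c (lshift n i, l); have /andP[] := A0c (lshift n i, l).
  have gp i' : g i' != (lshift n i, l) by apply: contra lj => /eqP[_ ->].
  rewrite wE /gpt !gluef_out // ler_norml; lra.
have h3 : `|A1 (g i) - A0 (g i)| <= 2 * (r / h) + (m + n)%:R * w.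
  have E : k j * (A1 (g i) - A0 (g i)) = \sum_l k l * A1 (lshift n i, l) - \sum_l k l * A0 (lshift n i, l)
     - \sum_(l | l != j) k l * (A1 (lshift n i, l) - A0 (lshift n i, l)).
    rewrite (bigD1 j) //= [X in _ - X - _](bigD1 j) //=.
    under [X in _ - X]eq_bigr do rewrite mulrBr.
    by rewrite sumrB /g; ring.
  have h4 : `|k j * (A1 (g i) - A0 (g i))| <= 2 * r + (m + n)%:R * (`|k j| * w).
    rewrite E; apply: (le_trans (ler_normB _ _)); apply: lerD.
      apply: (le_trans (ler_normB _ _)); have := A0r i; have := A1r i; lra.
    apply: (le_trans (ler_norm_sum _ _ _)).
    rewrite -[(m + n)%N in leRHS]card_ord mulr_natl -sumr_const.
    rewrite big_mkcond /=; apply: ler_sum => l _; case: ifP => [lj|_].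
      by rewrite normrM ler_pM // h2.
    by rewrite mulr_ge0 // ltW.
  rewrite -(ler_pM2l k0) -normrM; apply: (le_trans h4).
  have rE : r = h * (r / h) by field; rewrite gt_eqF.
  have h5 : h * (r / h) <= `|k j| * (r / h) by rewrite ler_pM2r.
  have -> : `|k j| * (2 * (r / h) + (m + n)%:R * w) = 2 * (`|k j| * (r / h)) + (m + n)%:R * (`|k j| * w) by ring.
  by rewrite lerD2r ler_pM2l // {1}rE.
have -> : gpt (a \o g) (b \o g) ka i - A0 (g i) =
   (gpt (a \o g) (b \o g) ka i - A1 (g i)) + (A1 (g i) - A0 (g i)) by ring.
apply: (le_trans (ler_normD _ _)).
have h5 : (m + n)%:R * w <= (m + n)%:R * (r / h) by rewrite ler_wpM2l.
have DE : D = (m + n)%:R + 3 by rewrite /D -addn3 natrD.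
rewrite /rho DE mulrDl; lra.
Qed.

End Slab.

Lemma exists_max (R : realType) (J : finType) (x : J -> R) (j1 : J) :
  exists j, forall l, x l <= x j.
Proof.
have [j _ h] := @Order.TotalTheory.arg_maxP _ R J j1 xpredT x isT.
by exists j => l; exact: h.
Qed.

Lemma zr_resize (R : realType) (J : finType) (N Q : nat) (s : {ffun J -> 'I_(2 * N).+1}) :
  (forall j, `|zr R (s j)| <= Q%:R) ->
  exists s' : {ffun J -> 'I_(2 * Q).+1}, forall j, zr R (s' j) = zr R (s j).
Proof.
move=> h; have hb j : (N <= s j + Q)%N /\ (s j + Q - N < (2 * Q).+1)%N.
  have := h j; rewrite ler_norml /zr => /andP[h1 h2].
  have le1 : (N <= s j + Q)%N by rewrite -(ler_nat R) natrD; lra.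
  split=> //; rewrite ltnS -(ler_nat R) natrB // natrD natrM; lra.
exists [ffun j => Ordinal (hb j).2] => j; rewrite /zr ffunE /= natrB; last by have [] := hb j.
by rewrite natrD; ring.
Qed.

Section BC.
Variables (R : realType) (m n : nat) (K : R).
Hypothesis m0 : (0 < m)%N.
Hypothesis n0 : (0 < n)%N.
Hypothesis K1 : 1 <= K.
Let I : finType := ('I_(m + n) * 'I_(m + n))%type.
Let j1 : 'I_(m + n) := Ordinal (leq_trans m0 (leq_addr n m)).

(* The lower bound [Nl m s <= max |k|] is imposed by the predicates on the shell. *)
Definition shell s : finType := {ffun 'I_(m + n) -> 'I_(2 * Nl m s.+1).+1}.

Lemma null_limsup (S : forall s, pred (shell s)) (r : nat -> R) (B : R) :
  (forall s, 0 < r s) ->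
  (forall s (k : shell s), S s k -> exists j, (Nl m s)%:R <= `|zr R (k j)|) ->
  (forall t, \sum_(s < t) #|S s|%:R * (r s / (Nl m s)%:R) ^+ m <= B) ->
  null [set A : I -> R | (forall p, `|A p| <= K) /\
    forall s0, exists s, (s0 <= s)%N /\ exists2 k : shell s, S s k &
      forall i, `|\sum_l zr R (k l) * A (lshift n i, l)| <= r s].
Proof.
move=> r0 SN sB e e0.
have [C C0 hC] := coverable_slab n m0 K1.
pose v s := #|S s|%:R * (r s / (Nl m s)%:R) ^+ m.
have NR s : 0 < (Nl m s)%:R :> R by rewrite ltr0n Nl_gt0.
have v0 s : 0 <= v s by rewrite mulr_ge0 // exprn_ge0 // divr_ge0 ?ltW.
have [s0 hs0] := tail_small v0 sB (divr_gt0 e0 C0).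
pose F s : set (I -> R) := [set A | exists2 k : shell s, S s k & slab K (fun l => zr R (k l)) (r s) A].
apply: (@coverable_le _ _ (\bigcup_s F (s0 + s)%N) _ e) => //.
  move=> A [AK /(_ s0)[s [s0s [k Sk kr]]]]; exists (s - s0)%N => //.
  by rewrite /F subnKC //; exists k.
apply: (@coverable_bigcup _ _ _ (fun s => C * v (s0 + s)%N)) => [s|t].
  have -> : C * v (s0 + s)%N = \sum_(k | S (s0 + s)%N k) C * (r (s0 + s)%N / (Nl m (s0 + s))%:R) ^+ m.
    by rewrite sumr_const -[RHS]mulr_natl /v mulrCA.
  apply: (@coverable_finU R I (j1, j1)) => k Sk.
  have [j hj] := exists_max (fun l => `|zr R (k l)|) j1.
  apply: (hC _ j) => //; have [j' hj'] := SN _ _ Sk; exact: le_trans hj' (hj j').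
by rewrite -mulr_sumr mulrC -ler_pdivlMr.
Qed.

(** Borel-Cantelli says nothing about finitely many short vectors; outside this set their top parts
    are nonzero, hence bounded away from 0. *)
Lemma null_kernel : null [set A : I -> R | (forall p, `|A p| <= K) /\
  exists2 k : {ffun 'I_(m + n) -> int}, exists j, k j != 0 &
    forall i : 'I_m, \sum_l (k l)%:~R * A (lshift n i, l) = 0].
Proof.
have [C C0 hC] := coverable_slab n m0 K1.
pose F (k : {ffun 'I_(m + n) -> int}) : set (I -> R) :=
  [set A | (forall p, `|A p| <= K) /\ (exists j, k j != 0) /\
    forall i : 'I_m, \sum_l (k l)%:~R * A (lshift n i, l) = 0].
apply: (@null_sub _ _ [set A | exists k, F k A]).
  by move=> A [AK [k k0 h]]; exists k.
apply: (null_bigcup_count (j1, j1)) => k.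
have [[j kj0]|no] := pselect (exists j, k j != 0); last first.
  apply: (@null_sub R I set0); last exact: (@null0 R I (j1, j1)).
  by move=> A [_ [/no]].
move=> e e0.
have [j' hj'] := exists_max (fun l => `|(k l)%:~R : R|) j.
have h0 : 0 < `|(k j')%:~R : R|.
  by apply: lt_le_trans (hj' j); rewrite normr_gt0 intr_eq0.
(* The cap at 1 gives [t ^ m <= t]. *)
pose t := Order.min 1 (e / C).
have t0 : 0 < t by rewrite lt_min ltr01 divr_gt0.
apply: (@coverable_le _ _ (slab K (fun l => (k l)%:~R) (t * `|(k j')%:~R|)) _ (C * (t * `|(k j')%:~R| / `|(k j')%:~R|) ^+ m)).
- by move=> A [AK [_ h]]; split=> // i; rewrite h normr0 mulr_ge0 // ltW.
- rewrite mulfK ?gt_eqF // mulrC -ler_pdivlMr //.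
  have : t ^+ m <= t ^+ 1.
    by apply: ler_wiXn2l => //; rewrite ?(ltW t0) // ge_min lexx.
  by rewrite expr1 => /le_trans; apply; rewrite ge_min lexx orbT.
- by apply: (hC _ j') => //; rewrite mulr_gt0.
Qed.

Lemma card_shell_fix (j0 : 'I_(m + n)) (x0 : nat) s (S : pred (shell s)) :
  (forall k, S k -> k j0 = x0 :> nat) -> #|S|%:R <= (3 * (Nl m s.+1)%:R) ^+ (m + n).-1 :> R.
Proof.
move=> Sj0; set Q := Nl m s.+1.
have Q1 : 1 <= Q%:R :> R by rewrite ler1n Nl_gt0.
pose al (j : 'I_(m + n)) : R := if j == j0 then x0%:R else 0.
pose be (j : 'I_(m + n)) : R := if j == j0 then x0%:R else 2 * Q%:R.
apply: le_trans (@card_box_le R _ _ S al be _ _) _.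
- by move=> j; rewrite /al /be; case: ifP => // _; rewrite mulr_ge0.
- move=> k j Sk; rewrite /al /be; case: eqP => [->|_]; first by rewrite Sj0 // lexx.
  by rewrite ler0n /= -natrM ler_nat -ltnS.
rewrite (bigD1 j0) //= /al /be eqxx subrr add0r mul1r.
rewrite (eq_bigr (fun=> 2 * Q%:R + 1)) => [|j /negbTE ->]; last by rewrite subr0.
rewrite prodr_const.
have -> : #|(fun i : 'I_(m + n) => i != j0)| = (m + n).-1.
  by have := cardC1 j0; rewrite card_ord => <-; apply: eq_card => j; rewrite !inE.
apply: lerXn2r; rewrite ?nnegrE ?addr_ge0 ?mulr_ge0 //; lra.
Qed.

Lemma card_shell s (S : pred (shell s)) : #|S|%:R <= (3 * (Nl m s.+1)%:R) ^+ (m + n) :> R.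
Proof.
have Q1 : 1 <= (Nl m s.+1)%:R :> R by rewrite ler1n Nl_gt0.
apply: (@le_trans _ _ ((2 * Nl m s.+1).+1 ^ (m + n))%:R).
  by rewrite ler_nat (leq_trans (max_card _)) // card_ffun !card_ord.
rewrite natrX; apply: lerXn2r; rewrite ?nnegrE ?mulr_ge0 // -natr1 natrM; lra.
Qed.

Lemma NHs u : (Nl m u)%:R / (Hl m n u)%:R = ((2 ^ (n * u))%:R)^-1 :> R.
Proof.
have -> : (Hl m n u)%:R = (Nl m u)%:R * (2 ^ (n * u))%:R :> R by rewrite -natrM -expnD -mulnDl.
by rewrite invfM mulrA divff ?mul1r // pnatr_eq0 -lt0n Nl_gt0.
Qed.

Lemma sum_half (c : R) t : 0 <= c -> \sum_(s < t) c / (2 ^ s)%:R <= 2 * c.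
Proof.
move=> c0; suff -> : \sum_(s < t) c / (2 ^ s)%:R = 2 * c - 2 * c / (2 ^ t)%:R.
  by rewrite gerBl divr_ge0 // mulr_ge0.
elim: t => [|t IH]; first by rewrite big_ord0 expn0 divr1 subrr.
rewrite big_ord_recr /= IH expnS natrM; field.
by rewrite pnatr_eq0 -lt0n expn_gt0.
Qed.

Lemma tail_sum (A : I -> R) N (j0 : 'I_(m + n)) (s : {ffun 'I_(m + n) -> 'I_(2 * N).+1}) i :
  zr R (s j0) = 0 -> tail j0 (cols A) s i = \sum_l zr R (s l) * A (lshift n i, l).
Proof. by move=> s0; rewrite [RHS](bigD1 j0) //= s0 mul0r add0r. Qed.

(** With [k_j0 = 0] a shell has only about [N ^ (d - 1)] vectors, each with a slab of volume about
    [N ^ (- d)], so the sum is about [1 / N] per level and converges. A vector counted at level [u]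
    may come from an earlier shell; this is harmless because the threshold [r] decreases with the
    level. *)
Lemma null_ND (j0 : 'I_(m + n)) : null [set A : I -> R | (forall p, `|A p| <= K) /\
  ~ exists u1, forall u, (u1 <= u)%N -> forall s : {ffun 'I_(m + n) -> 'I_(2 * Nl m u).+1},
       zr R (s j0) = 0 -> (exists j, zr R (s j) != 0) ->
       exists i, C1 m n K * (Nl m u)%:R / (Hl m n u)%:R < `|tail j0 (cols A) s i|].
Proof.
have K0 : 0 < K by apply: lt_le_trans K1.
have C10 : 0 < C1 m n K by rewrite /C1 !mulr_gt0 // ltr0n addn_gt0 m0.
have NR u : 0 < (Nl m u)%:R :> R by rewrite ltr0n Nl_gt0.
have HR u : 0 < (Hl m n u)%:R :> R by rewrite ltr0n Hl_gt0.
pose r u : R := C1 m n K * (Nl m u)%:R / (Hl m n u)%:R.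
have r0 u : 0 < r u by rewrite divr_gt0 // mulr_gt0.
have rE u : r u = C1 m n K / (2 ^ (n * u))%:R by rewrite /r -mulrA NHs.
(* In the shifted encoding the ordinal [Nl m s.+1] stands for the integer 0. *)
pose S s : pred (shell s) := fun k =>
  (k j0 == Nl m s.+1 :> nat) && [exists j, (Nl m s)%:R <= `|zr R (k j)|].
pose c : R := (3 * (2 ^ m)%:R) ^+ (m + n).-1 * C1 m n K ^+ m.
have c0 : 0 <= c by rewrite /c mulr_ge0 ?exprn_ge0 ?mulr_ge0 // ltW.
have sB t : \sum_(s < t) #|S s|%:R * (r s / (Nl m s)%:R) ^+ m <= 2 * c.
  apply: le_trans (sum_half t c0); apply: ler_sum => s _.
  apply: (@le_trans _ _ (c / (Nl m s)%:R)); last first.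
    rewrite ler_wpM2l // lef_pV2 ?posrE ?ltr0n ?expn_gt0 // ler_nat; exact: le_2_Nl.
  apply: (@le_trans _ _ ((3 * (Nl m s.+1)%:R) ^+ (m + n).-1 * (r s / (Nl m s)%:R) ^+ m)).
    apply: ler_wpM2r; first by rewrite exprn_ge0 // divr_ge0 // ltW.
    by apply: (@card_shell_fix j0 (Nl m s.+1)) => k /andP[/eqP].
  have -> : (r s / (Nl m s)%:R) ^+ m = C1 m n K ^+ m * ((Nl m s)%:R ^+ (m + n))^-1.
    rewrite /r expr_div_n -mulrA exprMn expr_div_n NH // -mulrA -invfM -exprD.
    by rewrite addnC.
  have -> : (Nl m s.+1)%:R = (2 ^ m)%:R * (Nl m s)%:R :> R.
    by rewrite -natrM -expnD /Nl mulnS.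
  have -> : (Nl m s)%:R ^+ (m + n) = (Nl m s)%:R * (Nl m s)%:R ^+ (m + n).-1 :> R.
    by rewrite -exprS prednK // addn_gt0 m0.
  rewrite mulrA /c; move: (C1 m n K) => c1; rewrite !exprMn le_eqVlt; apply/orP; left; apply/eqP.
  have := NR s; set N := (Nl m s)%:R => N0; have : N ^+ (m + n).-1 != 0 by rewrite expf_neq0 // gt_eqF.
  set X := N ^+ _ => X0; set Y := 3 ^+ (m + n).-1; set V := (2 ^ m)%:R ^+ _; set Z := c1 ^+ m.
  by field; rewrite X0 gt_eqF.
have SN s (k : shell s) : S s k -> exists j, (Nl m s)%:R <= `|zr R (k j)|.
  by move=> /andP[_ /existsP].
have n1 := null_limsup r0 SN sB.
apply: null_sub (nullU (j1, j1) n1 null_kernel) => A [AK noU].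
have [kerA|kerA] := pselect (exists2 k : {ffun 'I_(m + n) -> int}, exists j, k j != 0 &
    forall i : 'I_m, \sum_l (k l)%:~R * A (lshift n i, l) = 0); first by right.
left; split=> // s0; apply: contrapT => no; apply: noU.
have far s : (s0 <= s)%N -> forall k : shell s, S s k ->
    exists i, r s < `|\sum_l zr R (k l) * A (lshift n i, l)|.
  move=> s0s k Sk; apply: contrapT => h; apply: no; exists s; split=> //; exists k => // i.
  by rewrite leNgt; apply/negP => h'; apply: h; exists i.
(* Bounding the inverses of the finitely many nonzero values above by [D] bounds the values below by
   [1 / D]. *)
have /choice[x xP] : forall s : {ffun 'I_(m + n) -> 'I_(2 * Nl m s0).+1}, exists y : R,
    (exists j, zr R (s j) != 0) -> exists2 i, 0 < `|\sum_l zr R (s l) * A (lshift n i, l)|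
      & y = `|\sum_l zr R (s l) * A (lshift n i, l)|^-1.
  move=> s.
  have [[j sj]|nj] := pselect (exists j, zr R (s j) != 0); last by exists 0 => /nj.
  have [i hi] : exists i, \sum_l zr R (s l) * A (lshift n i, l) != 0.
    apply: contrapT => h; apply: kerA; exists [ffun j => (s j)%:Z - (Nl m s0)%:Z].
      by exists j; rewrite ffunE -(intr_eq0 R) -zr_int.
    move=> i; apply/eqP/negPn/negP => hi; apply: h; exists i; move: hi; congr (_ != 0).
    by apply: eq_bigr => l _; rewrite ffunE zr_int.
  by eexists => _; exists i; [rewrite normr_gt0|].
have [D D0 hD] := exists_bound x.
have [u1 hu1] := pow2_ge (C1 m n K * D + 1).
exists u1 => u u1u s sj0 [j sj].
have Ru : r u < D^-1.
  rewrite rE ltr_pdivrMr ?ltr0n ?expn_gt0 // mulrC ltr_pdivlMr //.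
  have h : (2 ^ u)%:R <= (2 ^ (n * u))%:R :> R by rewrite ler_nat leq_exp2l // leq_pmull.
  have := hu1 _ u1u; lra.
have [j' hj'] := exists_max (fun l => `|zr R (s l)|) j.
have ex : exists t, `|zr R (s j')| <= (Nl m t)%:R by exists u; exact: zr_le.
(* The least level whose range contains the vector: it is either among the short vectors of level
   [s0] or in a shell beyond [s0], where Borel-Cantelli applies. *)
have [t tP tmin] := ex_minnP ex.
have tu : (t <= u)%N by apply: tmin; exact: zr_le.
have small_or : (t <= s0)%N \/ exists2 t', t = t'.+1 & (s0 <= t')%N.
  case: t {tP tmin tu} => [|t']; first by left.
  by case: (leqP t'.+1 s0) => h; [left|right; exists t'].
case: small_or => [ts0|[t' tE s0t']].
  have hs l : `|zr R (s l)| <= (Nl m s0)%:R.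
    apply: (le_trans (hj' l)); apply: (le_trans tP); rewrite ler_nat.
    by rewrite leq_exp2l // leq_mul2l ts0 orbT.
  have [s' s'E] := zr_resize hs.
  have [i hi xE] : exists2 i, 0 < `|\sum_l zr R (s' l) * A (lshift n i, l)|
      & x s' = `|\sum_l zr R (s' l) * A (lshift n i, l)|^-1.
    by apply: xP; exists j; rewrite s'E.
  exists i; rewrite tail_sum // -/(r u).
  have -> : \sum_l zr R (s l) * A (lshift n i, l) = \sum_l zr R (s' l) * A (lshift n i, l).
    by apply: eq_bigr => l _; rewrite s'E.
  apply: (lt_le_trans Ru); rewrite -[leRHS]invrK lef_pV2 ?posrE ?invr_gt0 //.
  by rewrite -xE.
have hs l : `|zr R (s l)| <= (Nl m t'.+1)%:R by rewrite -tE (le_trans (hj' l)).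
have [s' s'E] := zr_resize hs.
have Ss' : S t' s'.
  apply/andP; split.
    have := s'E j0; rewrite sj0 /zr => /eqP; rewrite subr_eq0 eqr_nat //.
  apply/existsP; exists j'; rewrite s'E; rewrite leNgt; apply/negP => h.
  by have := tmin t' (ltW h); rewrite tE ltnn.
have [i hi] := far _ s0t' _ Ss'; exists i; rewrite tail_sum // -/(r u).
have -> : \sum_l zr R (s l) * A (lshift n i, l) = \sum_l zr R (s' l) * A (lshift n i, l).
  by apply: eq_bigr => l _; rewrite s'E.
apply: le_lt_trans hi; rewrite !rE ler_pM2l // lef_pV2 ?posrE ?ltr0n ?expn_gt0 // ler_nat leq_exp2l // leq_mul2l.
by rewrite (leq_trans _ tu) ?orbT // tE.
Qed.

End BC.

(** * Condensation *)

Section Condensation.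
Variables (R : realType) (psi : R -> R) (be q : R).
Hypothesis psi0 : forall x, 1 <= x -> 0 < psi x.
Hypothesis psi_le : forall x y, 1 <= x -> x <= y -> psi y <= psi x.
Hypothesis psic : {within [set x : R | 1 <= x], continuous psi}.
Hypothesis be1 : 1 <= be.
Hypothesis q1 : 2 <= q.

Local Notation mu := (@lebesgue_measure R).
Let f x := (psi x)%:E.
Let D : set R := [set x | 1 <= x].
Let X t : R := be * q ^+ t.

Let mD : measurable D.
Proof. by rewrite /D -set_itvcy; exact: measurable_itv. Qed.

Let mf : measurable_fun D f.
Proof. by apply/measurable_EFinP; exact: subspace_continuous_measurable_fun. Qed.

Let f0 x : D x -> (0 <= f x)%E.
Proof. by move=> /psi0 h; rewrite lee_fin ltW. Qed.

Let qt t : 1 <= q ^+ t. Proof. by rewrite exprn_ege1 // (le_trans _ q1) // ler1n. Qed.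

Let X1 t : 1 <= X t.
Proof. by rewrite /X -[leLHS]mulr1; apply: ler_pM => //; exact: qt. Qed.

Let XS t : X t <= X t.+1.
Proof. by rewrite /X exprS mulrCA ler_peMl ?(le_trans ler01) ?X1 // (le_trans _ q1) // ler1n. Qed.

Let XE t : X t.+1 - X t = be * (q - 1) * q ^+ t.
Proof. by rewrite /X exprS; ring. Qed.

Let J t : set R := [set` `[1, X t[%R].
Let P t : set R := [set` `[X t, X t.+1[%R].

Let mJ t : measurable (J t). Proof. exact: measurable_itv. Qed.
Let mP t : measurable (P t). Proof. exact: measurable_itv. Qed.
Let JD t : J t `<=` D. Proof. by move=> x; rewrite /J /= in_itv /= => /andP[]. Qed.
Let PD t : P t `<=` D.
Proof. by move=> x; rewrite /P /= in_itv /= => /andP[h _]; exact: le_trans (X1 t) h. Qed.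

Let JS t : J t.+1 = J t `|` P t.
Proof.
apply/seteqP; split=> x; rewrite /J /P /= !in_itv /=.
  by move=> /andP[h1 h2]; have [h|h] := ltP x (X t); [left; rewrite h1|right].
move=> [/andP[h1 h2]|/andP[h1 h2]]; apply/andP; split=> //.
  exact: lt_le_trans h2 (XS t).
exact: le_trans (X1 t) h1.
Qed.

Let intS t : (\int[mu]_(x in J t.+1) f x = \int[mu]_(x in J t) f x + \int[mu]_(x in P t) f x)%E.
Proof.
rewrite JS ge0_integral_setU //.
- exact: mJ.
- exact: mP.
- by apply: (measurable_funS mD _ mf) => x [/JD|/PD].
- by move=> x [/JD|/PD]; exact: f0.
- rewrite disj_set2E; apply/eqP/seteqP; split=> x //; rewrite /J /P /= !in_itv /=.
  by move=> [/andP[_ h1] /andP[h2 _]]; have := lt_le_trans h1 h2; rewrite ltxx.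
Qed.

Let muP a b : a <= b -> mu [set` `[a, b[%R] = (b - a)%:E.
Proof.
move=> ab; rewrite lebesgue_measure_itv /= lte_fin; case: ltP => // ba.
by have -> : b = a; [apply/le_anti; rewrite ba|rewrite subrr].
Qed.

Let intc a b c : a <= b -> (\int[mu]_(x in [set` `[a, b[%R]) (cst c%:E) x = ((b - a) * c)%:E)%E.
Proof.
move=> ab; rewrite integral_cst; last exact: measurable_itv.
by rewrite mulrC EFinM; congr (_ * _)%E; exact: muP.
Qed.

Let upper a b : 1 <= a -> a <= b -> (\int[mu]_(x in [set` `[a, b[%R]) f x <= ((b - a) * psi a)%:E)%E.
Proof.
move=> a1 ab; rewrite -intc //.
have sub : [set` `[a, b[%R] `<=` D.
  by move=> x; rewrite /= in_itv /= => /andP[h _]; exact: le_trans a1 h.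
apply: ge0_le_integral => //.
- by move=> x /sub; exact: f0.
- exact: measurable_funS mD sub mf.
- by move=> x xab; rewrite lee_fin psi_le //; move: xab; rewrite /= in_itv /= => /andP[].
Qed.

Let lower a b : 1 <= a -> a <= b -> (((b - a) * psi b)%:E <= \int[mu]_(x in [set` `[a, b[%R]) f x)%E.
Proof.
move=> a1 ab; rewrite -intc //.
have sub : [set` `[a, b[%R] `<=` D.
  by move=> x; rewrite /= in_itv /= => /andP[h _]; exact: le_trans a1 h.
apply: ge0_le_integral => //.
- by move=> x _; rewrite lee_fin ltW // psi0 // (le_trans a1).
- exact: measurable_funS mD sub mf.
- move=> x xab; rewrite lee_fin psi_le //; first exact: sub.
  by move: xab; rewrite /= in_itv /= => /andP[_ /ltW].
Qed.

(** Cauchy condensation along [be * q ^ t], with upper sums. The starting point [be] is free because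
    [psi] is sampled at constant multiples of a geometric sequence; the stretch before it adds
    [(be - 1) * psi 1]. *)
Lemma condensation_fin (B : R) : (forall t, \sum_(u < t) q ^+ u * psi (X u) <= B) ->
  (\int[mu]_(x in D) f x < +oo)%E.
Proof.
move=> hB; pose C := (be - 1) * psi 1 + be * (q - 1) * B.
have bq : 0 <= be * (q - 1) by have := be1; have := q1; nra.
have IJ t : (\int[mu]_(x in J t) f x <= ((be - 1) * psi 1 + be * (q - 1) * \sum_(u < t) q ^+ u * psi (X u))%:E)%E.
  elim: t => [|t IH].
    by rewrite big_ord0 mulr0 addr0 /J /X expr0 mulr1; exact: upper.
  rewrite intS; apply: (le_trans (leeD IH (upper (X1 t) (XS t)))).
  rewrite -EFinD lee_fin le_eqVlt big_ord_recr; apply/orP; left; apply/eqP.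
  by rewrite /= XE; ring.
have cupJ : \bigcup_t J t = D.
  apply/seteqP; split=> x; first by move=> [t _ /JD].
  move=> Dx; have [t ht] : exists t, x < X t.
    have [n hn] : exists n : nat, x < q ^+ n.
      exists (Num.truncn x).+1; apply: (lt_le_trans (truncnS_gt x)).
      apply: (@le_trans _ _ (2 ^+ (Num.truncn x).+1)).
        by rewrite -natrX ler_nat ltnW // ltn_expl.
      have q0 : 0 <= q by apply: le_trans q1.
      by apply: lerXn2r; rewrite ?nnegrE.
    by exists n; apply: (lt_le_trans hn); rewrite /X ler_peMl // (le_trans ler01) ?qt.
  by exists t => //; rewrite /J /= in_itv /= Dx.
have ndJ : nondecreasing_seq J.
  by apply/nondecreasing_seqP => t; rewrite subsetEset JS; exact: subsetUl.
have cv : (\int[mu]_(x in J i) f x @[i --> \oo] --> \int[mu]_(x in D) f x)%E.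
  rewrite -cupJ; apply: ge0_nondecreasing_set_cvg_integral => //.
  - by move=> i; exact: measurable_funS mD (@JD i) mf.
  - by move=> i x /JD; exact: f0.
apply: (@le_lt_trans _ _ C%:E); last exact: ltry.
apply: (cvge_le _ cv); near=> t; apply: (le_trans (IJ t)).
by rewrite lee_fin /C lerD2l ler_wpM2l.
Unshelve. all: by end_near.
Qed.

(** Lower sums evaluate [psi] at right endpoints, so the index shifts by one: this costs a factor
    [q] and the separate first term [psi be]. *)
Lemma condensation_bound : (\int[mu]_(x in D) f x < +oo)%E ->
  exists B, forall t, \sum_(u < t) q ^+ u * psi (X u) <= B.
Proof.
move=> fin; have I0 : (0 <= \int[mu]_(x in D) f x)%E by apply: integral_ge0 => x /f0.
pose Y := fine (\int[mu]_(x in D) f x)%E.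
have YE : (\int[mu]_(x in D) f x = Y%:E)%E by rewrite fineK // ge0_fin_numE.
have bq : 0 < be * (q - 1) by have := be1; have := q1; nra.
have q0 : 0 < q by have := q1; lra.
have IJ t : ((be * (q - 1) * \sum_(u < t) q ^+ u * psi (X u.+1))%:E <= \int[mu]_(x in J t) f x)%E.
  elim: t => [|t IH].
    by rewrite big_ord0 mulr0; apply: integral_ge0 => x /JD/f0.
  rewrite intS; apply: le_trans (leeD IH (lower (X1 t) (XS t))).
  rewrite -EFinD lee_fin le_eqVlt big_ord_recr; apply/orP; left; apply/eqP.
  by rewrite /= XE; ring.
have hY t : \sum_(u < t) q ^+ u * psi (X u.+1) <= Y / (be * (q - 1)).
  rewrite ler_pdivlMr // mulrC -lee_fin -YE; apply: (le_trans (IJ t)).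
  by apply: ge0_subset_integral; [exact: mJ|exact: mD|exact: mf|exact: f0|exact: JD].
exists (psi be + q * (Y / (be * (q - 1)))) => -[|t].
  rewrite big_ord0 addr_ge0 ?(ltW (psi0 be1)) //.
  by have := hY 0%N; rewrite big_ord0 => h; rewrite mulr_ge0 // ltW.
rewrite big_ord_recl /= expr0 mul1r /X expr0 mulr1 lerD2l.
have -> : \sum_(u < t) q ^+ bump 0 u * psi (be * q ^+ bump 0 u) = q * \sum_(u < t) q ^+ u * psi (X u.+1).
  by rewrite mulr_sumr; apply: eq_bigr => u _; rewrite /bump /= add1n mulrA -exprS.
by rewrite ler_pM2l.
Qed.

End Condensation.

(** Either the terms are eventually at most 1 and the truncation changes only finitely many of them,
    or infinitely many truncated terms equal 1. It is used because [rho] is capped at [1 / H]. *)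
Lemma sum_min_unbounded (R : realType) (x : nat -> R) :
  (forall u, 0 <= x u) -> (forall B, exists t, B <= \sum_(u < t) x u) ->
  forall B, exists t, B <= \sum_(u < t) Num.min 1 (x u).
Proof.
move=> x0 div B.
have [[u1 small]|large] := pselect (exists u1, forall u, (u1 <= u)%N -> x u <= 1).
  have [t0 ht0] := div (\sum_(u < u1) x u + B).
  exists (u1 + t0)%N.
  apply: (@le_trans _ _ (\sum_(u1 <= u < u1 + t0) x u)).
    have h : \sum_(u < t0) x u <= \sum_(u < u1 + t0) x u.
      rewrite -!(big_mkord predT) [leRHS](big_cat_nat (n := t0)) ?leq_addl //= lerDl sumr_ge0 //.
    have h2 : \sum_(u < u1 + t0) x u = \sum_(u < u1) x u + \sum_(u1 <= u < u1 + t0) x u.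
      by rewrite -!(big_mkord predT) [LHS](big_cat_nat (n := u1)) ?leq_addr.
    lra.
  rewrite -(big_mkord predT (fun u => Num.min 1 (x u))).
  rewrite [leRHS](big_cat_nat (n := u1)) ?leq_addr //=.
  have -> : \sum_(u1 <= u < u1 + t0) x u = \sum_(u1 <= u < u1 + t0) Num.min 1 (x u).
    by apply: eq_big_nat => u /andP[u1u _]; rewrite min_r // small.
  by rewrite lerDr sumr_ge0 // => u _; rewrite le_min ler01 x0.
have step n : exists t, n%:R <= \sum_(u < t) Num.min 1 (x u).
  elim: n => [|n [t ht]]; first by exists 0%N; rewrite big_ord0.
  have [u [tu xu]] : exists u, (t <= u)%N /\ 1 < x u.
    apply: contrapT => h; apply: large; exists t => u tu; rewrite leNgt; apply/negP => xu.
    by apply: h; exists u.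
  exists u.+1; rewrite big_ord_recr /= min_l ?(ltW xu) // -natr1 lerD2r; apply: (le_trans ht).
  rewrite -!(big_mkord predT (fun u => Num.min 1 (x u))) [leRHS](big_cat_nat (n := t)) //= lerDl.
  by rewrite sumr_ge0 // => v _; rewrite le_min ler01 x0.
have [t ht] := step (Num.truncn B).+1; exists t; apply: le_trans ht.
exact/ltW/truncnS_gt.
Qed.

(** * From lattice points to the top rows *)

Section Supnorm.
Variables (R : realType) (k : nat).
Implicit Types x : 'I_k -> R.

Lemma supnorm_le x c : 0 <= c -> (forall i, `|x i| <= c) -> supnorm x <= c.
Proof. by move=> c0 h; apply: bigmax_le. Qed.

Lemma le_supnorm x i : `|x i| <= supnorm x.
Proof. exact: (le_bigmax _ (fun i => `|x i|)). Qed.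

Lemma supnorm_ge0 x : 0 <= supnorm x.
Proof. by rewrite /supnorm; elim/big_rec: _ => // i y _ y0; rewrite le_max y0 orbT. Qed.

End Supnorm.

Section Root.
Variables (R : realType) (m : nat).
Hypothesis m0 : (0 < m)%N.

Definition rt (x : R) : R := x `^ (m%:R)^-1.

Lemma rtK x : 0 <= x -> rt x ^+ m = x.
Proof.
move=> x0; rewrite /rt -powR_mulrn ?powR_ge0 // -powRrM mulVf ?powRr1 //.
by rewrite pnatr_eq0 -lt0n.
Qed.

Lemma rt_gt0 x : 0 < x -> 0 < rt x. Proof. exact: powR_gt0. Qed.

Lemma le_rt x y : 0 <= x -> 0 <= y -> x ^+ m <= y -> x <= rt y.
Proof.
move=> x0 y0 h; rewrite leNgt; apply/negP => h'.
have : rt y ^+ m < x ^+ m by rewrite ltrXn2r ?powR_ge0 // gtn_eqF.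
by rewrite rtK // ltNge h.
Qed.

End Root.

Section Lattice.
Variables (R : realType) (m n : nat) (psi : R -> R) (K : R).
Hypothesis m0 : (0 < m)%N.
Hypothesis n0 : (0 < n)%N.
Hypothesis psi0 : forall x, 1 <= x -> 0 < psi x.
Hypothesis psi_le : forall x y, 1 <= x -> x <= y -> psi y <= psi x.
Hypothesis K1 : 1 <= K.
Let d := (m + n)%N.

Definition lam (A : 'M[R]_(m + n)) : R := `|\det A| `^ (- ((m + n)%:R)^-1).

Definition lat (A : 'M[R]_(m + n)) (k : 'I_(m + n) -> int) : 'I_(m + n) -> R :=
  fun i => lam A * \sum_j A i j * (k j)%:~R.

(** Invertibility with explicit bounds. Every invertible matrix is regular for all large natural
    numbers [K], which gives a countable exhaustion. *)
Definition regular (A : 'M[R]_(m + n)) := [/\ forall i j, `|A i j| <= K, K^-1 <= lam A, lam A <= K &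
  exists2 A' : 'M[R]_(m + n), A' *m A = 1%:M & forall i j, `|A' i j| <= K].

(** Bounds, in sup norm, both the map from integer coordinates to lattice vectors and its
    inverse. *)
Definition K2 : R := d%:R * K ^+ 2.

Let K0 : 0 < K. Proof. exact: lt_le_trans K1. Qed.

Lemma K2_ge1 : 1 <= K2.
Proof.
rewrite /K2 -[leLHS]mulr1; apply: ler_pM => //; last by rewrite exprn_ege1.
by rewrite ler1n addn_gt0 m0.
Qed.

Lemma lat_le A k B : regular A -> (forall j, `|(k j)%:~R : R| <= B) ->
  forall i, `|lat A k i| <= K2 * B.
Proof.
move=> [AK l1 l2 _] kB i; have l0 : 0 <= lam A by rewrite powR_ge0.
rewrite /lat normrM (ger0_norm l0).
have -> : K2 * B = K * (d%:R * (K * B)) by rewrite /K2; ring.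
apply: ler_pM => //; apply: (le_trans (ler_norm_sum _ _ _)).
rewrite -[d in leRHS]card_ord mulr_natl -sumr_const; apply: ler_sum => j _.
by rewrite normrM ler_pM.
Qed.

Lemma coord_le A k B : regular A -> (forall i, `|lat A k i| <= B) ->
  forall j, `|(k j)%:~R : R| <= K2 * B.
Proof.
move=> [AK l1 l2 [A' A'A A'K]] lB j.
have l0 : 0 < lam A by apply: lt_le_trans l1; rewrite invr_gt0.
pose c : 'cV[R]_(m + n) := \col_j (k j)%:~R.
have cE : c = A' *m (A *m c) by rewrite mulmxA A'A mul1mx.
have -> : (k j)%:~R = \sum_i A' j i * ((lam A)^-1 * lat A k i).
  transitivity (c j ord0); first by rewrite mxE.
  rewrite cE mxE; apply: eq_bigr => i _; congr (_ * _).
  rewrite mxE /lat mulKf ?gt_eqF //; apply: eq_bigr => l _; by rewrite mxE.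
apply: (le_trans (ler_norm_sum _ _ _)).
have -> : K2 * B = d%:R * (K * (K * B)) by rewrite /K2; ring.
rewrite -[d in leRHS]card_ord mulr_natl -sumr_const; apply: ler_sum => i _.
rewrite !normrM -[`|lam A| * _]normrM; apply: ler_pM => //; apply: ler_pM => //; last exact: lB.
by rewrite gtr0_norm ?invr_gt0 // -[leRHS]invrK lef_pV2 ?posrE ?invr_gt0.
Qed.

(* Top rows of [A k] of size at most [3 * Nl m u * rho u] give a lattice vector [v] with
   [|v^(m)| ^ m <= psi (|v_(n)| ^ n)], because [|v_(n)| <= K2 * Nl m u]. *)
Definition rho u : R := Num.min (1 / (Hl m n u)%:R)
  (rt m (psi ((K2 * (Nl m u)%:R) ^+ n)) / (3 * K * (Nl m u)%:R)).

Lemma K2N_ge1 u : 1 <= (K2 * (Nl m u)%:R) ^+ n.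
Proof.
apply: exprn_ege1; rewrite -[leLHS]mulr1; apply: ler_pM => //; first exact: K2_ge1.
by rewrite ler1n Nl_gt0.
Qed.

Lemma rho_bound u : 0 < rho u <= 1 / (Hl m n u)%:R.
Proof.
rewrite /rho ge_min lexx lt_min !divr_gt0 ?ltr0n ?Hl_gt0 //=.
  by rewrite rt_gt0 // psi0 // K2N_ge1.
by rewrite !mulr_gt0 // ltr0n Nl_gt0.
Qed.

(** The lower bound on [|k_j0|] makes the lattice vector long, and its top part stays below [3 K],
    so it is the bottom part that exceeds every [T]. *)
Lemma approximable_of_points A E j0 : (0 < E)%N -> regular A ->
  (forall u1, exists2 u, (u1 <= u)%N & exists k : 'I_(m + n) -> int,
     [/\ forall j, `|(k j)%:~R : R| <= (Nl m u)%:R, (Nl m u)%:R <= E%:R * `|(k j0)%:~R : R| &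
         forall i : 'I_m, `|\sum_j A (lshift n i) j * (k j)%:~R| <= 3 * (Nl m u)%:R * rho u]) ->
  approximable m n psi (lattice_of A).
Proof.
move=> E0 reg pts T; have [AK l1 l2 _] := reg.
have l0 : 0 < lam A by apply: lt_le_trans l1; rewrite invr_gt0.
(* [3 K] dominates the top part, [T] is the length asked for, and 1 keeps the argument of [psi] in
   its domain. *)
pose B := Num.max 1 (Num.max T (3 * K)).
have [u1 hu1] := pow2_ge (E%:R * (K2 * B) + 1).
have [u u1u [k [kN kj kA]]] := pts u1.
have NR : 0 < (Nl m u)%:R :> R by rewrite ltr0n Nl_gt0.
have HR : 0 < (Hl m n u)%:R :> R by rewrite ltr0n Hl_gt0.
have ER : 0 < E%:R :> R by rewrite ltr0n.
have top i : `|lat A k (lshift n i)| <= 3 * K * (Nl m u)%:R * rho u.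
  rewrite /lat normrM gtr0_norm //.
  have -> : 3 * K * (Nl m u)%:R * rho u = K * (3 * (Nl m u)%:R * rho u) by ring.
  by apply: ler_pM => //; exact: ltW.
have KN0 : 0 < 3 * K * (Nl m u)%:R by rewrite !mulr_gt0.
have top1 i : `|lat A k (lshift n i)| <= 3 * K.
  apply: (le_trans (top i)); apply: (@le_trans _ _ (3 * K * (Nl m u)%:R * (1 / (Hl m n u)%:R))).
    by rewrite ler_pM2l // /rho ge_min lexx.
  by rewrite mulrA mulr1 -mulrA ler_piMr ?mulr_ge0 ?(ltW K0) // ler_pdivrMr // mul1r ler_nat Nl_le_Hl.
have top2 i : `|lat A k (lshift n i)| <= rt m (psi ((K2 * (Nl m u)%:R) ^+ n)).
  apply: (le_trans (top i)); rewrite mulrC -ler_pdivlMr //.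
  by rewrite /rho ge_min lexx orbT.
have big : B < supnorm (vbot (lat A k)).
  rewrite ltNge; apply/negP => small.
  have hB i : `|lat A k i| <= B.
    case: (split_ordP i) => i' ->.
      by apply: (le_trans (top1 i')); rewrite /B !le_max lexx !orbT.
    by apply: le_trans small; exact: (le_supnorm (vbot (lat A k)) i').
  have := coord_le reg hB j0 => h.
  have : (Nl m u)%:R <= E%:R * (K2 * B) by apply: (le_trans kj); rewrite ler_pM2l.
  have := hu1 _ u1u; have : (2 ^ u)%:R <= (Nl m u)%:R :> R by rewrite ler_nat le_2_Nl.
  lra.
have B1 : 1 <= B by rewrite /B le_max lexx.
have BT : T <= B by rewrite /B !le_max lexx orbT.
exists (lat A k); first by exists k.
split; first exact: le_lt_trans BT big.
have b1 : 1 <= supnorm (vbot (lat A k)) by rewrite (le_trans B1) // ltW.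
have bN : supnorm (vbot (lat A k)) <= K2 * (Nl m u)%:R.
  apply: supnorm_le => [|i]; last exact: lat_le.
  by rewrite mulr_ge0 ?(ltW NR) // (le_trans _ K2_ge1).
apply: (@le_trans _ _ (psi ((K2 * (Nl m u)%:R) ^+ n))).
  have p0 : 0 <= psi ((K2 * (Nl m u)%:R) ^+ n) by rewrite ltW // psi0 // K2N_ge1.
  rewrite -[leRHS](rtK m0) //; apply: lerXn2r; rewrite ?nnegrE ?supnorm_ge0 ?powR_ge0 //.
  by apply: supnorm_le; [exact: powR_ge0|exact: top2].
apply: psi_le; first exact: exprn_ege1.
by apply: lerXn2r; rewrite ?nnegrE ?(le_trans ler01) // (le_trans b1).
Qed.

(** For a long enough vector the top part is smaller than the bottom part, so the latter is the full
    norm and is comparable to [|k|]. The guard [K2 <= Nl m s] keeps the argument of [psi] at least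
    1. *)
Lemma points_of_approximable A : regular A -> approximable m n psi (lattice_of A) ->
  forall s0, exists s, (s0 <= s)%N /\ exists k : 'I_(m + n) -> int,
     [/\ forall j, `|(k j)%:~R : R| <= (Nl m s.+1)%:R, exists j, (Nl m s)%:R <= `|(k j)%:~R : R| &
         (K2 <= (Nl m s)%:R) -> forall i : 'I_m, `|\sum_j A (lshift n i) j * (k j)%:~R|
            <= K * rt m (psi (((Nl m s)%:R / K2) ^+ n))].
Proof.
move=> reg app s0; have [AK l1 l2 _] := reg.
have K21 := K2_ge1; have K20 : 0 < K2 by apply: lt_le_trans K21.
have l0 : 0 < lam A by apply: lt_le_trans l1; rewrite invr_gt0.
(* The root of [psi 1] bounds every admissible top part, and [K2 * Nl m s0] forces [|k|] beyond
   level [s0]. *)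
pose T := Num.max (Num.max 1 (rt m (psi 1))) (K2 * (Nl m s0)%:R).
have [v [k ->] [Tb tb]] := app T.
have {}Tb : T < supnorm (vbot (lat A k)) by [].
have {}tb : supnorm (vtop (lat A k)) ^+ m <= psi (supnorm (vbot (lat A k)) ^+ n) by [].
set bt := supnorm _ in Tb tb; set tp := supnorm _ in tb.
have b1 : 1 <= bt by rewrite (le_trans _ (ltW Tb)) // /T !le_max lexx.
have bn1 : 1 <= bt ^+ n by exact: exprn_ege1.
have psib : psi (bt ^+ n) <= psi 1 by exact: psi_le.
have tpb : tp <= bt.
  apply: (@le_trans _ _ (rt m (psi 1))); last by rewrite (le_trans _ (ltW Tb)) // /T !le_max lexx !orbT.
  by apply: le_rt => //; [exact: supnorm_ge0|exact/ltW/psi0|exact: le_trans psib].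
have all_b i : `|lat A k i| <= bt.
  case: (split_ordP i) => i' ->.
    by apply: le_trans tpb; exact: (le_supnorm (vtop (lat A k)) i').
  exact: (le_supnorm (vbot (lat A k)) i').
have kb := coord_le reg all_b.
have [j hj] := exists_max (fun l => `|(k l)%:~R : R|) (Ordinal (leq_trans m0 (leq_addr n m))).
have bk : bt <= K2 * `|(k j)%:~R|.
  apply: supnorm_le => [|i]; first by rewrite mulr_ge0 // ltW.
  exact: (lat_le reg hj).
have kbig : (Nl m s0)%:R < `|(k j)%:~R : R|.
  rewrite -(ltr_pM2l K20); apply: lt_le_trans bk; apply: le_lt_trans Tb.
  by rewrite /T le_max lexx orbT.
have ex : exists t, `|(k j)%:~R : R| <= (Nl m t)%:R.
  have [t ht] := pow2_ge `|(k j)%:~R : R|; exists t; apply: (le_trans (ht t (leqnn t))).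
  by rewrite ler_nat le_2_Nl.
have [t tP tmin] := ex_minnP ex.
have ts0 : (s0 < t)%N.
  rewrite ltnNge; apply/negP => h.
  have : (Nl m t)%:R <= (Nl m s0)%:R :> R by rewrite ler_nat leq_exp2l // leq_mul2l h orbT.
  by move=> /(le_trans tP); rewrite leNgt kbig.
case: t tP tmin ts0 => // s tP tmin; rewrite ltnS => s0s.
have ks : (Nl m s)%:R <= `|(k j)%:~R : R|.
  by rewrite leNgt; apply/negP => /ltW/tmin; rewrite ltnn.
exists s; split=> //; exists k; split.
- by move=> l; apply: le_trans tP.
- by exists j.
move=> K2N i.
have arg1 : 1 <= (Nl m s)%:R / K2 by rewrite ler_pdivlMr // mul1r.
have Nb : (Nl m s)%:R / K2 <= bt.
  by rewrite ler_pdivrMr // mulrC; apply: (le_trans ks); exact: kb.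
have h1 : tp <= rt m (psi (((Nl m s)%:R / K2) ^+ n)).
  apply: le_rt => //; [exact: supnorm_ge0|by rewrite ltW // psi0 // exprn_ege1|].
  apply: (le_trans tb); apply: psi_le; first exact: exprn_ege1.
  by apply: lerXn2r; rewrite ?nnegrE ?(le_trans ler01).
have h2 : `|lat A k (lshift n i)| <= tp by exact: (le_supnorm (vtop (lat A k)) i).
have -> : \sum_j A (lshift n i) j * (k j)%:~R = (lam A)^-1 * lat A k (lshift n i).
  by rewrite /lat mulKf // gt_eqF.
rewrite normrM; apply: ler_pM => //; last exact: le_trans h1.
by rewrite gtr0_norm ?invr_gt0 // -[leRHS]invrK lef_pV2 ?posrE ?invr_gt0.
Qed.

End Lattice.

(** * Matrices as functions, basis columns and regular classes *)

Lemma mx_null_of_null (R : realType) (d : nat) (N : set 'M[R]_d) :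
  null [set x : 'I_d * 'I_d -> R | exists2 A, N A & x = fun p => A p.1 p.2] -> mx_null N.
Proof.
move=> nN eps e0; have [a [b [ab cov sm]]] := nN _ e0.
exists (fun l => \matrix_(i, j) a l (i, j)), (fun l => \matrix_(i, j) b l (i, j)).
split; first by move=> l i j; rewrite !mxE.
split.
  move=> A NA; have [|l _ h] := cov (fun p => A p.1 p.2); first by exists A.
  by exists l => // i j; rewrite !mxE; exact: (h (i, j)).
move=> K; apply: le_trans (sm K); rewrite le_eqVlt; apply/orP; left; apply/eqP.
apply: eq_bigr => l _; rewrite /vol pair_big /=.
by apply: eq_bigr => -[i j] _; rewrite !mxE.
Qed.

(** The top rows of an invertible matrix have rank [m], so some [m] columns of them form a basis;
    since [n > 0] a column [j0] is left over. [Z] is the inverse of the chosen block, transposed. *)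
Lemma basis_columns (R : realType) (m n : nat) (A : 'M[R]_(m + n)) : (0 < n)%N -> \det A != 0 ->
  exists (j0 : 'I_(m + n)) (f : {ffun 'I_m -> 'I_(m + n)}) (Z : 'M[R]_m),
  [/\ injective f, forall l, f l != j0 &
     forall (c : 'I_m -> R) l, c l = \sum_i Z l i * \sum_l' c l' * A (lshift n i) (f l')].
Proof.
move=> n0 dA; have uA : A \in unitmx by rewrite unitmxE unitfE.
have fA : row_full (usubmx A)^T.
  rewrite /row_full mxrank_tr eqn_leq rank_leq_row /=.
  have := mxrank_unit uA; rewrite -{1}[A]vsubmxK => rA.
  have : (\rank (col_mx (usubmx A) (dsubmx A)) <= \rank (usubmx A) + \rank (dsubmx A))%N.
    by rewrite -addsmxE; exact: (mxrank_adds_leqif _ _).1.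
  rewrite rA => h; rewrite -(leq_add2r n); apply: (leq_trans h).
  by rewrite leq_add2l rank_leq_row.
pose f := fullrankfun fA; have fi : injective f := @fullrankfun_inj _ _ _ _ fA.
pose B := rowsub f (usubmx A)^T; have uB : B \in unitmx := fullrowsub_unit fA.
have [j0 hj0] : exists j0, j0 \notin codom f.
  apply/existsP; rewrite -negb_forall; apply/negP => /forallP h.
  have : (#|'I_(m + n)| <= #|codom f|)%N by apply: subset_leq_card; apply/fintype.subsetP => j _.
  by rewrite card_codom // !card_ord leqNgt -[X in (X < _)%N]addn0 ltn_add2l n0.
exists j0, f, (\matrix_(l, i) invmx B i l); split=> // [l|c l].
  by apply: contra hj0 => /eqP <-; exact: codom_f.
pose cv : 'rV[R]_m := \row_l c l.
have e : cv = cv *m B *m invmx B by rewrite mulmxK.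
transitivity (cv ord0 l); first by rewrite mxE.
rewrite e mxE; apply: eq_bigr => i _; rewrite !mxE mulrC; congr (_ * _).
by apply: eq_bigr => l' _; rewrite !mxE.
Qed.

Lemma regular_ex (R : realType) (m n : nat) (A : 'M[R]_(m + n)) : \det A != 0 ->
  exists K0 : nat, forall K : nat, (K0 <= K)%N -> regular K%:R A.
Proof.
move=> dA; have uA : A \in unitmx by rewrite unitmxE unitfE.
have [c1 c10 h1] := exists_bound (fun p : 'I_(m + n) * 'I_(m + n) => `|A p.1 p.2|).
have [c2 c20 h2] := exists_bound (fun p : 'I_(m + n) * 'I_(m + n) => `|invmx A p.1 p.2|).
have l0 : 0 < lam A by rewrite powR_gt0 // normr_gt0.
have [K0 [K00 hK]] := exists_natR (c1 + c2 + lam A + (lam A)^-1).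
have li : 0 < (lam A)^-1 by rewrite invr_gt0.
exists K0 => K K0K.
have hK' : c1 + c2 + lam A + (lam A)^-1 <= K%:R by apply: (le_trans hK); rewrite ler_nat.
have KR : 0 < K%:R :> R by lra.
split.
- by move=> i j; apply: (le_trans (h1 (i, j))); lra.
- rewrite -[leRHS]invrK lef_pV2 ?posrE //; lra.
- lra.
- exists (invmx A); first exact: mulVmx.
  by move=> i j; apply: (le_trans (h2 (i, j))); lra.
Qed.

(** * The volume series expressed through [psi] *)

Section Sums.
Variables (R : realType) (m n : nat) (psi : R -> R).
Hypothesis m0 : (0 < m)%N.
Hypothesis n0 : (0 < n)%N.
Hypothesis psi0 : forall x, 1 <= x -> 0 < psi x.
Hypothesis psi_le : forall x y, 1 <= x -> x <= y -> psi y <= psi x.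
Hypothesis psic : {within [set x : R | 1 <= x], continuous psi}.

(** Since [H ^ m = N ^ m N ^ n], the uncapped term is [N ^ n psi ((K2 N) ^ n) / (3 K) ^ m]. Along
    the levels [L (u + u0)] the number [N ^ n] is geometric with ratio [q = 2 ^ (m L n)], so
    condensation applies. *)
Lemma sum_rho_unbounded (K : R) : 1 <= K ->
  (\int[lebesgue_measure]_(x in [set x : R | (1 <= x)%R]) (psi x)%:E = +oo)%E ->
  forall L u0 (B : R), (0 < L)%N -> exists t : nat,
     B <= \sum_(u < t) (rho m n psi K (L * (u + u0))%N * (Hl m n (L * (u + u0)))%:R) ^+ m.
Proof.
move=> K1 div L u0 B L0.
have K0 : 0 < K by apply: lt_le_trans K1.
pose q : R := (2 ^ (m * L * n))%:R.
have q1 : 2 <= q.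
  by rewrite /q (ler_nat R 2) -[2%N]expn1 leq_exp2l // !muln_gt0 m0 n0 L0.
have q0 : 0 < q by apply: lt_le_trans q1.
have K21 := K2_ge1 n m0 K1.
pose be : R := K2 m n K ^+ n * q ^+ u0.
have be1 : 1 <= be.
  rewrite /be -[leLHS]mulr1; apply: ler_pM => //; first exact: exprn_ege1.
  by apply: exprn_ege1; apply: le_trans q1; rewrite ler1n.
pose c : R := q ^+ u0 / (3 * K) ^+ m.
have c0 : 0 < c by rewrite divr_gt0 // exprn_gt0 // mulr_gt0.
pose x u : R := c * (q ^+ u * psi (be * q ^+ u)).
have beq u : 1 <= be * q ^+ u.
  rewrite -[leLHS]mulr1; apply: ler_pM => //.
  by apply: exprn_ege1; apply: le_trans q1; rewrite ler1n.
have x0 u : 0 <= x u.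
  by apply: mulr_ge0; [exact: ltW|apply: mulr_ge0; [exact/exprn_ge0/ltW|exact/ltW/psi0]].
have xdiv B' : exists t, B' <= \sum_(u < t) x u.
  apply: contrapT => h.
  have : (\int[lebesgue_measure]_(x in [set x : R | (1 <= x)%R]) (psi x)%:E < +oo)%E.
    apply: (@condensation_fin R psi be q psi0 psi_le psic be1 q1 (B' / c)) => t.
    rewrite leNgt; apply/negP => h'; apply: h; exists t.
    by rewrite /x -mulr_sumr mulrC -ler_pdivrMr // ltW.
  by rewrite div ltxx.
have [t ht] := sum_min_unbounded x0 xdiv B.
exists t; apply: (le_trans ht); apply: ler_sum => u _.
set v := (L * (u + u0))%N.
have NR : 0 < (Nl m v)%:R :> R by rewrite ltr0n Nl_gt0.
have HR : 0 < (Hl m n v)%:R :> R by rewrite ltr0n Hl_gt0.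
have Nq : (Nl m v)%:R ^+ n = q ^+ u0 * q ^+ u.
  rewrite -exprD -!natrX /Nl -!expnM.
  by have -> // : (m * v * n = m * L * n * (u0 + u))%N by rewrite /v [(u + u0)%N]addnC mulnA mulnAC.
have argE : (K2 m n K * (Nl m v)%:R) ^+ n = be * q ^+ u by rewrite exprMn Nq /be mulrA.
have p0 : 0 < psi (be * q ^+ u) by exact: psi0.
rewrite /rho argE; set g := rt m _ / _.
have gE : (g * (Hl m n v)%:R) ^+ m = x u.
  have HmE : (Hl m n v)%:R ^+ m = (Nl m v)%:R ^+ m * (Nl m v)%:R ^+ n :> R.
    by rewrite -exprD -!natrX Hl_pow.
  rewrite exprMn /g expr_div_n rtK ?(ltW p0) // HmE Nq [(_ * (Nl m v)%:R) ^+ m]exprMn /x /c.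
  have : (Nl m v)%:R ^+ m != 0 :> R by rewrite expf_neq0 // gt_eqF.
  have : (3 * K) ^+ m != 0 by rewrite expf_neq0 // gt_eqF // mulr_gt0.
  set X := (3 * K) ^+ m; set Y := (Nl m v)%:R ^+ m => X0 Y0.
  by field; rewrite X0 Y0.
have [h|h] := leP (1 / (Hl m n v)%:R) g.
  by rewrite divfK ?gt_eqF // expr1n ge_min lexx.
by rewrite gE ge_min lexx orbT.
Qed.

(** From [s1] on, the terms are a constant times those of the condensed series. Below [s1] the
    argument of [psi] might be less than 1; the radius is set to 1 there, and these finitely many
    terms only change the bound. *)
Lemma sum_shell_bounded (K : R) : 1 <= K ->
  (\int[lebesgue_measure]_(x in [set x : R | (1 <= x)%R]) (psi x)%:E < +oo)%E ->
  exists s1 B, (forall s, (s1 <= s)%N -> K2 m n K <= (Nl m s)%:R) /\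
    forall t, \sum_(s < t) (3 * (Nl m s.+1)%:R) ^+ (m + n) *
      ((if (s1 <= s)%N then K * rt m (psi (((Nl m s)%:R / K2 m n K) ^+ n)) else 1) / (Nl m s)%:R) ^+ m <= B.
Proof.
move=> K1 fin.
have K0 : 0 < K by apply: lt_le_trans K1.
have K21 := K2_ge1 n m0 K1; have K20 : 0 < K2 m n K by apply: lt_le_trans K21.
have [s1 hs1] := pow2_ge (K2 m n K).
have Ns1 s : (s1 <= s)%N -> K2 m n K <= (Nl m s)%:R.
  by move=> /hs1 h; apply: (le_trans h); rewrite ler_nat le_2_Nl.
have NR s : 0 < (Nl m s)%:R :> R by rewrite ltr0n Nl_gt0.
pose q : R := (2 ^ (m * n))%:R.
have q1 : 2 <= q by rewrite /q (ler_nat R 2) -[2%N]expn1 leq_exp2l // muln_gt0 m0 n0.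
have q0 : 0 < q by apply: lt_le_trans q1.
pose be : R := ((Nl m s1)%:R / K2 m n K) ^+ n.
have be1 : 1 <= be by apply: exprn_ege1; rewrite ler_pdivlMr // mul1r Ns1.
have [B hB] := condensation_bound psi0 psi_le psic be1 q1 fin.
pose v s : R := (3 * (Nl m s.+1)%:R) ^+ (m + n) *
      ((if (s1 <= s)%N then K * rt m (psi (((Nl m s)%:R / K2 m n K) ^+ n)) else 1) / (Nl m s)%:R) ^+ m.
have v0 s : 0 <= v s.
  apply: mulr_ge0; first by rewrite exprn_ge0 // mulr_ge0.
  rewrite exprn_ge0 // divr_ge0 //; case: ifP => // _; rewrite mulr_ge0 ?powR_ge0 // ltW //.
pose C : R := (3 * (2 ^ m)%:R) ^+ (m + n) * K ^+ m * q ^+ s1.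
have C0 : 0 <= C by rewrite /C !mulr_ge0 ?exprn_ge0 ?mulr_ge0 // ltW.
have vE s : v (s1 + s)%N = C * (q ^+ s * psi (be * q ^+ s)).
  have Nq : (Nl m (s1 + s))%:R ^+ n = q ^+ s1 * q ^+ s.
    rewrite -exprD -!natrX /Nl -!expnM.
    by have -> // : (m * (s1 + s) * n = m * n * (s1 + s))%N by rewrite mulnAC.
  have argE : ((Nl m (s1 + s))%:R / K2 m n K) ^+ n = be * q ^+ s.
    rewrite /be !expr_div_n Nq mulrAC; congr (_ * _ * _).
    by rewrite -!natrX /Nl -!expnM mulnAC.
  have p0 : 0 <= psi (be * q ^+ s).
    rewrite ltW // psi0 // -[leLHS]mulr1; apply: ler_pM => //.
    by apply: exprn_ege1; apply: le_trans q1; rewrite ler1n.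
  rewrite /v leq_addr argE expr_div_n exprMn [(K * rt _ _) ^+ m]exprMn rtK // /C.
  have -> : (Nl m (s1 + s).+1)%:R = (2 ^ m)%:R * (Nl m (s1 + s))%:R :> R.
    by rewrite -natrM -expnD /Nl mulnS.
  rewrite [(_ * (Nl m (s1 + s))%:R) ^+ (m + n)]exprMn [(Nl m (s1 + s))%:R ^+ (m + n)]exprD Nq.
  rewrite [(3 * _) ^+ (m + n)]exprMn.
  have : (Nl m (s1 + s))%:R ^+ m != 0 :> R by rewrite expf_neq0 // gt_eqF.
  set Y := (Nl m _)%:R ^+ m => Y0; set X := 3 ^+ _; set X' := (2 ^ m)%:R ^+ _; set X'' := K ^+ m.
  by field.
exists s1, (\sum_(s < s1) v s + C * B); split=> // t.
apply: (@le_trans _ _ (\sum_(s < s1 + t) v s)).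
  rewrite -!(big_mkord predT v) [leRHS](big_cat_nat (n := t)) ?leq_addl //= lerDl sumr_ge0 //.
have -> : \sum_(s < s1 + t) v s = \sum_(s < s1) v s + \sum_(s < t) v (s1 + s)%N.
  elim: t => [|t IH]; first by rewrite big_ord0 addr0 addn0.
  by rewrite addnS big_ord_recr /= IH big_ord_recr /= addrA.
rewrite lerD2l; under eq_bigr do rewrite vE.
by rewrite -mulr_sumr ler_wpM2l.
Qed.

End Sums.

(** * The divergence and convergence halves *)

Lemma null_not_approximable (R : realType) (m n : nat) (psi : R -> R) :
  (0 < m)%N -> (0 < n)%N ->
  (forall x : R, 1 <= x -> 0 < psi x) ->
  (forall x y : R, 1 <= x -> x <= y -> psi y <= psi x) ->
  {within [set x : R | 1 <= x], continuous psi} ->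
  (\int[lebesgue_measure]_(x in [set x : R | (1 <= x)%R]) (psi x)%:E = +oo)%E ->
  mx_null [set A : 'M[R]_(m + n) | \det A != 0 /\ ~ approximable m n psi (lattice_of A)].
Proof.
move=> m0 n0 psi0 psi_le psic div; apply: mx_null_of_null.
have j1 : 'I_(m + n) := Ordinal (leq_trans m0 (leq_addr n m)).
(* The classes: a bound [K], a column [j0] and a map [f] selecting basis columns. *)
pose T : countType := (nat * 'I_(m + n) * {ffun 'I_m -> 'I_(m + n)})%type.
pose G (t : T) := let K : R := t.1.1%:R in let j0 := t.1.2 in let f := t.2 in
  [set x : 'I_(m + n) * 'I_(m + n) -> R | exists A : 'M[R]_(m + n),
    [/\ x = (fun p => A p.1 p.2), 1 <= K /\ regular K A, ~ approximable m n psi (lattice_of A),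
      injective f /\ (forall l, f l != j0) &
      exists2 Z : 'I_m -> 'I_m -> R, forall l i, `|Z l i| <= K &
        forall (c : 'I_m -> R) l, c l = \sum_i Z l i * \sum_l' c l' * A (lshift n i) (f l')]].
apply: (@null_sub _ _ [set x | exists t : T, G t x]).
  move=> _ [A [dA nA] ->].
  have [j0 [f [Z [fi fj0 ZE]]]] := basis_columns n0 dA.
  have [k1 hk1] := regular_ex dA.
  have [c c0 hc] := exists_bound (fun p : 'I_m * 'I_m => `|Z p.1 p.2|).
  have [k2 [k20 hk2]] := exists_natR c.
  have kk : (k2 <= maxn k1 k2)%N by rewrite leq_max leqnn orbT.
  exists (maxn k1 k2, j0, f); exists A; split=> //=.
    split; first by rewrite ler1n (leq_trans k20).
    by apply: hk1; rewrite leq_max leqnn.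
  exists (fun l i => Z l i) => // l i; apply: (le_trans (hc (l, i))).
  by apply: (le_trans hk2); rewrite ler_nat.
apply: (null_bigcup_count ((j1, j1) : 'I_(m + n) * 'I_(m + n))) => -[[k j0] f].
set K : R := k%:R.
have [[K1 [fi fj0]]|no] := pselect (1 <= K /\ injective f /\ forall l, f l != j0); last first.
  apply: (@null_sub _ _ set0); last exact: (@null0 _ _ (j1, j1)).
  by move=> x [A [_ [K1 _] _ [fi fj0] _]]; apply: no.
have [E [E0 hE]] := null_missing m0 n0 fi fj0 K1.
have hmis u1 : null (missing j0 f K E (rho m n psi K) u1).
  apply: hE => [u|L u0 B L0]; first exact: rho_bound.
  exact: sum_rho_unbounded.
apply: null_sub (nullU ((j1, j1) : 'I_(m + n) * 'I_(m + n)) (null_ND m0 n0 K1 j0) (null_bigcup hmis)).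
move=> x [A [xE [_ reg] napp _ [Z ZK ZE]]].
have xK p : `|x p| <= K by rewrite xE; case: reg.
have [[u1 hu1]|nND] := pselect (exists u1, forall u, (u1 <= u)%N -> forall s : {ffun 'I_(m + n) -> 'I_(2 * Nl m u).+1},
       zr R (s j0) = 0 -> (exists j, zr R (s j) != 0) ->
       exists i, C1 m n K * (Nl m u)%:R / (Hl m n u)%:R < `|tail j0 (cols x) s i|); last by left.
right.
(* Otherwise good vectors occur at arbitrarily high levels, and [approximable_of_points] contradicts
   [napp]. *)
have [u2 hu2] : exists u2, forall u, (u2 <= u)%N -> forall s : {ffun 'I_(m + n) -> 'I_(2 * Nl m u).+1},
       (Nl m u)%:R <= E%:R * `|zr R (s j0)| ->
       exists i, 3 * (Nl m u)%:R * rho m n psi K u < `|lin j0 (cols x) s (cols x j0) i|.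
  apply: contrapT => h; apply: napp.
  refine (approximable_of_points m0 psi0 psi_le K1 (E := E) (j0 := j0) E0 reg _) => u2.
  apply: contrapT => h'; apply: h; exists u2 => u u2u s sE.
  apply: contrapT => h2; apply: h'; exists u => //.
  exists (fun j => (s j)%:Z - (Nl m u)%:Z).
  have zE j : ((s j)%:Z - (Nl m u)%:Z)%:~R = zr R (s j) by rewrite zr_int.
  split; [by move=> j; rewrite zE; exact: zr_le|by rewrite zE|move=> i].
  rewrite leNgt; apply/negP => h3; apply: h2; exists i; move: h3; congr (_ < `|_|).
  rewrite /lin /tail [LHS](bigD1 j0) //= zE /cols xE /= mulrC; congr (_ + _).
  by apply: eq_bigr => j _; rewrite zE mulrC.
exists (maxn u1 u2) => //; split=> //.
- by exists Z => // c l; rewrite [LHS]ZE; apply: eq_bigr => i _; rewrite /cols xE.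
- by move=> u; rewrite geq_max => /andP[/hu1].
- by move=> u; rewrite geq_max => /andP[_ /hu2].
Qed.

Lemma null_approximable (R : realType) (m n : nat) (psi : R -> R) :
  (0 < m)%N -> (0 < n)%N ->
  (forall x : R, 1 <= x -> 0 < psi x) ->
  (forall x y : R, 1 <= x -> x <= y -> psi y <= psi x) ->
  {within [set x : R | 1 <= x], continuous psi} ->
  (\int[lebesgue_measure]_(x in [set x : R | (1 <= x)%R]) (psi x)%:E < +oo)%E ->
  mx_null [set A : 'M[R]_(m + n) | \det A != 0 /\ approximable m n psi (lattice_of A)].
Proof.
move=> m0 n0 psi0 psi_le psic fin; apply: mx_null_of_null.
have j1 : 'I_(m + n) := Ordinal (leq_trans m0 (leq_addr n m)).
pose G (k : nat) := [set x : 'I_(m + n) * 'I_(m + n) -> R | exists A : 'M[R]_(m + n),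
    [/\ x = (fun p => A p.1 p.2), 1 <= k%:R :> R, regular k%:R A & approximable m n psi (lattice_of A)]].
apply: (@null_sub _ _ (\bigcup_k G k)).
  move=> _ [A [dA appA] ->]; have [k1 hk1] := regular_ex dA.
  exists k1.+1 => //; exists A; split=> //; first by rewrite ler1n.
  by apply: hk1; exact: leqnSn.
apply: null_bigcup => k; set K : R := k%:R.
have [K1|Klt] := leP 1 K; last first.
  apply: (@null_sub _ _ set0); last exact: (@null0 _ _ (j1, j1)).
  by move=> x [A [_ K1 _ _]]; move: Klt; rewrite ltNge K1.
have K0 : 0 < K by apply: lt_le_trans K1.
have K20 : 0 < K2 m n K by apply: lt_le_trans (K2_ge1 n m0 K1).
have [s1 [B [hs1 hB]]] := sum_shell_bounded m0 n0 psi0 psi_le psic K1 fin.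
pose r s : R := if (s1 <= s)%N then K * rt m (psi (((Nl m s)%:R / K2 m n K) ^+ n)) else 1.
have NR s : 0 < (Nl m s)%:R :> R by rewrite ltr0n Nl_gt0.
have r0 s : 0 < r s.
  rewrite /r; case: ifP => // s1s; rewrite mulr_gt0 // rt_gt0 // psi0 //.
  by apply: exprn_ege1; rewrite ler_pdivlMr // mul1r hs1.
(* All vectors of the shell are taken, about [N ^ d] of them. *)
pose S s : pred (shell m n s) := fun c => [exists j, (Nl m s)%:R <= `|zr R (c j)|].
have SN s (c : shell m n s) : S s c -> exists j, (Nl m s)%:R <= `|zr R (c j)| by move=> /existsP.
have sB t : \sum_(s < t) #|S s|%:R * (r s / (Nl m s)%:R) ^+ m <= B.
  apply: le_trans (hB t); apply: ler_sum => s _; rewrite ler_wpM2r ?card_shell //.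
  by rewrite exprn_ge0 // divr_ge0 // ltW.
apply: null_sub (null_limsup m0 K1 r0 SN sB) => x [A [xE _ reg app]].
split; first by move=> p; rewrite xE; case: reg.
move=> s0; have [s [ss [c [cN cj cA]]]] := points_of_approximable m0 psi0 psi_le K1 reg app (maxn s0 s1).
have [s0s s1s] : (s0 <= s)%N /\ (s1 <= s)%N by move: ss; rewrite geq_max => /andP.
exists s; split=> //.
have cb j : (`|c j| <= Nl m s.+1)%N.
  by have := cN j; rewrite -intr_norm -abszE (ler_nat R).
(* Encoding of an integer vector in the shell: the shifted entry is nonnegative, so [absz] leaves it
   unchanged. *)
have cb' j : (absz (c j + (Nl m s.+1)%:Z)%R < (2 * Nl m s.+1).+1)%N by have := cb j; lia.
have zE j : zr R (Ordinal (cb' j)) = (c j)%:~R.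
  have h : 0 <= c j + (Nl m s.+1)%:Z by have := cb j; lia.
  by rewrite /zr /= natr_absz ger0_norm // intrD addrK.
exists [ffun j => Ordinal (cb' j)].
  by have [j hj] := cj; apply/existsP; exists j; rewrite ffunE zE.
move=> i; rewrite /r s1s; apply: le_trans (cA (hs1 _ s1s) i).
rewrite le_eqVlt; apply/orP; left; apply/eqP; congr `|_|.
by apply: eq_bigr => j _; rewrite ffunE zE xE mulrC.
Qed.

Theorem theorem8p2 (R : realType) (m n : nat) (psi : R -> R) :
  (0 < m)%N -> (0 < n)%N ->
  (forall x : R, 1 <= x -> 0 < psi x) ->
  (forall x y : R, 1 <= x -> x <= y -> psi y <= psi x) ->
  {within [set x : R | 1 <= x], continuous psi} ->
  (((\int[lebesgue_measure]_(x in [set x : R | (1 <= x)%R]) (psi x)%:E) = +oo)%E ->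
     mx_null [set A : 'M[R]_(m + n) | \det A != 0 /\
                                      ~ approximable m n psi (lattice_of A)]) /\
  (((\int[lebesgue_measure]_(x in [set x : R | (1 <= x)%R]) (psi x)%:E) < +oo)%E ->
     mx_null [set A : 'M[R]_(m + n) | \det A != 0 /\
                                      approximable m n psi (lattice_of A)]).
Proof.
move=> m0 n0 psi0 psi_le psic; split.
  exact: null_not_approximable.
exact: null_approximable.
Qed.
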